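(* Let $\mathfrak g=\mathfrak{sp}(2n,\mathbb C)$ with $n\ge1$, and identify $\mathfrak g$ with $\mathcal A^2$ and $\mathcal R$ (the algebra of polynomial functions on the minimal nilpotent coadjoint orbit) with $\mathcal A^{even}$, where $\mathcal A=\mathbb C[z_1,w_1,\dots,z_n,w_n]$. The Moyal star product (restricted to $\mathcal A^{even}$) is a $G$-equivariant graded star product on $\mathcal R$. If $n\ge2$, it corresponds to the Joseph ideal; if $n=1$, it corresponds to the ideal $J^{1/4}$ of $\mathcal U(\mathfrak{sl}(2,\mathbb C))$. The operators $\Lambda^x$ ($x\in\mathfrak g$), defined by $\mu_x\star f=\mu_xf+\frac12\{\mu_x,f\}t+\Lambda^x(f)t^2$, are order $2$ algebraic differential operators, and $$\Lambda^{z_iz_j}=\frac14\frac{\partial^2}{\partial w_i\partial w_j},\qquad \Lambda^{w_iw_j}=\frac14\frac{\partial^2}{\partial z_i\partial z_j},\qquad \Lambda^{z_iw_j}=-\frac14\frac{\partial^2}{\partial w_i\partial z_j}.$$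
   Context: $\mathcal A=\mathbb C[z_1,w_1,\dots,z_n,w_n]$ is the Poisson algebra with $\{z_i,z_j\}=\{w_i,w_j\}=0$, $\{z_i,w_j\}=\delta_{ij}$; $\mathcal A^k$ is the space of homogeneous polynomials of degree $k$. $\mathcal A^2$ is a Lie algebra under $\{\cdot,\cdot\}$ isomorphic to $\mathfrak{sp}(2n,\mathbb C)$, and $\mathcal A^{even}=\bigoplus_{k\ge0}\mathcal A^{2k}$ is identified as a graded Poisson algebra with $\mathcal R=S(\mathfrak g)/I$, $\mathcal R^k=\mathcal A^{2k}$, where $I$ is the ideal of the minimal non-zero nilpotent coadjoint orbit; the momentum function $\mu_x\in\mathcal R^1$ of $x\in\mathfrak g=\mathcal A^2$ is $x$ itself. The Moyal star product is $f\star g=\sum_{p\ge0}\frac{t^p}{2^pp!}P^p(f,g)$, where $P^p$ is the $p$-th power of the bidifferential operator $P=\sum_i(\partial_{z_i}\otimes\partial_{w_i}-\partial_{w_i}\otimes\partial_{z_i})$ applied to $f\otimes g$ followed by multiplication. $G$ is the simply-connected group with Lie algebra $\mathfrak g$. A graded star product on $\mathcal R$ is an associative $\mathbb C[t]$-linear product $\star$ on $\mathcal R[t]$ such that, writing $f\star g=\sum_{p\ge0}C_p(f,g)t^p$ for $f,g\in\mathcal R$: (i) $C_0(f,g)=fg$; (ii) $C_1(f,g)-C_1(g,f)=\{f,g\}$; (iii) $C_p(f,g)=(-1)^pC_p(g,f)$; (iv) $C_p(f,g)\in\mathcal R^{k+l-p}$ if $f\in\mathcal R^k$, $g\in\mathcal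 R^l$. It is $G$-equivariant if $\mu_x\star f-f\star\mu_x=t\{\mu_x,f\}$ for all $x\in\mathfrak g$, $f\in\mathcal R$. With $f\circ g=(f\star g)|_{t=1}$, the two-sided ideal of $\mathcal U(\mathfrak g)$ corresponding to $\star$ is the kernel of the algebra homomorphism $\mathcal U(\mathfrak g)\to(\mathcal R,\circ)$ with $x\mapsto\mu_x$. For $n\ge2$, the Joseph ideal is the unique two-sided ideal $J\subset\mathcal U(\mathfrak g)$ with $\operatorname{gr}J=I$. For $\lambda\in\mathbb C$, $J^\lambda\subset\mathcal U(\mathfrak{sl}(2,\mathbb C))$ is the kernel of the natural homomorphism to the algebra of global twisted differential operators on $\mathbb{CP}^1$ acting on local sections of the $\lambda$-th power of the canonical bundle. *)

(* Defs.v *)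
From HB Require Import structures.
From mathcomp Require Import all_boot all_order all_algebra.
From mathcomp Require Import ring_quotient.
From mathcomp Require Import boolp reals complex.
From mathcomp Require monalg mpoly.

Set Implicit Arguments.
Unset Strict Implicit.
Unset Printing Implicit Defensive.

Import GRing.Theory Num.Theory.

Local Open Scope ring_scope.

(* The universal enveloping algebra of a Lie algebra (L, br) over K, presented
   as the quotient of the free associative algebra on the set L by the ideal
   generated by
     [a x + y] - a [x] - [y]   and   [x] [y] - [y] [x] - [br x y].
   With br = 0 the same construction yields the symmetric algebra of L. *)
Module Enveloping.
Import monalg.
Local Open Scope quotient_scope.

Section Enveloping.
Variables (K : comNzRingType) (L : lmodType K) (br : L -> L -> L).

Local Notation words := {malg K[{fmonom L}]}.

Definition letter (x : L) : words := << fmu x >>.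

Definition env_rel (t : words) : Prop :=
  (exists a x y, t = letter (a *: x + y) - (a *: letter x + letter y)) \/
  (exists x y, t = letter x * letter y - letter y * letter x - letter (br x y)).

Inductive in_env_ideal : words -> Prop :=
| in_env_ideal0 : in_env_ideal 0
| in_env_idealD a r b t :
    env_rel r -> in_env_ideal t -> in_env_ideal (a * r * b + t).

Definition env_ideal : {pred words} := [pred t | `[< in_env_ideal t >]].

Lemma in_env_ideal_add t u :
  in_env_ideal t -> in_env_ideal u -> in_env_ideal (t + u).
Proof.
move=> + hu; elim=> [|a r b s hr hs IH]; first by rewrite add0r.
by rewrite -addrA; apply: in_env_idealD.
Qed.

Lemma in_env_ideal_mul c d t : in_env_ideal t -> in_env_ideal (c * t * d).
Proof.
elim=> [|a r b s hr hs IH]; first by rewrite mulr0 mul0r; apply: in_env_ideal0.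
have distr (T : nzRingType) (x y z u v w : T) :
    x * (y * z * u + v) * w = (x * y) * z * (u * w) + x * v * w.
  by rewrite mulrDr mulrDl !mulrA.
by rewrite distr; apply: in_env_idealD.
Qed.

Lemma env_ideal_zmod_closed : zmod_closed env_ideal.
Proof.
split=> [|t u]; rewrite !inE; first by apply/asboolP/in_env_ideal0.
move=> /asboolP ht /asboolP hu; apply/asboolP/in_env_ideal_add => //.
by have := in_env_ideal_mul (-1) 1 hu; rewrite mulN1r mulr1.
Qed.

HB.instance Definition _ :=
  GRing.isZmodClosed.Build _ env_ideal env_ideal_zmod_closed.

Lemma env_idealM c d t : t \in env_ideal -> c * t * d \in env_ideal.
Proof. by rewrite !inE => /asboolP ht; apply/asboolP/in_env_ideal_mul. Qed.

Lemma env_idealMl c t : t \in env_ideal -> c * t \in env_ideal.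
Proof. by move=> /(env_idealM c 1); rewrite mulr1. Qed.

Lemma env_idealMr d t : t \in env_ideal -> t * d \in env_ideal.
Proof. by move=> /(env_idealM 1 d); rewrite mul1r. Qed.

Lemma env_ideal_counit t : t \in env_ideal -> t@_mone = 0.
Proof.
have letter0 x : (letter x)@_mone = 0.
  rewrite /letter mcoeffU; case: eqP => // /(congr1 (@fmonom_val L)).
  by rewrite fm1 fmU.
have counitM (r s : words) : (r * s)@_mone = r@_mone * s@_mone :> K.
  by have [+ _] := @mcoeff1g_is_multiplicative {fmonom L} K; apply.
rewrite inE => /asboolP; elim=> [|a r b s hr _ IH]; first by rewrite mcoeff0.
rewrite mcoeffD IH addr0 !counitM.
suff -> : r@_mone = 0 by rewrite mulr0 mul0r.
case: hr => [[c [x [y ->]]]|[x [y ->]]].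
  by rewrite mcoeffB mcoeffD mcoeffZ !letter0 mulr0 !addr0 subrr.
have counitB (p q : words) : p@_mone = 0 -> q@_mone = 0 -> (p - q)@_mone = 0.
  by move=> hp hq; rewrite mcoeffB hp hq subr0.
have counit_prod p q : (letter p * letter q)@_mone = 0.
  by apply: etrans (counitM _ _) _; rewrite (letter0 p) mul0r.
apply: (counitB _ _ _ (letter0 (br x y))).
exact: (counitB _ _ (counit_prod x y) (counit_prod y x)).
Qed.

Definition env : Type := Quotient.quot env_ideal.
HB.instance Definition _ := GRing.Zmodule.on env.
HB.instance Definition _ := EqQuotient.on env.

Definition class (t : words) : env := \pi_env t.

Lemma classP t u : reflect (class t = class u) (t - u \in env_ideal).
Proof. by rewrite Quotient.idealrBE; apply: eqP. Qed.

Lemma classK u : class (repr u) = u.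
Proof. exact: reprK. Qed.

Lemma class_repr t : repr (class t) - t \in env_ideal.
Proof. by apply/classP; rewrite classK. Qed.

Lemma classD t u : class (t + u) = class t + class u.
Proof. exact: raddfD. Qed.

Definition env_one : env := class 1.
Definition env_mul (u v : env) : env := class (repr u * repr v).
Definition env_scale (a : K) (u : env) : env := class (a *: repr u).

Lemma classM t u : env_mul (class t) (class u) = class (t * u).
Proof.
apply/(classP (repr (class t) * repr (class u)) (t * u)).
have -> : repr (class t) * repr (class u) - t * u =
  repr (class t) * (repr (class u) - u) + (repr (class t) - t) * u.
  by rewrite mulrBr mulrBl addrA subrK.
by rewrite rpredD //; [apply: env_idealMl|apply: env_idealMr]; apply: class_repr.
Qed.

Lemma classZ a t : env_scale a (class t) = class (a *: t).
Proof.
apply/(classP (a *: repr (class t)) (a *: t)); rewrite -scalerBr -[X in a *: X]mul1r scalerAl.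
exact/env_idealMl/class_repr.
Qed.

Lemma env_mulA : associative env_mul.
Proof.
by move=> u v w; rewrite -(classK u) -(classK v) -(classK w) !classM mulrA.
Qed.

Lemma env_mul1 : left_id env_one env_mul.
Proof. by move=> u; rewrite -(classK u) classM mul1r. Qed.

Lemma env_1mul : right_id env_one env_mul.
Proof. by move=> u; rewrite -(classK u) classM mulr1. Qed.

Lemma env_mulDl : left_distributive env_mul +%R.
Proof.
move=> u v w; rewrite -(classK u) -(classK v) -(classK w).
by rewrite -classD !classM mulrDl classD.
Qed.

Lemma env_mulDr : right_distributive env_mul +%R.
Proof.
move=> u v w; rewrite -(classK u) -(classK v) -(classK w).
by rewrite -classD !classM mulrDr classD.
Qed.

Lemma env_oner_neq0 : env_one != 0.
Proof.
apply/eqP => h.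
have /classP/env_ideal_counit : class 1 = class 0.
  by rewrite [RHS](raddf0 (\pi_env)).
by rewrite subr0 mcoeff1 eqxx; apply/eqP/oner_neq0.
Qed.

HB.instance Definition _ := GRing.Zmodule_isNzRing.Build env
  env_mulA env_mul1 env_1mul env_mulDl env_mulDr env_oner_neq0.

Lemma env_scaleA a b u : env_scale a (env_scale b u) = env_scale (a * b) u.
Proof. by rewrite -(classK u) !classZ scalerA. Qed.

Lemma env_scale1 : left_id 1 env_scale.
Proof. by move=> u; rewrite -(classK u) classZ scale1r. Qed.

Lemma env_scaleDr : right_distributive env_scale +%R.
Proof.
move=> a u v; rewrite -(classK u) -(classK v).
by rewrite -classD !classZ scalerDr classD.
Qed.

Lemma env_scaleDl u : {morph env_scale^~ u : a b / a + b}.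
Proof. by move=> a b; rewrite -(classK u) !classZ scalerDl classD. Qed.

HB.instance Definition _ := GRing.Zmodule_isLmodule.Build K env
  env_scaleA env_scale1 env_scaleDr env_scaleDl.

Lemma env_scaleAl a (u v : env) : a *: (u * v) = (a *: u) * v.
Proof.
rewrite -(classK u) -(classK v).
change (env_scale a (env_mul (class (repr u)) (class (repr v))) =
  env_mul (env_scale a (class (repr u))) (class (repr v))).
by rewrite classM !classZ classM scalerAl.
Qed.

HB.instance Definition _ := GRing.Lmodule_isLalgebra.Build K env env_scaleAl.

Definition iota (x : L) : env := class (letter x).

(* The classes of the sums of words of length k, and of length < k. *)
Definition word_length (k : nat) (t : words) : Prop :=
  forall m, t@_m != 0 -> fdeg m = k.

Definition env_below (k : nat) (u : env) : Prop :=
  exists2 t, u = class t & forall m, t@_m != 0 -> (fdeg m < k)%N.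

End Enveloping.

Arguments class {K L} br t.
Arguments iota {K L} br x.

Definition alg_hom_extending (K : comNzRingType) (L B : lmodType K)
    (br : L -> L -> L) (mul : B -> B -> B) (one : B) (f : L -> B)
    (phi : env br -> B) : Prop :=
  [/\ linear phi, phi 1 = one, {morph phi : u v / u * v >-> mul u v}
    & forall x, phi (iota br x) = f x].

Definition two_sided_ideal (K : comNzRingType) (L : lmodType K)
    (br : L -> L -> L) (J : env br -> Prop) : Prop :=
  [/\ J 0, forall u v, J u -> J v -> J (u + v)
    & forall a u b, J u -> J (a * u * b)].

Section Symmetric.
Variables (K : comNzRingType) (L : lmodType K).

Local Notation words := {malg K[{fmonom L}]}.

Definition sym : Type := env (fun _ _ : L => 0 : L).
HB.instance Definition _ := GRing.Lalgebra.on sym.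

Definition sym_class (t : words) : sym := class (fun _ _ => 0) t.

(* An element of S(L) as a polynomial function on the dual of L. *)
Definition sym_eval (xi : {scalar L}) (s : sym) : K :=
  mmap idfun (fun m : {fmonom L} => \prod_(x <- (m : seq L)) xi x) (repr s).

(* S^k(L) and U_k / U_{k-1} are both quotients of the k-th tensor power of L.
   A sum t of words of length k gives an element of the k-th component of
   gr J if its class in U_k / U_{k-1} is that of an element of J. *)
Definition gr (br : L -> L -> L) (J : env br -> Prop) (s : sym) : Prop :=
  exists2 t : nat -> words,
    forall k, word_length k (t k) /\
      exists2 u, J u & env_below k (u - class br (t k))
  & exists N, s = \sum_(k < N) sym_class (t k).

End Symmetric.

End Enveloping.

Import mpoly.
Import Enveloping.

Local Open Scope complex_scope.

Section GradedStarProducts.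
Variables (K : fieldType) (A : comAlgType K) (L : lmodType K).

Definition tscale (c : {poly K}) (F : {poly A}) : {poly A} :=
  map_poly (in_alg A) c * F.

(* A is a commutative algebra with Poisson bracket br and grading deg: deg k is
   the homogeneous component of degree k.  A component of negative degree is
   zero. *)
Record graded_star_product (br : A -> A -> A) (deg : nat -> A -> Prop)
    (star : {poly A} -> {poly A} -> {poly A}) : Prop := {
  starA : associative star;
  star_linearl : forall c F G H,
    star (tscale c F + G) H = tscale c (star F H) + star G H;
  star_linearr : forall c F G H,
    star H (tscale c F + G) = tscale c (star H F) + star H G;
  star_coef0 : forall f g, (star f%:P g%:P)`_0 = f * g;
  star_coef1 : forall f g,
    (star f%:P g%:P)`_1 - (star g%:P f%:P)`_1 = br f g;
  star_parity : forall p f g,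
    (star f%:P g%:P)`_p = (-1) ^+ p * (star g%:P f%:P)`_p;
  star_degree : forall p k l f g, deg k f -> deg l g ->
    if (p <= k + l)%N then deg (k + l - p)%N (star f%:P g%:P)`_p
    else (star f%:P g%:P)`_p = 0
}.

Definition equivariant_star (br : A -> A -> A) (mu : L -> A)
    (star : {poly A} -> {poly A} -> {poly A}) : Prop :=
  forall x f, star (mu x)%:P f%:P - star f%:P (mu x)%:P
              = 'X * (br (mu x) f)%:P.

Definition star1 (star : {poly A} -> {poly A} -> {poly A}) (f g : A) : A :=
  (star f%:P g%:P).[1].

Definition star_corresponds_to (lie : L -> L -> L) (mu : L -> A)
    (star : {poly A} -> {poly A} -> {poly A}) (J : env lie -> Prop) : Prop :=
  exists2 phi : env lie -> A,
    alg_hom_extending (star1 star) 1 mu phi & forall u, J u <-> phi u = 0.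

End GradedStarProducts.

Section DifferentialOperators.
Variables (K : fieldType) (A : comAlgType K).

Fixpoint diff_order_le (k : nat) (D : A -> A) : Prop :=
  if k is k'.+1 then forall a, diff_order_le k' (fun f => D (a * f) - a * D f)
  else forall a f, D (a * f) = a * D f.

(* Grothendieck's algebraic differential operators of order at most k. *)
Definition diff_op (k : nat) (D : A -> A) : Prop :=
  linear D /\ diff_order_le k D.

End DifferentialOperators.

Section Setup.
Variables (R : realType) (n : nat).
Local Notation C := R[i].

(* The variables of C[z_1, w_1, ..., z_n, w_n] are listed as
   z_1, ..., z_n, w_1, ..., w_n. *)
Definition zi (i : 'I_n) : 'I_(n + n) := lshift n i.
Definition wi (i : 'I_n) : 'I_(n + n) := rshift n i.

(* bidiff p f g is P^p (f (x) g) followed by multiplication: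
   P^p.+1 (f (x) g) = P^p (P (f (x) g)). *)
Fixpoint bidiff (p : nat) (f g : {mpoly C[n + n]}) : {mpoly C[n + n]} :=
  if p is p'.+1 then
    \sum_(i < n) (bidiff p' f^`M(zi i) g^`M(wi i)
                  - bidiff p' f^`M(wi i) g^`M(zi i))
  else f * g.

Definition poisson (f g : {mpoly C[n + n]}) : {mpoly C[n + n]} :=
  \sum_(i < n) (f^`M(zi i) * g^`M(wi i) - f^`M(wi i) * g^`M(zi i)).

Definition moyal_coef (p : nat) (f g : {mpoly C[n + n]}) : {mpoly C[n + n]} :=
  ((2 ^ p * p`!)%N%:R : C)^-1 *: bidiff p f g.

Definition parity_mpoly (b : bool) : {pred {mpoly C[n + n]}} :=
  [pred f | all (fun m : 'X_{1..n + n} => odd (mdeg m) == b) (msupp f)].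

Lemma parity_mpolyP b (f : {mpoly C[n + n]}) :
  reflect (forall m, f@_m != 0 -> odd (mdeg m) = b) (f \in parity_mpoly b).
Proof.
rewrite inE; apply: (iffP allP) => h m.
  by rewrite -mcoeff_msupp => /h /eqP.
by rewrite mcoeff_msupp => /h ->.
Qed.

Lemma parity_submod_closed b : submod_closed (parity_mpoly b).
Proof.
split=> [|c f g /parity_mpolyP hf /parity_mpolyP hg]; apply/parity_mpolyP => m.
  by rewrite mcoeff0 eqxx.
rewrite mcoeffD mcoeffZ; have [-> |] := eqVneq g@_m 0; last by move=> /hg.
by have [-> |/hf//] := eqVneq f@_m 0; rewrite mulr0 addr0 eqxx.
Qed.

HB.instance Definition _ b := GRing.isSubmodClosed.Build C {mpoly C[n + n]}
  (parity_mpoly b) (parity_submod_closed b).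

Lemma parity_mpolyM b c (f g : {mpoly C[n + n]}) :
  f \in parity_mpoly b -> g \in parity_mpoly c ->
  f * g \in parity_mpoly (b (+) c).
Proof.
move=> /parity_mpolyP hf /parity_mpolyP hg; apply/parity_mpolyP => m.
rewrite -mcoeff_msupp => /msuppM_le/allpairsP[/= [m1 m2] [/=]].
by rewrite !mcoeff_msupp => /hf <- /hg <- ->; rewrite mdegD oddD.
Qed.

Lemma parity_mderiv b (f : {mpoly C[n + n]}) i :
  f \in parity_mpoly b -> f^`M(i) \in parity_mpoly (~~ b).
Proof.
move=> /parity_mpolyP hf; apply/parity_mpolyP => m; rewrite mcoeff_mderiv => h.
have /hf <- : f@_(m + U_(i)) != 0.
  by apply: contraNneq h => ->; rewrite mul0rn.
by rewrite mdegD mdeg1 addn1 /= negbK.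
Qed.

Lemma parity_bidiff b p (f g : {mpoly C[n + n]}) :
  f \in parity_mpoly b -> g \in parity_mpoly b ->
  bidiff p f g \in parity_mpoly false.
Proof.
elim: p b f g => [|p IH] b f g hf hg /=.
  by rewrite -(addbb b); apply: parity_mpolyM.
by apply: rpred_sum => i _; rewrite rpredB // (IH (~~ b)) // parity_mderiv.
Qed.

Lemma poissonE (f g : {mpoly C[n + n]}) : poisson f g = bidiff 1 f g.
Proof. by []. Qed.

Lemma parity_poisson (f g : {mpoly C[n + n]}) :
  f \in parity_mpoly false -> g \in parity_mpoly false ->
  poisson f g \in parity_mpoly false.
Proof. by rewrite poissonE; apply: parity_bidiff. Qed.

Lemma parity_moyal_coef p (f g : {mpoly C[n + n]}) :
  f \in parity_mpoly false -> g \in parity_mpoly false ->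
  moyal_coef p f g \in parity_mpoly false.
Proof. by move=> hf hg; rewrite rpredZ // (parity_bidiff _ hf). Qed.

Lemma mderiv_homog d (f : {mpoly C[n + n]}) i :
  f \is d.+1.-homog -> f^`M(i) \is d.-homog.
Proof.
move=> /dhomogP hf; apply/dhomogP => m; rewrite mcoeff_msupp mcoeff_mderiv => h.
have /hf /= : (m + U_(i))%MM \in msupp f.
  by rewrite mcoeff_msupp; apply: contraNneq h => ->; rewrite mul0rn.
by rewrite mdegD mdeg1 addn1 => -[].
Qed.

Lemma poisson_homog2 (x y : {mpoly C[n + n]}) :
  x \is 2.-homog -> y \is 2.-homog -> poisson x y \is 2.-homog.
Proof.
move=> hx hy; apply: rpred_sum => i _.
by rewrite rpredB //; apply: (@dhomogM _ _ _ 1 _ 1); apply: mderiv_homog.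
Qed.

Lemma homog2_even (x : {mpoly C[n + n]}) :
  x \is 2.-homog -> x \in parity_mpoly false.
Proof.
move=> /dhomogP hx; apply/parity_mpolyP => m; rewrite -mcoeff_msupp => /hx /=.
by move=> ->.
Qed.

End Setup.

Section EvenPolynomials.
Variables (R : realType) (n : nat).
Local Notation C := R[i].

Record Aeven : Type := AEven {
  aeven_val :> {mpoly C[n + n]};
  _ : aeven_val \in parity_mpoly false
}.

HB.instance Definition _ := [isSub for aeven_val].
HB.instance Definition _ := [Choice of Aeven by <:].

Lemma even_subalg_closed : subalg_closed (@parity_mpoly R n false).
Proof.
split=> [|c f g hf hg|f g hf hg]; last exact: (parity_mpolyM hf hg).
  by apply/parity_mpolyP => m; rewrite mcoeff1; case: (m =P 0%MM) => [->|_]; rewrite ?mdeg0 ?eqxx.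
by rewrite rpredD // rpredZ.
Qed.

HB.instance Definition _ := GRing.isSubalgClosed.Build C {mpoly C[n + n]}
  (parity_mpoly false) (GRing.subalg_closed_semi even_subalg_closed).
HB.instance Definition _ := [SubChoice_isSubComNzRing of Aeven by <:].
HB.instance Definition _ := [SubZmodule_isSubLmodule of Aeven by <:].
HB.instance Definition _ := [SubNzRing_SubLmodule_isSubLalgebra of Aeven by <:].
HB.instance Definition _ := [SubLalgebra_isSubAlgebra of Aeven by <:].

Definition even_poisson (f g : Aeven) : Aeven :=
  AEven (parity_poisson (valP f) (valP g)).

(* R^k = A^{2k} *)
Definition even_deg (k : nat) (f : Aeven) : Prop := val f \is (2 * k).-homog.

Definition even_moyal_coef (p : nat) (f g : Aeven) : Aeven :=
  AEven (parity_moyal_coef p (valP f) (valP g)).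

(* The terms with p >= msize f vanish, since msize f exceeds the degree of f. *)
Definition moyal_poly (f g : Aeven) : {poly Aeven} :=
  \poly_(p < msize (val f)) even_moyal_coef p f g.

(* The C[t]-bilinear extension of the Moyal star product to A^even[t]. *)
Definition moyal (F G : {poly Aeven}) : {poly Aeven} :=
  \sum_(k < size F) \sum_(l < size G) 'X^(k + l) * moyal_poly F`_k G`_l.

(* sp(2n, C), realised as the quadratic polynomials. *)
Definition sp : Type := dhomog (n + n) C 2.
HB.instance Definition _ := SubChoice.on sp.
HB.instance Definition _ := GRing.Lmodule.on sp.

Definition sp_lie (x y : sp) : sp :=
  DHomog (poisson_homog2 (valP x) (valP y)).

Definition momentum (x : sp) : Aeven := AEven (homog2_even (valP x)).

Lemma quad_homog2 (a b : 'I_(n + n)) :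
  ('X_a * 'X_b : {mpoly C[n + n]}) \is 2.-homog.
Proof. by apply: (@dhomogM _ _ _ 1 _ 1); rewrite dhomogX /= mdeg1. Qed.

Definition quad (a b : 'I_(n + n)) : sp := DHomog (quad_homog2 a b).

(* The symplectic group acts on C^{2n} = {(z, w)} by matrices, on quadratic
   polynomials by (Ad S x)(v) = x (S^{-1} v), and on functionals by
   (S . xi)(x) = xi (Ad S^{-1} x). *)
Definition Omega : 'M[C]_(n + n) := block_mx 0 1%:M (- 1%:M) 0.

Definition symplectic (S : 'M[C]_(n + n)) : Prop := S^T *m Omega *m S = Omega.

Definition linear_subst (S : 'M[C]_(n + n)) (x : {mpoly C[n + n]}) :
    {mpoly C[n + n]} :=
  x \mPo [tuple \sum_(b < n + n) S a b *: 'X_b | a < n + n].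

Lemma linear_subst_homog2 S (x : {mpoly C[n + n]}) :
  x \is 2.-homog -> linear_subst S x \is 2.-homog.
Proof.
move=> /dhomogP hx; rewrite /linear_subst comp_mpolyE big_seq.
apply: rpred_sum => m /hx /= <-; rewrite rpredZ // mdegE.
apply: (big_ind2 (fun (p : {mpoly C[n + n]}) d => p \is d.-homog)).
- exact: dhomog1.
- by move=> p d q e; apply: dhomogM.
move=> a _; rewrite -[X in X.-homog]mul1n; apply: dhomogMn; rewrite tnth_mktuple.
by apply: rpred_sum => b _; rewrite rpredZ // dhomogX /= mdeg1.
Qed.

Definition Ad (S : 'M[C]_(n + n)) (x : sp) : sp :=
  DHomog (linear_subst_homog2 (invmx S) (valP x)).

Definition coadjoint_orbit (O : {scalar sp} -> Prop) : Prop :=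
  exists xi : {scalar sp}, forall eta : {scalar sp},
    O eta <-> exists2 S, symplectic S & forall x, eta (Ad S x) = xi x.

(* The matrix of {x, .} on the linear polynomials; it identifies quadratic
   polynomials with the matrices of sp(2n, C) (up to transposition). *)
Definition sp_matrix (x : sp) : 'M[C]_(n + n) :=
  \matrix_(a, b) (poisson (val x) 'X_a)@_U_(b).

(* Nilpotency of a functional is nilpotency of the corresponding element of
   sp(2n, C) under the trace form, a multiple of the Killing form. *)
Definition nilpotent_functional (xi : {scalar sp}) : Prop :=
  exists2 x, exists k, sp_matrix x ^+ k = 0
    & forall y, xi y = \tr (sp_matrix x *m sp_matrix y).

Definition nonzero_nilpotent_orbit (O : {scalar sp} -> Prop) : Prop :=
  coadjoint_orbit O /\
  forall xi, O xi -> nilpotent_functional xi /\ exists x, xi x != 0.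

(* The ideal of polynomial functions on the dual vanishing on O. *)
Definition vanishing_ideal (O : {scalar sp} -> Prop) (s : sym sp) : Prop :=
  forall xi, O xi -> sym_eval xi s = 0.

Definition zariski_closure (O : {scalar sp} -> Prop) (xi : {scalar sp}) : Prop :=
  forall s, vanishing_ideal O s -> sym_eval xi s = 0.

(* The closures of an orbit in the Zariski and Euclidean topologies agree. *)
Definition minimal_nilpotent_orbit (O : {scalar sp} -> Prop) : Prop :=
  nonzero_nilpotent_orbit O /\
  forall O', nonzero_nilpotent_orbit O' ->
    forall xi, O xi -> zariski_closure O' xi.

(* The restriction to O of a polynomial function identifies S(sp) / I(O) with
   A^even, the linear function x restricting to momentum x. *)
Definition orbit_functions_are_even (O : {scalar sp} -> Prop) : Prop :=
  exists kappa : sym sp -> Aeven,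
    [/\ alg_hom_extending ( *%R ) 1 momentum kappa,
        forall f, exists s, kappa s = f
      & forall s, kappa s = 0 <-> vanishing_ideal O s].

Definition ideal_with_gr (O : {scalar sp} -> Prop) (J : env sp_lie -> Prop) :
    Prop :=
  two_sided_ideal J /\ forall s, gr J s <-> vanishing_ideal O s.

(* J is the unique two-sided ideal with gr J = I(O). *)
Definition joseph_ideal (O : {scalar sp} -> Prop) (J : env sp_lie -> Prop) :
    Prop :=
  ideal_with_gr O J /\
  forall J', ideal_with_gr O J' -> forall u, J' u <-> J u.

End EvenPolynomials.

Section ProjectiveLine.
Variable R : realType.
Local Notation C := R[i].
Local Notation sp1 := (sp R 1).

(* Local sections of the lam-th power of the canonical bundle over a chart with
   coordinate x are f(x) (dx)^lam; the Lie derivative along v(x) d/dx is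
   f |-> v f' + lam v' f. *)
Definition lie_derivative (lam : C) (v f : {poly C}) : {poly C} :=
  v * f^`() + lam *: (v^`() * f).

(* The vector field on CP^1 induced by the Hamiltonian vector field {q, .} of
   C^2, in the charts x = w/z and y = z/w:
   {q, w/z} = (z q_z + w q_w) / z^2 = 2 q(1, x),  {q, z/w} = - 2 q(y, 1). *)
Definition vfield_x (q : sp1) : {poly C} :=
  2%:R *: mmap (@polyC C) (fun a => if a == zi ord0 then 1 else 'X) (val q).

Definition vfield_y (q : sp1) : {poly C} :=
  - (2%:R *: mmap (@polyC C) (fun a => if a == zi ord0 then 'X else 1) (val q)).

Definition action_extending (act : sp1 -> {poly C} -> {poly C})
    (rho : env (@sp_lie R 1) -> {poly C} -> {poly C}) : Prop :=
  [/\ forall a u v f, rho (a *: u + v) f = a *: rho u f + rho v f,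
      forall f, rho 1 f = f,
      forall u v f, rho (u * v) f = rho u (rho v f)
    & forall x f, rho (iota (@sp_lie R 1) x) f = act x f].

(* An element of U(sl(2, C)) lies in J^lam iff it acts by zero on the local
   sections over both charts: a twisted differential operator on CP^1 is
   determined by its restrictions to the two charts, and there by its action on
   the sections f(x) (dx)^lam with f a polynomial. *)
Definition J_lambda (lam : C) (u : env (@sp_lie R 1)) : Prop :=
  exists rho_x rho_y,
    [/\ action_extending (fun q => lie_derivative lam (vfield_x q)) rho_x,
        action_extending (fun q => lie_derivative lam (vfield_y q)) rho_y
      & forall f, rho_x u f = 0 /\ rho_y u f = 0].

End ProjectiveLine.

(* Main.v *)
Require Import Defs.
From HB Require Import structures.
From mathcomp Require Import all_boot all_order all_algebra.
From mathcomp Require Import finmap boolp reals complex.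
From mathcomp Require Import mpoly ring zify.

Set Implicit Arguments.
Unset Strict Implicit.
Unset Printing Implicit Defensive.

Import GRing.Theory Num.Theory.
Import Enveloping.

Local Open Scope ring_scope.

(** Every Moyal coefficient is governed by one recursion: replacing [f] by
    ['X_a * f] multiplies the [p]-th coefficient by ['X_a] and adds half of the
    [(p - 1)]-st coefficient of [f] and [ham a g], where [ham a] is the
    derivation [{X_a, -}] ([moyal_termX]).  Associativity follows by induction
    on the degree of the left factor ([moyal_term_assoc]).  Parity in [p] and
    the vanishing of the coefficients beyond the degree of [f] are immediate,
    and a quadratic polynomial has no coefficient with [p > 2]; this gives the
    graded star product, its equivariance and the expansion of [mu_x * f]
    ([moyal_graded], [moyal_equivariant], [moyal_momentum]).

    The operator [Lambda^x] has constant coefficients and second order, and its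
    symbol is the Hessian of [x] transported by the symplectic form.  The
    transport is invertible, so the symbol vanishes only for [x = 0]
    ([lambda_diff_op2], [lambda_not_diff_op1], [lambda_quad]).

    The functionals [x |-> x(v)], for [v] a non-zero vector, are nilpotent and
    form one orbit, because transvections act transitively on the non-zero
    vectors.  They satisfy the quadratic equations of the rank-one symmetric
    tensors, and any non-zero functional that satisfies them is of this form;
    so the minimal orbit is this one ([minimal_orbitE]).  Restricting an
    element of [S(g)] to it amounts to evaluating an even polynomial at [v],
    hence the identification of the functions on the orbit with [A^even]
    ([kappa_eq0], [kappa_surjective]).

    At [t = 1] the Moyal product extends [momentum] to a homomorphism
    [weyl_hom] from [U(g)].  A word of length [k] has the same image under
    [weyl_hom] and under the commutative homomorphism [kappa], up to terms of
    lower degree, and [kappa] is onto in each degree; by a filtration argument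
    the associated graded of the kernel of [weyl_hom] is the kernel of [kappa]
    ([gr_ker], [weyl_kernel_gr]).  So this kernel is an ideal whose associated
    graded is the ideal of the orbit, and the Joseph ideal equals it as soon as
    there is only one such ideal.

    For [n = 1], the left Moyal product by a quadratic polynomial is a quadratic
    expression in the ladder operators [X_a + ham a / 2] ([val_weyl_quad]).
    Quantising polynomials and applying them to a vacuum vector turns the two
    ladder operators into [d/dx] and [x] on [C[x]] ([model_annihilator],
    [model_creator]); on even polynomials in [x], written in [y = x ^ 2] with
    coefficients rescaled by double factorials, the quadratic operators become
    the Lie derivatives of densities of weight [1/4] ([section_of_momentum]).
    The map obtained from [A^even] to the sections over a chart is onto, and an
    even polynomial whose left product has zero image vanishes
    ([section_of_faithful]).  Therefore an element of [U(sl_2)] acts by zero on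
    the sections over either chart exactly when [weyl_hom] kills it
    ([chart_kernel], [weyl_kernel_J_lambda]). *)

(** * Polynomials in several variables *)
Lemma mpoly_mulX_ind (K : nzRingType) m (P : {mpoly K[m]} -> Prop) :
    P 0 -> (forall c f g, P f -> P g -> P (c *: f + g)) -> P 1 ->
    (forall a f, P f -> P ('X_a * f)) ->
  forall f, P f.
Proof.
move=> P0 PL P1 PX; have PX' k (mu : 'X_{1..m}) : mdeg mu = k -> P 'X_[mu].
  elim: k mu => [|k IH] mu.
    by move/eqP; rewrite mdeg_eq0 => /eqP ->; rewrite mpolyX0.
  move=> mu_k; have [a mu_a] : exists a, mu a != 0.
    apply/existsP; apply/contra_eqT: mu_k => /existsPn mu0; rewrite mdegE big1 // => a _.
    by have /negPn/eqP := mu0 a.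
  have le_a : (U_(a) <= mu)%MM by rewrite lep1mP.
  rewrite -(submK le_a) addmC mpolyXD; apply/PX/IH/eqP.
  by rewrite -(eqn_add2r (mdeg U_(a))) -mdegD submK // mdeg1 mu_k addn1.
by elim/mpolyind => // c mu f _ _ IH; apply: PL => //; apply: (PX' _ _ erefl).
Qed.

Lemma sum_lincomb (K : pzRingType) (V : lmodType K) (I : Type) (r : seq I) c (F G : I -> V) :
  \sum_(i <- r) (c *: F i + G i) = c *: (\sum_(i <- r) F i) + \sum_(i <- r) G i.
Proof. by rewrite scaler_sumr -big_split. Qed.

Lemma scale_sign (K : pzRingType) (V : lalgType K) p (x : V) :
  (-1) ^+ p *: x = (-1) ^+ p * x.
Proof.
elim: p => [|p IH]; first by rewrite !expr0 scale1r mul1r.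
by rewrite !exprS -scalerA -mulrA IH scaleN1r mulN1r.
Qed.

Lemma msize_mderiv_le (K : nzRingType) m p a (f : {mpoly K[m]}) :
  (msize f <= p.+1)%N -> (msize f^`M(a) <= p)%N.
Proof.
move=> fp; rewrite msizeE; apply/bigmax_leqP_seq => mu; rewrite mcoeff_msupp mcoeff_mderiv => fm _.
have /msize_mdeg_lt : (mu + U_(a))%MM \in msupp f.
  by rewrite mcoeff_msupp; apply: contraNneq fm => ->; rewrite mul0rn.
by rewrite mdegD mdeg1 addn1 => /leq_trans/(_ fp).
Qed.

Lemma mderivXU (K : nzRingType) m (a b : 'I_m) : ('X_a : {mpoly K[m]})^`M(b) = (a == b)%:R.
Proof.
rewrite mderivX mnm1E; case: eqP => [->|_]; last by rewrite scale0r.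
by rewrite scale1r (_ : (U_(b) - U_(b) = 0)%MM) ?mpolyX0 //; apply/mnmP => c;
  rewrite mnmBE subnn mnm0E.
Qed.

(** * The Moyal coefficients *)

(** The constant is locked because unification would otherwise unfold the
    iterated derivatives inside it. *)
HB.lock Definition moyal_term (R : realType) (n p : nat) (f g : {mpoly R[i][n + n]}) :=
  moyal_coef p f g.

Section Moyal.
Variables (R : realType) (n : nat).
Local Notation C := R[i].
Local Notation A := {mpoly C[n + n]}.
Implicit Types (f g h : A) (a b : 'I_(n + n)).

(** The Hamiltonian vector field [{X_a, -}]; it allows one sum over all
    [n + n] variables in place of the two halves of the Poisson bracket. *)
Definition ham a f : A :=
  match split a with inl i => f^`M(wi i) | inr i => - f^`M(zi i) end.

Lemma ham_is_linear a : linear (ham a).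
Proof.
by rewrite /ham => c f g; case: split => i; rewrite mderivD mderivZ // opprD scalerN.
Qed.
HB.instance Definition _ a := GRing.isLinear.Build C A A *:%R (ham a) (ham_is_linear a).

Lemma hamZ a c f : ham a (c *: f) = c *: ham a f.
Proof. exact: linearZ. Qed.

Lemma bidiff_linear2 p f : linear (bidiff p f).
Proof.
elim: p f => [|p IH] f c g h /=; first by rewrite mulrDr scalerAr.
rewrite scaler_sumr -big_split; apply: eq_bigr => i _ /=.
by rewrite !mderivD !mderivZ !IH scalerBr opprD addrACA.
Qed.
HB.instance Definition _ p f :=
  GRing.isLinear.Build C A A *:%R (bidiff p f) (bidiff_linear2 p f).

Lemma bidiffC p f g : bidiff p f g = (-1) ^+ p *: bidiff p g f.
Proof.
elim: p f g => [|p IH] f g /=; first by rewrite scale1r mulrC.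
rewrite scaler_sumr; apply: eq_bigr => i _.
by rewrite [in LHS]IH [X in _ - X]IH exprS mulN1r scaleNr -!scalerBr -scalerN opprB.
Qed.

Lemma bidiffS p f g : bidiff p.+1 f g = \sum_a bidiff p f^`M(a) (ham a g).
Proof.
rewrite big_split_ord /= -big_split; apply: eq_bigr => i _ /=.
by rewrite /ham !(unsplitK (inl _), unsplitK (inr _)) linearN.
Qed.

Lemma mderiv_bidiff p i f g :
  (bidiff p f g)^`M(i) = bidiff p f^`M(i) g + bidiff p f g^`M(i).
Proof.
elim: p f g => [|p IH] f g /=; first by rewrite mderivM.
rewrite linear_sum -big_split; apply: eq_bigr => j _ /=.
rewrite mderivB !IH ![_^`M(i)^`M(_)]mderiv_comm.
by rewrite opprD addrACA.
Qed.

Lemma bidiff_linear1 p g : linear (bidiff p ^~ g).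
Proof.
by move=> c f f'; rewrite !(bidiffC p _ g) linearP scalerDr !scalerA mulrC.
Qed.

Lemma bidiffDl p f f' g : bidiff p (f + f') g = bidiff p f g + bidiff p f' g.
Proof. by have := bidiff_linear1 p g 1 f f'; rewrite !scale1r. Qed.

Lemma bidiff0l p g : bidiff p 0 g = 0.
Proof. by rewrite bidiffC raddf0 scaler0. Qed.

Lemma bidiffZl p c f g : bidiff p (c *: f) g = c *: bidiff p f g.
Proof. by have := bidiff_linear1 p g c f 0; rewrite !addr0 bidiff0l addr0. Qed.

Lemma ham_bidiff p a f g :
  ham a (bidiff p f g) = bidiff p (ham a f) g + bidiff p f (ham a g).
Proof.
rewrite /ham; case: split => i; rewrite mderiv_bidiff //.
by rewrite linearN opprD -!(scaleN1r (_^`M(_))) bidiffZl !scaleN1r.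
Qed.

Lemma ham_comm a b f : ham a (ham b f) = ham b (ham a f).
Proof.
by rewrite /ham; case: (split a) => i; case: (split b) => j;
  rewrite ?mderivN mderiv_comm.
Qed.

(** Only the first derivative of ['X_a] is non-zero, so among the [p]
    derivations falling on ['X_a * f] at most one falls on ['X_a]. *)
Lemma bidiffX p a f g :
  bidiff p ('X_a * f) g = 'X_a * bidiff p f g + p%:R *: bidiff p.-1 f (ham a g).
Proof.
elim: p f g => [|p IH] f g; first by rewrite /= scale0r addr0 mulrA.
rewrite [LHS]bidiffS.
under eq_bigr => b _ do rewrite mderivM mderivXU bidiffDl IH.
rewrite !big_split /= -mulr_sumr -bidiffS addrCA; congr (_ + _).
rewrite (bigD1 a) //= big1 => [|b /negPf ba]; last by rewrite eq_sym ba mul0r bidiff0l.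
rewrite eqxx mul1r addr0 -nat1r scalerDl scale1r -scaler_sumr; congr (_ + _).
case: p {IH} => [|p]; first by rewrite !scale0r.
by rewrite bidiffS; congr (_ *: _); apply: eq_bigr => b _; rewrite ham_comm.
Qed.

Lemma bidiff1l p g : bidiff p 1 g = (p == 0)%:R * g.
Proof.
case: p => [|p] //; rewrite bidiffS big1 ?mul0r // => a _.
by rewrite -mpolyC1 mderivC bidiff0l.
Qed.

Local Notation mc := (@moyal_term R n).
Local Notation half := (2%:R^-1 : C).

Lemma moyal_termC p f g : mc p f g = (-1) ^+ p *: mc p g f.
Proof. by rewrite !moyal_term.unlock /moyal_coef bidiffC !scalerA mulrC. Qed.

Lemma moyal_termPr p c f g h : mc p f (c *: g + h) = c *: mc p f g + mc p f h.
Proof. by rewrite !moyal_term.unlock /moyal_coef linearP scalerDr !scalerA [_ * c]mulrC. Qed.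

Lemma moyal_termPl p c f g h : mc p (c *: f + g) h = c *: mc p f h + mc p g h.
Proof. by rewrite !(moyal_termC p _ h) moyal_termPr scalerDr !scalerA [c * _]mulrC. Qed.

Lemma moyal_termDr p f g h : mc p f (g + h) = mc p f g + mc p f h.
Proof. by rewrite -[g in LHS]scale1r moyal_termPr scale1r. Qed.

Lemma moyal_termDl p f g h : mc p (f + g) h = mc p f h + mc p g h.
Proof. by rewrite -[f in LHS]scale1r moyal_termPl scale1r. Qed.

Lemma moyal_term0l p f : mc p 0 f = 0.
Proof. by rewrite !moyal_term.unlock /moyal_coef bidiff0l scaler0. Qed.

Lemma moyal_termZl p c f g : mc p (c *: f) g = c *: mc p f g.
Proof. by rewrite -[_ *: f]addr0 moyal_termPl moyal_term0l addr0. Qed.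

Lemma moyal_term0 f g : mc 0 f g = f * g.
Proof. by rewrite !moyal_term.unlock /moyal_coef invr1 scale1r. Qed.

Lemma moyal_term1l p g : mc p 1 g = (p == 0)%:R * g.
Proof. by case: p => [|p]; rewrite !moyal_term.unlock /moyal_coef bidiff1l ?mul0r ?scaler0 // invr1 scale1r. Qed.

Lemma ham_moyal_term p a f g : ham a (mc p f g) = mc p (ham a f) g + mc p f (ham a g).
Proof. by rewrite !moyal_term.unlock /moyal_coef hamZ ham_bidiff scalerDr. Qed.

(** The normalisation by [2 ^ p * p`!] cancels the factor [p.+1] of [bidiffX];
    this is why the recursion has the constant coefficient [1/2]. *)
Lemma moyal_termSX p a f g :
  mc p.+1 ('X_a * f) g = 'X_a * mc p.+1 f g + half *: mc p f (ham a g).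
Proof.
rewrite !moyal_term.unlock /moyal_coef bidiffX scalerDr !scalerA -scalerAr;
  congr (_ + _ *: _) => /=.
have [] : (2 ^ p)%:R != 0 :> C /\ p`!%:R != 0 :> C.
  by rewrite !pnatr_eq0 -!lt0n expn_gt0 fact_gt0.
have : p.+1%:R != 0 :> C by rewrite pnatr_eq0.
rewrite factS expnS !natrM; move: (p.+1%:R) (_ `!%:R) (_ ^ _)%:R => z y x zn xn yn.
by field; rewrite zn xn yn.
Qed.

Lemma moyal_termX p a f g :
  mc p ('X_a * f) g =
  'X_a * mc p f g + if p is p'.+1 then half *: mc p' f (ham a g) else 0.
Proof. by case: p => [|p]; rewrite ?moyal_termSX // !moyal_term0 addr0 mulrA. Qed.

(** Both sides obey the recursion [moyal_termX] in [f]: the term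
    [mc p (mc q f g) (ham a h)] comes from ['X_a] meeting [h], and
    [mc p (mc q f (ham a g)) h] from ['X_a] meeting [g]; on the other side they
    are the two terms of the Leibniz rule for [ham a] on [mc q g h]. *)
Lemma moyal_term_assoc N f g h :
  \sum_(q < N.+1) mc (N - q) (mc q f g) h = \sum_(q < N.+1) mc (N - q) f (mc q g h).
Proof.
elim/mpoly_mulX_ind: f N g h => [|c f f' IH IH'||a f IH] N g h.
- by rewrite !big1 // => q _; rewrite !moyal_term0l.
- under eq_bigr => q _ do rewrite !moyal_termPl.
  under [RHS]eq_bigr => q _ do rewrite moyal_termPl.
  by rewrite !sum_lincomb IH IH'.
- under eq_bigr => q _ do rewrite moyal_term1l.
  under [RHS]eq_bigr => q _ do rewrite moyal_term1l subn_eq0.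
  rewrite big_ord_recl big_ord_recr /= subn0 leqnn !big1 ?add0r ?addr0 ?mul1r //.
    by move=> q _; rewrite leqNgt ltn_ord mul0r.
  by move=> q _; rewrite mul0r moyal_term0l.
case: N => [|N]; first by rewrite !big_ord1 !moyal_term0 !mulrA.
transitivity ('X_a * (\sum_(q < N.+2) mc (N.+1 - q) (mc q f g) h)
    + (half *: (\sum_(q < N.+1) mc (N - q) (mc q f g) (ham a h))
       + half *: (\sum_(q < N.+1) mc (N - q) (mc q f (ham a g)) h))).
  under eq_bigr => q _ do rewrite moyal_termX moyal_termDl moyal_termX.
  rewrite !big_split /= -mulr_sumr -addrA !scaler_sumr; congr (_ + (_ + _)).
    rewrite big_ord_recr /= subnn addr0; apply: eq_bigr => q _.
    by rewrite subSn // -ltnS.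
  by rewrite big_ord_recl moyal_term0l add0r; apply: eq_bigr => q _; rewrite moyal_termZl.
rewrite !IH; symmetry; under eq_bigr => q _ do rewrite moyal_termX.
rewrite big_split -mulr_sumr /=; congr (_ + _); rewrite big_ord_recr /= subnn addr0.
rewrite -scalerDr -big_split scaler_sumr; apply: eq_bigr => q _ /=.
by rewrite subSn ?leq_ord // ham_moyal_term moyal_termDr addrC.
Qed.

End Moyal.

(** * Star products with given coefficients *)

(** A biadditive map into [{poly A}] extends to [{poly A}] by linearity over the
    powers of ['X]. *)
Section PolynomialExtension.
Variable A : comNzRingType.

Definition extend (phi : A -> {poly A}) (F : {poly A}) : {poly A} :=
  \sum_(k < size F) 'X^k * phi F`_k.

Section Additive.
Variables (phi : A -> {poly A}) (phi0 : phi 0 = 0).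

Lemma extendEw N (F : {poly A}) : (size F <= N)%N -> extend phi F = \sum_(k < N) 'X^k * phi F`_k.
Proof.
move=> FN; rewrite /extend (big_ord_widen _ (fun k => 'X^k * phi F`_k) FN) big_mkcond.
by apply: eq_bigr => k _; case: ltnP => // Fk; rewrite nth_default // phi0 mulr0.
Qed.

Lemma extendC f : extend phi f%:P = phi f.
Proof.
by rewrite (extendEw (size_polyC_leq1 _)) big_ord1 expr0 mul1r coefC.
Qed.

Lemma coef_extend N (F : {poly A}) :
  (extend phi F)`_N = \sum_(k < N.+1) (phi F`_k)`_(N - k).
Proof.
have [FM NM] := (leq_maxl (size F) N.+1, leq_maxr (size F) N.+1).
rewrite (extendEw FM) coef_sum (big_ord_widen _ (fun k => (phi F`_k)`_(N - k)) NM).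
rewrite [RHS]big_mkcond; apply: eq_bigr => k _.
by rewrite coefXnM ltnS; case: leqP.
Qed.

Lemma extendMXn i (F : {poly A}) : extend phi ('X^i * F) = 'X^i * extend phi F.
Proof.
elim: i => [|i IH]; first by rewrite expr0 !mul1r.
rewrite exprS -!mulrA -IH; move: ('X^i * F) => {IH} G.
have GX : (size ('X * G)%R <= (size G).+1)%N.
  by rewrite (leq_trans (size_polyMleq _ _)) // size_polyX.
rewrite (extendEw GX) big_ord_recl coefXM eqxx phi0 mulr0 add0r mulr_sumr.
by apply: eq_bigr => k _; rewrite coefXM /= exprS mulrA.
Qed.

Lemma extend_lin (c : A) (F G : {poly A}) : (forall f g, phi (c * f + g) = c *: phi f + phi g) ->
  extend phi (c *: F + G) = c *: extend phi F + extend phi G.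
Proof.
move=> phiL; have [FN GN] := (leq_maxl (size F) (size G), leq_maxr (size F) (size G)).
have HN : (size (c *: F + G)%R <= maxn (size F) (size G))%N.
  rewrite (leq_trans (size_polyD _ _)) // geq_max GN andbT.
  by rewrite (leq_trans (size_scale_leq _ _)).
rewrite (extendEw FN) (extendEw GN) (extendEw HN) scaler_sumr -big_split.
by apply: eq_bigr => k _; rewrite coefD coefZ phiL mulrDr scalerAr.
Qed.

End Additive.

Lemma eq_extend phi psi F : phi =1 psi -> extend phi F = extend psi F.
Proof. by move=> e; apply: eq_bigr => k _; rewrite e. Qed.

Lemma poly_decomp (F : {poly A}) : F = \sum_(k < size F) 'X^k * (F`_k)%:P.
Proof. by rewrite -[LHS]coefK poly_def; apply: eq_bigr => k _; rewrite mulrC mul_polyC. Qed.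

Variable s : A -> A -> {poly A}.

Definition extend2 F G := extend (fun f => extend (s f) G) F.

Hypotheses (s0l : forall g, s 0 g = 0) (s0r : forall f, s f 0 = 0).

Let extend0 G : extend (s 0) G = 0.
Proof. by apply: big1 => k _; rewrite s0l mulr0. Qed.

Lemma extend2C f g : extend2 f%:P g%:P = s f g.
Proof. by rewrite /extend2 extendC ?extend0 // extendC. Qed.

Lemma extend2Cl f G : extend2 f%:P G = extend (s f) G.
Proof. by rewrite /extend2 extendC ?extend0. Qed.

Lemma extend2Cr F g : extend2 F g%:P = extend (s ^~ g) F.
Proof. by apply: eq_extend => f; rewrite extendC. Qed.

Lemma extend2_MXnl i F G : extend2 ('X^i * F) G = 'X^i * extend2 F G.
Proof. by rewrite /extend2 extendMXn ?extend0. Qed.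

Lemma extend2_MXnr i F G : extend2 F ('X^i * G) = 'X^i * extend2 F G.
Proof.
rewrite /extend2 /extend mulr_sumr; apply: eq_bigr => k _.
by rewrite mulrCA; congr (_ * _); apply: extendMXn.
Qed.

Lemma extend2_linl (c : A) F F' G :
  (forall f f' g, s (c * f + f') g = c *: s f g + s f' g) ->
  extend2 (c *: F + F') G = c *: extend2 F G + extend2 F' G.
Proof.
move=> sl; rewrite /extend2 extend_lin ?extend0 // => f g.
rewrite (eq_extend _ (sl f g)) /extend scaler_sumr -big_split.
by apply: eq_bigr => k _; rewrite mulrDr scalerAr.
Qed.

Lemma extend2_linr (c : A) (F G G' : {poly A}) :
  (forall f g g', s f (c * g + g') = c *: s f g + s f g') ->
  extend2 F (c *: G + G') = c *: extend2 F G + extend2 F G'.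
Proof.
move=> sl; have extend2E H : extend2 F H = \sum_(k < size F) 'X^k * extend (s F`_k) H by [].
rewrite !extend2E scaler_sumr -big_split.
by apply: eq_bigr => k _; rewrite /= extend_lin // mulrDr scalerAr.
Qed.

Hypotheses (sDl : forall f f' g, s (f + f') g = s f g + s f' g)
           (sDr : forall f g g', s f (g + g') = s f g + s f g').

Lemma extend2_sumr I (r : seq I) F G :
  extend2 F (\sum_(i <- r) G i) = \sum_(i <- r) extend2 F (G i).
Proof.
apply: (big_morph (extend2 F)) => [G1 G2|].
  by rewrite -{1}[G1]scale1r extend2_linr ?scale1r // => f g g'; rewrite mul1r scale1r.
by apply: big1 => k _; rewrite /extend size_poly0 big_ord0 mulr0.
Qed.

Lemma extend2_suml I (r : seq I) F G :
  extend2 (\sum_(i <- r) F i) G = \sum_(i <- r) extend2 (F i) G.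
Proof.
apply: (big_morph (extend2 ^~ G)) => [F1 F2|].
  by rewrite -{1}[F1]scale1r extend2_linl ?scale1r // => f g g'; rewrite mul1r scale1r.
by rewrite /extend2 /extend size_poly0 big_ord0.
Qed.

Lemma extend2_scalel (P F G : {poly A}) :
  (forall i f g, s (P`_i * f) g = P`_i *: s f g) ->
  extend2 (P * F) G = P * extend2 F G.
Proof.
move=> sP; rewrite [P in LHS]poly_decomp mulr_suml (extend2_suml _ _ G).
rewrite [P in RHS]poly_decomp mulr_suml; apply: eq_bigr => i _.
rewrite -!mulrA extend2_MXnl !mul_polyC; congr (_ * _).
rewrite -[_ *: F]addr0 extend2_linl => [|f f' g]; last by rewrite sDl sP.
by rewrite [X in _ + X]/extend2 [X in _ + X]/extend size_poly0 big_ord0 addr0.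
Qed.

Lemma extend2_scaler (P F G : {poly A}) :
  (forall i f g, s f (P`_i * g) = P`_i *: s f g) ->
  extend2 F (P * G) = P * extend2 F G.
Proof.
move=> sP; rewrite [P in LHS]poly_decomp mulr_suml (extend2_sumr _ F).
rewrite [P in RHS]poly_decomp mulr_suml; apply: eq_bigr => i _.
rewrite -!mulrA extend2_MXnr !mul_polyC; congr (_ * _).
rewrite -[_ *: G]addr0 extend2_linr => [|f g g']; last by rewrite sDr sP.
by rewrite [X in _ + X]big1 ?addr0 // => k _; rewrite /extend size_poly0 big_ord0 mulr0.
Qed.

Lemma extend2Dl F F' G : extend2 (F + F') G = extend2 F G + extend2 F' G.
Proof.
by rewrite -[F in LHS]scale1r extend2_linl ?scale1r // => f f' g; rewrite mul1r scale1r.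
Qed.

Lemma extend2Dr F G G' : extend2 F (G + G') = extend2 F G + extend2 F G'.
Proof.
by rewrite -[G in LHS]scale1r extend2_linr ?scale1r // => f g g'; rewrite mul1r scale1r.
Qed.

(** Both sides are additive in each argument and commute with the powers of
    ['X], so associativity needs to be checked on constants only. *)
Lemma extend2A :
  (forall f g h, extend2 (s f g) h%:P = extend2 f%:P (s g h)) -> associative extend2.
Proof.
move=> sA F G H; rewrite (poly_decomp F).
rewrite (extend2_suml _ _ (extend2 G H)) (extend2_suml _ _ G) (extend2_suml _ _ H).
apply: eq_bigr => i _.
rewrite (poly_decomp G) extend2_suml !(extend2_sumr _ ('X^i * _)) extend2_suml.
apply: eq_bigr => j _; rewrite (poly_decomp H).
rewrite (extend2_sumr _ ('X^j * _)) (extend2_sumr _ ('X^i * _)) (extend2_sumr _ (extend2 _ _)).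
apply: eq_bigr => k _.
by rewrite !(extend2_MXnl, extend2_MXnr) !extend2C sA; ring.
Qed.

End PolynomialExtension.

(** The coefficients [mc p] are those of a product on [A], and [bound f] is a
    degree beyond which they vanish, which makes the product of two elements of
    [A] a polynomial in the parameter. *)
Section StarOfTerms.
Variables (K : fieldType) (A : comAlgType K).
Variables (mc : nat -> A -> A -> A) (bound : A -> nat).
Implicit Types (f g h : A) (F G H : {poly A}).

Hypotheses
  (mcPl : forall p c f g h, mc p (c *: f + g) h = c *: mc p f h + mc p g h)
  (mcC : forall p f g, mc p f g = (-1) ^+ p *: mc p g f)
  (mc_bound : forall p f g, (bound f <= p)%N -> mc p f g = 0)
  (mc0 : forall f g, mc 0 f g = f * g)
  (mcA : forall N f g h, \sum_(q < N.+1) mc (N - q) (mc q f g) h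
                       = \sum_(q < N.+1) mc (N - q) f (mc q g h)).

Definition sterm f g : {poly A} := \poly_(p < bound f) mc p f g.

Definition tstar F G : {poly A} :=
  \sum_(k < size F) \sum_(l < size G) 'X^(k + l) * sterm F`_k G`_l.

Let mcPr p c f g h : mc p f (c *: g + h) = c *: mc p f g + mc p f h.
Proof. by rewrite !(mcC p f) mcPl scalerDr !scalerA [c * _]mulrC. Qed.

Lemma coef_sterm f g p : (sterm f g)`_p = mc p f g.
Proof. by rewrite coef_poly; case: ltnP => // fp; rewrite mc_bound. Qed.

Lemma tstarE F G : tstar F G = extend2 sterm F G.
Proof.
rewrite /tstar /extend2 /extend; apply: eq_bigr => k _.
by rewrite mulr_sumr; apply: eq_bigr => l _; rewrite exprD mulrA.
Qed.

Let stermPl c f f' g : sterm (c *: f + f') g = c%:A *: sterm f g + sterm f' g.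
Proof.
by apply/polyP => p; rewrite coefD coefZ !coef_sterm mcPl -scalerAl mul1r.
Qed.

Let stermPr c f g g' : sterm f (c *: g + g') = c%:A *: sterm f g + sterm f g'.
Proof.
by apply/polyP => p; rewrite coefD coefZ !coef_sterm mcPr -scalerAl mul1r.
Qed.

Let stermDl f f' g : sterm (f + f') g = sterm f g + sterm f' g.
Proof. by have := stermPl 1 f f' g; rewrite !scale1r. Qed.

Let stermDr f g g' : sterm f (g + g') = sterm f g + sterm f g'.
Proof. by have := stermPr 1 f g g'; rewrite !scale1r. Qed.

Let sterm0l g : sterm 0 g = 0.
Proof. by apply: (addIr (sterm 0 g)); rewrite -stermDl !add0r. Qed.

Let sterm0r f : sterm f 0 = 0.
Proof. by apply: (addIr (sterm f 0)); rewrite -stermDr !add0r. Qed.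

Lemma tstarC f g : tstar f%:P g%:P = sterm f g.
Proof. by rewrite tstarE extend2C. Qed.

Lemma coef_tstar f g p : (tstar f%:P g%:P)`_p = mc p f g.
Proof. by rewrite tstarC coef_sterm. Qed.

Lemma tstarA : associative tstar.
Proof.
move=> F G H; rewrite !tstarE; apply: extend2A => // f g h.
rewrite (extend2Cl sterm0l f) (extend2Cr sterm0r _ h).
apply/polyP => N; rewrite !coef_extend //.
under eq_bigr => q _ do rewrite !coef_sterm.
by under [RHS]eq_bigr => q _ do rewrite !coef_sterm; rewrite mcA.
Qed.

Lemma tstarDl F F' G : tstar (F + F') G = tstar F G + tstar F' G.
Proof. by rewrite !tstarE extend2Dl. Qed.

Lemma tstarDr F G G' : tstar F (G + G') = tstar F G + tstar F G'.
Proof. by rewrite !tstarE extend2Dr. Qed.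

Lemma tstar_scalel (c : {poly K}) F G : tstar (tscale c F) G = tscale c (tstar F G).
Proof.
rewrite !tstarE extend2_scalel // => i f g.
by rewrite coef_map /= -scalerAl mul1r -[_ *: f]addr0 stermPl sterm0l addr0.
Qed.

Lemma tstar_scaler (c : {poly K}) F G : tstar F (tscale c G) = tscale c (tstar F G).
Proof.
rewrite !tstarE extend2_scaler // => i f g.
by rewrite coef_map /= -scalerAl mul1r -[_ *: g]addr0 stermPr sterm0r addr0.
Qed.

Lemma tstar_graded (br : A -> A -> A) (deg : nat -> A -> Prop) :
  (forall f g, mc 1 f g - mc 1 g f = br f g) ->
  (forall p k l f g, deg k f -> deg l g ->
     if (p <= k + l)%N then deg (k + l - p)%N (mc p f g) else mc p f g = 0) ->
  graded_star_product br deg tstar.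
Proof.
move=> mc1 mcdeg; split.
- exact: tstarA.
- by move=> c F G H; rewrite tstarDl tstar_scalel.
- by move=> c F G H; rewrite tstarDr tstar_scaler.
- by move=> f g; rewrite coef_tstar mc0.
- by move=> f g; rewrite !coef_tstar mc1.
- by move=> p f g; rewrite !coef_tstar mcC scale_sign.
by move=> p k l f g fk gl; rewrite coef_tstar; apply: mcdeg.
Qed.

(** Coefficients of even index are symmetric and those of index at least 3
    vanish, so only the first one contributes to the commutator. *)
Lemma tstar_commutator (f : A) (br : A -> A) :
  (bound f <= 3)%N -> (forall g, mc 1 f g - mc 1 g f = br g) ->
  forall g, tstar f%:P g%:P - tstar g%:P f%:P = 'X * (br g)%:P.
Proof.
move=> f3 mc1 g; apply/polyP => p; rewrite coefB !coef_tstar coefXM coefC.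
case: p => [|[|p]] /=; first by rewrite !mc0 mulrC subrr.
  exact: mc1.
rewrite [mc _ g f]mcC; case: p => [|p]; first by rewrite sqrrN expr1n scale1r subrr.
by rewrite mc_bound ?scaler0 ?subrr // (leq_trans f3).
Qed.

Lemma tstar_quadratic (f g : A) : (bound f <= 3)%N ->
  tstar f%:P g%:P = (f * g)%:P + (mc 1 f g)%:P * 'X + (mc 2 f g)%:P * 'X^2.
Proof.
move=> f3; apply/polyP => p; rewrite !coefD coef_tstar coefMX coefMXn !coefC.
case: p => [|[|[|p]]] /=; rewrite ?(addr0, add0r) ?mc0 //.
by rewrite ?subn2 /= ?addr0 mc_bound // (leq_trans f3).
Qed.

Lemma star1Pl c f g h : star1 tstar (c *: f + g) h = c *: star1 tstar f h + star1 tstar g h.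
Proof.
rewrite /star1 !tstarC stermPl hornerD hornerZ.
by rewrite -scalerAl mul1r.
Qed.

Lemma star1Pr c f g h : star1 tstar f (c *: g + h) = c *: star1 tstar f g + star1 tstar f h.
Proof.
rewrite /star1 !tstarC stermPr hornerD hornerZ.
by rewrite -scalerAl mul1r.
Qed.

(** The product is linear over the polynomials in the parameter, so setting
    the parameter to 1 is multiplicative; this transfers associativity to
    [star1]. *)
Lemma horner1_tstar F G : (tstar F G).[1] = star1 tstar F.[1] G.[1].
Proof.
have s0l g : star1 tstar 0 g = 0 by rewrite /star1 tstarC sterm0l horner0.
have s0r f : star1 tstar f 0 = 0 by rewrite /star1 tstarC sterm0r horner0.
have sDl f f' g : star1 tstar (f + f') g = star1 tstar f g + star1 tstar f' g.
  by rewrite /star1 !tstarC stermDl hornerD.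
have sDr f g g' : star1 tstar f (g + g') = star1 tstar f g + star1 tstar f g'.
  by rewrite /star1 !tstarC stermDr hornerD.
rewrite [F.[1]]horner_coef [G.[1]]horner_coef.
under [X in star1 _ X _]eq_bigr => k _ do rewrite expr1n mulr1.
under [X in star1 _ _ X]eq_bigr => k _ do rewrite expr1n mulr1.
rewrite (big_morph (star1 tstar ^~ _) (fun f f' => sDl f f' _) (s0l _)) horner_sum.
apply: eq_bigr => k _.
rewrite (big_morph (star1 tstar _) (sDr _) (s0r _)) horner_sum.
apply: eq_bigr => l _.
by rewrite hornerM hornerXn expr1n mul1r /star1 tstarC.
Qed.

Lemma star1A : associative (star1 tstar).
Proof.
move=> f g h; have el F : star1 tstar f F.[1] = (tstar f%:P F).[1].
  by rewrite horner1_tstar hornerC.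
have er F : star1 tstar F.[1] h = (tstar F h%:P).[1] by rewrite horner1_tstar hornerC.
by rewrite [star1 tstar g h]/star1 el [star1 tstar f g]/star1 er tstarA.
Qed.

Lemma star1_commutator (f : A) (br : A -> A) :
  (bound f <= 3)%N -> (forall g, mc 1 f g - mc 1 g f = br g) ->
  forall g, star1 tstar f g - star1 tstar g f = br g.
Proof.
move=> f3 mc1 g; have := congr1 (fun F => F.[1]) (tstar_commutator f3 mc1 g).
by rewrite hornerD hornerN hornerM hornerX hornerC mul1r.
Qed.

Lemma star1_quadratic (f g : A) : (bound f <= 3)%N ->
  star1 tstar f g = f * g + mc 1 f g + mc 2 f g.
Proof.
by move=> f3; rewrite /star1 tstar_quadratic // !hornerE /= !mulr1.
Qed.

Lemma star1_1l f : (forall p g, mc p 1 g = (p == 0)%:R * g) -> star1 tstar 1 f = f.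
Proof.
move=> mc1; rewrite /star1 tstarC; have -> : sterm 1 f = f%:P; last by rewrite hornerC.
apply/polyP => p; rewrite coef_sterm coefC mc1.
by case: p => [|p]; rewrite ?mul1r ?mul0r.
Qed.

Lemma star1_1r f : (forall p g, mc p 1 g = (p == 0)%:R * g) -> star1 tstar f 1 = f.
Proof.
move=> mc1; rewrite /star1 tstarC; have -> : sterm f 1 = f%:P; last by rewrite hornerC.
apply/polyP => p; rewrite coef_sterm coefC mcC mc1.
by case: p => [|p]; rewrite ?mul1r ?mul0r ?scaler0 ?scale1r.
Qed.

End StarOfTerms.

(** * The Moyal product on even polynomials *)
Section MoyalDegree.
Variables (R : realType) (n : nat).
Local Notation C := R[i].
Local Notation A := {mpoly C[n + n]}.
Implicit Types (f g h : A) (a b : 'I_(n + n)).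

Lemma bidiff_msize p f g : (msize f <= p)%N -> bidiff p f g = 0.
Proof.
elim: p f g => [|p IH] f g fp.
  by move: fp; rewrite leqn0 msize_poly_eq0 => /eqP ->; rewrite bidiff0l.
by rewrite bidiffS big1 // => a _; apply/IH/msize_mderiv_le.
Qed.

Lemma homog_msize_le k f : f \is k.-homog -> (msize f <= k.+1)%N.
Proof.
move/dhomogP => fk; rewrite msizeE; apply/bigmax_leqP_seq => m /fk /= -> _; exact: leqnn.
Qed.

Lemma ham_homog k a f : f \is k.+1.-homog -> ham a f \is k.-homog.
Proof. by rewrite /ham => fk; case: split => i; rewrite ?rpredN mderiv_homog. Qed.

Lemma bidiff_homog p k l f g : f \is (p + k).-homog -> g \is (p + l).-homog ->
  bidiff p f g \is (k + l).-homog.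
Proof.
elim: p f g => [|p IH] f g fk gl; first exact: dhomogM.
rewrite bidiffS rpred_sum // => a _.
by apply: IH; rewrite ?(mderiv_homog, ham_homog).
Qed.

Lemma moyal_term_msize p f g : (msize f <= p)%N -> moyal_term p f g = 0.
Proof. by move=> fp; rewrite moyal_term.unlock /moyal_coef bidiff_msize ?scaler0. Qed.

Lemma moyal_term_homog p k l f g : f \is k.-homog -> g \is l.-homog ->
  if (p <= k)%N && (p <= l)%N then is_true (moyal_term p f g \is (k - p + (l - p)).-homog)
  else moyal_term p f g = 0.
Proof.
move=> fk gl; have [pk|kp] /= := leqP p k; last first.
  by rewrite moyal_term_msize // (leq_trans (homog_msize_le fk)).
have [pl|lp] := leqP p l; last first.
  by rewrite moyal_termC moyal_term_msize ?scaler0 // (leq_trans (homog_msize_le gl)).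
by rewrite moyal_term.unlock rpredZ // bidiff_homog ?subnKC.
Qed.

End MoyalDegree.

HB.lock Definition even_term (R : realType) (n p : nat) (f g : Aeven R n) : Aeven R n :=
  even_moyal_coef p f g.

Section EvenMoyal.
Variables (R : realType) (n : nat).
Local Notation C := R[i].
Local Notation A := (Aeven R n).
Implicit Types (f g h : A).

Local Notation mc := (@even_term R n).

Lemma val_even_term p f g : val (mc p f g) = moyal_term p (val f) (val g).
Proof. by rewrite even_term.unlock moyal_term.unlock. Qed.

Lemma even_termC p f g : mc p f g = (-1) ^+ p *: mc p g f.
Proof. by apply: val_inj; rewrite linearZ /= !val_even_term moyal_termC. Qed.

Lemma even_termZl p c f g : mc p (c *: f) g = c *: mc p f g.
Proof.
by apply: val_inj; rewrite linearZ /= !val_even_term linearZ -moyal_termZl.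
Qed.

Lemma even_termZr p c f g : mc p f (c *: g) = c *: mc p f g.
Proof. by rewrite !(even_termC p f) even_termZl !scalerA mulrC. Qed.

Lemma even_termDl p f f' g : mc p (f + f') g = mc p f g + mc p f' g.
Proof. by apply: val_inj; rewrite raddfD /= !val_even_term raddfD -moyal_termDl. Qed.

Lemma even_termDr p f g g' : mc p f (g + g') = mc p f g + mc p f g'.
Proof. by rewrite !(even_termC p f) even_termDl scalerDr. Qed.

Lemma even_term0l p g : mc p 0 g = 0.
Proof. by rewrite -(scale0r 0) even_termZl !scale0r. Qed.

Lemma even_term0 f g : mc 0 f g = f * g.
Proof. by apply: val_inj; rewrite val_even_term moyal_term0 rmorphM. Qed.

Lemma even_term_msize p f g : (msize (val f) <= p)%N -> mc p f g = 0.
Proof. by move=> fp; apply: val_inj; rewrite val_even_term moyal_term_msize // raddf0. Qed.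

Lemma even_term_assoc N f g h :
  \sum_(q < N.+1) mc (N - q) (mc q f g) h = \sum_(q < N.+1) mc (N - q) f (mc q g h).
Proof.
apply: val_inj; rewrite !raddf_sum /=.
under eq_bigr => q _ do rewrite !val_even_term.
under [RHS]eq_bigr => q _ do rewrite !val_even_term.
exact: moyal_term_assoc.
Qed.

Lemma even_term1 f g : mc 1 f g = 2%:R^-1 *: even_poisson f g.
Proof.
apply: val_inj; rewrite val_even_term linearZ /= moyal_term.unlock /moyal_coef.
by rewrite expn1 muln1.
Qed.

Lemma even_term1_comm f g : mc 1 f g - mc 1 g f = even_poisson f g.
Proof.
rewrite [mc 1 g f]even_termC expr1 scaleN1r opprK even_term1 -scalerDl.
by rewrite -mulr2n -(mulr_natl 2%:R^-1) mulfV ?scale1r // pnatr_eq0.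
Qed.

Lemma even_term_deg p k l f g : even_deg k f -> even_deg l g ->
  if (p <= k + l)%N then even_deg (k + l - p) (mc p f g) else mc p f g = 0.
Proof.
move=> fk gl; have := moyal_term_homog p fk gl; rewrite -val_even_term.
have [pk /= | kp /= fg0] := leqP p (2 * k); last first.
  have -> : mc p f g = 0 by apply: val_inj.
  by case: ifP => // _; apply: rpred0.
have [pl /= | lp /= fg0] := leqP p (2 * l); last first.
  have -> : mc p f g = 0 by apply: val_inj.
  by case: ifP => // _; apply: rpred0.
have -> : (p <= k + l)%N by lia.
by rewrite /even_deg; have -> : (2 * (k + l - p) = 2 * k - p + (2 * l - p))%N by lia.
Qed.

Lemma msize_momentum (x : sp R n) : (msize (val (momentum x)) <= 3)%N.
Proof. exact: homog_msize_le (valP x). Qed.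

Lemma even_termPl p c f g h : mc p (c *: f + g) h = c *: mc p f h + mc p g h.
Proof. by rewrite even_termDl even_termZl. Qed.

Local Notation esize := (fun f : A => msize (val f)).

Lemma moyal_tstar : @moyal R n = tstar mc esize.
Proof.
by rewrite even_term.unlock.
Qed.

Theorem moyal_graded : graded_star_product (@even_poisson R n) (@even_deg R n) (@moyal R n).
Proof.
rewrite moyal_tstar; apply: tstar_graded.
- exact: even_termPl.
- exact: even_termC.
- exact: even_term_msize.
- exact: even_term0.
- exact: even_term_assoc.
- exact: even_term1_comm.
- exact: even_term_deg.
Qed.

Theorem moyal_equivariant : equivariant_star (@even_poisson R n) (@momentum R n) (@moyal R n).
Proof.
move=> x f; rewrite moyal_tstar; apply: tstar_commutator.
- exact: even_termPl.
- exact: even_termC.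
- exact: even_term_msize.
- exact: even_term0.
- exact: msize_momentum.
- by move=> g; apply: even_term1_comm.
Qed.

Theorem moyal_momentum x f : moyal (momentum x)%:P f%:P =
  (momentum x * f)%:P + (2%:R^-1 *: even_poisson (momentum x) f)%:P * 'X
  + (mc 2 (momentum x) f)%:P * 'X^2.
Proof.
rewrite moyal_tstar -even_term1; apply: tstar_quadratic.
- exact: even_termPl.
- exact: even_termC.
- exact: even_term_msize.
- exact: even_term0.
- exact: msize_momentum.
Qed.

End EvenMoyal.

(** The Moyal product at [t = 1], locked for the same reason as its
    coefficients. *)
HB.lock Definition weyl (R : realType) (n : nat) (f g : Aeven R n) : Aeven R n :=
  star1 (@moyal R n) f g.

Section Weyl.
Variables (R : realType) (n : nat).
Local Notation C := R[i].
Local Notation A := (Aeven R n).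
Implicit Types (f g h : A) (x : sp R n).

Let weylE f g : weyl f g = star1 (tstar (@even_term R n) (fun f : A => msize (val f))) f g.
Proof. by rewrite weyl.unlock moyal_tstar. Qed.

Lemma weylA : associative (@weyl R n).
Proof.
move=> f g h; rewrite !weylE; apply: star1A.
- exact: even_termPl.
- exact: even_termC.
- exact: even_term_msize.
- exact: even_term_assoc.
Qed.

Lemma weylPl c f g h : weyl (c *: f + g) h = c *: weyl f h + weyl g h.
Proof.
rewrite !weylE; apply: star1Pl.
- exact: even_termPl.
- exact: even_termC.
- exact: even_term_msize.
Qed.

Lemma weylPr c f g h : weyl f (c *: g + h) = c *: weyl f g + weyl f h.
Proof.
rewrite !weylE; apply: star1Pr.
- exact: even_termPl.
- exact: even_termC.
- exact: even_term_msize.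
Qed.

Lemma even_term1l p g : even_term p 1 g = (p == 0)%:R * g.
Proof.
apply: val_inj; rewrite val_even_term rmorphM rmorph_nat.
by rewrite -[RHS]moyal_term1l.
Qed.

Lemma weyl1l f : weyl 1 f = f.
Proof.
rewrite weylE star1_1l //.
- exact: even_termPl.
- exact: even_termC.
- exact: even_term_msize.
- exact: even_term1l.
Qed.

Lemma weyl1r f : weyl f 1 = f.
Proof.
rewrite weylE star1_1r //.
- exact: even_termPl.
- exact: even_termC.
- exact: even_term_msize.
- exact: even_term1l.
Qed.

Lemma weyl_commutator x f :
  weyl (momentum x) f - weyl f (momentum x) = even_poisson (momentum x) f.
Proof.
rewrite !weylE; apply: (@star1_commutator _ _ _ _ _ _ _ _ _ (even_poisson (momentum x))).
- exact: even_termPl.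
- exact: even_termC.
- exact: even_term_msize.
- exact: even_term0.
- exact: msize_momentum.
- by move=> g; apply: even_term1_comm.
Qed.

Lemma weyl_momentum x f :
  weyl (momentum x) f = momentum x * f + even_term 1 (momentum x) f + even_term 2 (momentum x) f.
Proof.
rewrite weylE; apply: star1_quadratic.
- exact: even_termPl.
- exact: even_termC.
- exact: even_term_msize.
- exact: even_term0.
- exact: msize_momentum.
Qed.

End Weyl.

(** * The second-order terms of the Moyal product *)

(** [B] measures the failure of [D] to be a derivation.  When [B] is itself a
    derivation in its second argument, it is the polarised symbol of [D], and
    it decides the order of [D]. *)
Section DiffOrder.
Variables (K : fieldType) (A : comAlgType K) (D : A -> A) (B : A -> A -> A).
Hypothesis (DM : forall f g, D (f * g) = D f * g + f * D g + B f g).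
Hypothesis (BM : forall f g h, B f (g * h) = B f g * h + g * B f h).

Lemma diff_order2 : diff_order_le 2 D.
Proof. by move=> a b c f; rewrite !(DM, BM); ring. Qed.

Lemma diff_order1_symbol : diff_order_le 1 D -> forall f g, B f g = 0.
Proof.
move=> D1 f g.
have B11 : B 1 1 = 0.
  by apply: (addrI (B 1 1)); have := BM 1 1 1; rewrite !mulr1 mul1r addr0 => <-.
have D_1 : D 1 = 0.
  by apply: (addrI (D 1)); have := DM 1 1; rewrite !mulr1 mul1r B11 !addr0 => <-.
have /eqP := D1 f g 1; rewrite !mulr1 DM D_1 mulr0 subr0 -subr_eq0 => /eqP <-; ring.
Qed.

End DiffOrder.

Section Euler.
Variables (K : comNzRingType) (m : nat).
Implicit Types (f : {mpoly K[m]}).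

Lemma euler k f : f \is k.-homog -> \sum_a 'X_a * f^`M(a) = k%:R *: f.
Proof.
move/dhomogP => fk; rewrite [f in RHS]mpolyE scaler_sumr.
under eq_bigr => a _ do rewrite {1}[f]mpolyE linear_sum mulr_sumr.
rewrite exchange_big big_seq [RHS]big_seq; apply: eq_bigr => mu /fk /= muk.
rewrite -muk mdegE natr_sum scaler_suml; apply: eq_bigr => a _.
rewrite mderivZ mderivX -!scalerAr scalerA mulrC -scalerA.
have [->|mu_a] := eqVneq (mu a) 0%N; first by rewrite !scale0r.
by rewrite -mpolyXD addmC submK // lep1mP.
Qed.

End Euler.

Lemma leibniz2 (K : comPzRingType) (f g fa ga fb gb fab gab : K) :
  (fab * g + fa * gb) + (fb * ga + f * gab) = fab * g + f * gab + (fa * gb + fb * ga).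
Proof. ring. Qed.

Lemma leibniz_symbol (K : comPzRingType) (g h fa ga ha fb gb hb : K) :
  fa * (gb * h + g * hb) + fb * (ga * h + g * ha) =
  (fa * gb + fb * ga) * h + g * (fa * hb + fb * ha).
Proof. ring. Qed.

Lemma addDKK (V : zmodType) (u v s : V) : u + v + s - u - v = s.
Proof. by rewrite -(addrA (u + v + s)) -opprD [u + v + s]addrC addrK. Qed.

Lemma addDDK (V : zmodType) (u v w : V) : u + v + w - u = v + w.
Proof. by rewrite -(addrA u) [u + _]addrC addrK. Qed.

Lemma addDBB (V : zmodType) (u v s : V) : u + v + (s - u - v) = s.
Proof. by rewrite -(addrA s) -opprD addrCA subrr addr0. Qed.

Lemma symbol_coef (K : numFieldType) (h u v s t : K) :
  8%:R^-1 * h * (2%:R * u * (2%:R * v) + 2%:R * s * (2%:R * t)) =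
  2%:R^-1 * h * (u * v) + 2%:R^-1 * h * (s * t).
Proof. by field. Qed.

(** The hypotheses make [J^T] the inverse of [J], and congruence by an
    invertible matrix is injective. *)
Lemma skew_congr_eq0 (K : comPzRingType) m (J H : 'M[K]_m) :
  J *m J = (-1)%:M -> J^T = - J -> J^T *m H *m J = 0 -> H = 0.
Proof.
move=> JJ JT e; have : J *m (J *m H *m J) *m J = 0.
  move: e; rewrite JT !mulNmx => /eqP; rewrite oppr_eq0 => /eqP e.
  by have := congr1 (fun M => J *m M *m J) e; rewrite mulmx0 mul0mx.
have -> : J *m (J *m H *m J) *m J = (J *m J) *m H *m (J *m J) by rewrite !mulmxA.
by rewrite JJ mul_scalar_mx mul_mx_scalar scalerA mulrNN mulr1 scale1r.
Qed.

Section Quadratic.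
Variables (R : realType) (n : nat).
Local Notation C := R[i].
Local Notation A := (Aeven R n).
Implicit Types (x y : sp R n) (a b : 'I_(n + n)) (f g h : A).

Lemma momentumP c x y : momentum (c *: x + y) = c *: momentum x + momentum y.
Proof. exact: val_inj. Qed.
HB.instance Definition _ := GRing.isLinear.Build C (sp R n) A *:%R (@momentum R n) momentumP.

Definition hess x a b : C := (val x)^`M(a)^`M(b)@_0%MM.

Lemma hessC x a b : hess x a b = hess x b a.
Proof. by rewrite /hess mderiv_comm. Qed.

(** Euler's identity, applied to [x] and then to its first derivatives. *)
Lemma sp_quadE x : x = \sum_a \sum_b (2%:R^-1 * hess x a b) *: quad R a b.
Proof.
have n2 : (2%:R : C) != 0 by rewrite pnatr_eq0.
have x2 : val x \is 2.-homog := valP x.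
apply: val_inj; rewrite linear_sum /= -[LHS]scale1r -[X in X *: _ = _](mulVf n2) -scalerA -(euler x2).
rewrite scaler_sumr; apply: eq_bigr => a _.
have := euler (mderiv_homog a x2); rewrite scale1r => <-.
rewrite mulr_sumr scaler_sumr linear_sum; apply: eq_bigr => b _ /=.
have /dhomogP x0 := mderiv_homog b (mderiv_homog a x2).
have -> : (val x)^`M(a)^`M(b) = (hess x a b)%:MP.
  apply/mpolyP => m; rewrite mcoeffC; case: eqP => [->|/eqP m0]; first by rewrite mulr1.
  rewrite mulr0; apply/eqP; rewrite mcoeff_eq0; apply: contra m0 => /x0 /= /eqP.
  by rewrite mdeg_eq0.
by rewrite -scalerA; congr (_ *: _); rewrite mulrA mulrC mul_mpolyC.
Qed.

Lemma ham_quad2 a b f :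
  val (even_term 2 (momentum (quad R a b)) f) = 4%:R^-1 *: ham b (ham a (val f)).
Proof.
rewrite val_even_term -[val (momentum _)]/('X_a * 'X_b) -['X_b]mulr1 !moyal_termX.
rewrite !moyal_term1l !mul0r !mulr0 !(add0r, addr0) mul1r.
by rewrite scaler0 mulr0 add0r scalerA -invfM -natrM.
Qed.

Lemma ham_zi i (f : {mpoly C[n + n]}) : ham (zi i) f = f^`M(wi i).
Proof. by rewrite /ham /zi (unsplitK (inl _)). Qed.

Lemma ham_wi i (f : {mpoly C[n + n]}) : ham (wi i) f = - f^`M(zi i).
Proof. by rewrite /ham /wi (unsplitK (inr _)). Qed.

Lemma hamM a (f g : {mpoly C[n + n]}) : ham a (f * g) = ham a f * g + f * ham a g.
Proof. by rewrite /ham; case: split => i; rewrite mderivM // opprD mulNr mulrN. Qed.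

Lemma OmegaK : Omega R n *m Omega R n = (-1)%:M.
Proof.
rewrite /Omega mulmx_block !mul0mx !mulmx0 !mul1mx mulmx1 !add0r !addr0.
by rewrite scalar_mx_block raddfN.
Qed.

Lemma Omega_tr : (Omega R n)^T = - Omega R n.
Proof. by rewrite /Omega tr_block_mx !trmx0 linearN /= trmx1 opp_block_mx !oppr0 opprK. Qed.

Lemma ham_X a b : ham a ('X_b : {mpoly C[n + n]}) = (Omega R n a b)%:MP.
Proof.
have mdX i j : ('X_i : {mpoly C[n + n]})^`M(j) = (i == j)%:R%:MP by rewrite mderivXU mpolyC_nat.
rewrite -[a]splitK -[b]splitK /Omega; case: (split a) => i; case: (split b) => j /=;
  rewrite ?(block_mxEul, block_mxEur, block_mxEdl, block_mxEdr) ?mxE ?(ham_zi, ham_wi) mdX.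
- by rewrite eq_lrshift mpolyC0.
- by rewrite eq_rshift eq_sym.
- by rewrite eq_lshift eq_sym mpolyCN.
- by rewrite eq_rlshift mpolyC0 oppr0.
Qed.

Definition lambda x f : A := even_term 2 (momentum x) f.

Definition symbol x (f g : {mpoly C[n + n]}) : {mpoly C[n + n]} :=
  \sum_a \sum_b (8%:R^-1 * hess x a b) *: (ham a f * ham b g + ham b f * ham a g).

(** The factor [1/8] is the product of the [1/2] of [sp_quadE] and the [1/4]
    of [ham_quad2]. *)
Definition second_order x (f : {mpoly C[n + n]}) : {mpoly C[n + n]} :=
  \sum_a \sum_b (8%:R^-1 * hess x a b) *: ham b (ham a f).

Lemma second_orderM x (f g : {mpoly C[n + n]}) :
  second_order x (f * g) = second_order x f * g + f * second_order x g + symbol x f g.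
Proof.
rewrite !mulr_suml !mulr_sumr -!big_split; apply: eq_bigr => a _ /=.
rewrite !mulr_suml !mulr_sumr -!big_split; apply: eq_bigr => b _ /=.
rewrite -scalerAl -scalerAr -!scalerDr; congr (_ *: _).
by rewrite hamM raddfD /= !hamM; apply: leibniz2.
Qed.

Lemma symbolM x (f g h : {mpoly C[n + n]}) :
  symbol x f (g * h) = symbol x f g * h + g * symbol x f h.
Proof.
rewrite !mulr_suml !mulr_sumr -!big_split; apply: eq_bigr => a _ /=.
rewrite !mulr_suml !mulr_sumr -!big_split; apply: eq_bigr => b _ /=.
rewrite -scalerAl -scalerAr -!scalerDr; congr (_ *: _).
by rewrite !hamM; apply: leibniz_symbol.
Qed.

Lemma val_lambda x f : val (lambda x f) = second_order x (val f).
Proof.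
rewrite /lambda [x in LHS]sp_quadE linear_sum.
rewrite (big_morph (fun g => even_term 2 g f) (fun g h => even_termDl 2 g h f) (even_term0l 2 f)).
rewrite raddf_sum; apply: eq_bigr => a _; rewrite linear_sum.
rewrite (big_morph (fun g => even_term 2 g f) (fun g h => even_termDl 2 g h f) (even_term0l 2 f)).
rewrite raddf_sum; apply: eq_bigr => b _; rewrite linearZ even_termZl.
rewrite [LHS](_ : _ = (2%:R^-1 * hess x a b) *: val (even_term 2 (momentum (quad R a b)) f)) //.
by rewrite ham_quad2 scalerA mulrAC -invfM -natrM.
Qed.

Definition lambda_symbol x f g : A := lambda x (f * g) - lambda x f * g - f * lambda x g.

Lemma valM f g : val (f * g) = val f * val g.
Proof. by rewrite rmorphM. Qed.

Lemma valB f g : val (f - g) = val f - val g.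
Proof. by rewrite raddfB. Qed.

Lemma valD f g : val (f + g) = val f + val g.
Proof. by rewrite raddfD. Qed.

Lemma val_lambda_symbol x f g : val (lambda_symbol x f g) = symbol x (val f) (val g).
Proof.
rewrite /lambda_symbol !valB !valM !val_lambda valM second_orderM.
exact: addDKK.
Qed.

Lemma lambdaM x f g : lambda x (f * g) = lambda x f * g + f * lambda x g + lambda_symbol x f g.
Proof. by symmetry; apply: addDBB. Qed.

Lemma lambda_symbolM x f g h :
  lambda_symbol x f (g * h) = lambda_symbol x f g * h + g * lambda_symbol x f h.
Proof.
by apply: val_inj; rewrite val_lambda_symbol [RHS]valD !valM !val_lambda_symbol symbolM.
Qed.

Lemma lambda_diff_op2 x : diff_op 2 (lambda x).
Proof.
split=> [c f g|]; first by rewrite /lambda even_termDr even_termZr.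
by apply: (@diff_order2 _ _ _ (lambda_symbol x)); [exact: lambdaM | exact: lambda_symbolM].
Qed.

Lemma sq_even a : ('X_a * 'X_a : {mpoly C[n + n]}) \in parity_mpoly false.
Proof. exact: homog2_even (quad_homog2 R a a). Qed.

(** On the squares of two variables the symbol of [Lambda^x] is an entry of
    the transported Hessian; squares are used since a single variable is not
    an even polynomial. *)
Lemma symbol_sq x a b : symbol x ('X_a * 'X_a) ('X_b * 'X_b) =
  ((Omega R n)^T *m (\matrix_(i, j) hess x i j) *m Omega R n) a b *: ('X_a * 'X_b).
Proof.
have n2 : (2%:R : C) != 0 by rewrite pnatr_eq0.
have sq c d : ham c ('X_d * 'X_d) = (2%:R * Omega R n c d) *: ('X_d : {mpoly C[n + n]}).
  by rewrite hamM ham_X [X in _ + X]mulrC -mulr2n mul_mpolyC mulr_natl scalerMnl.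
pose S c d := 2%:R^-1 * hess x c d * (Omega R n c a * Omega R n d b).
transitivity ((\sum_c \sum_d (S c d + S d c)) *: ('X_a * 'X_b : {mpoly C[n + n]})).
  rewrite scaler_suml; apply: eq_bigr => c _; rewrite scaler_suml; apply: eq_bigr => d _.
  rewrite !sq -!scalerAl -!scalerAr !scalerA -scalerDl scalerA; congr (_ *: _).
  by rewrite /S (hessC x d c); apply: symbol_coef.
congr (_ *: _); under eq_bigr => c _ do rewrite big_split.
rewrite big_split /= [X in _ + X]exchange_big /= -mulr2n -mulr_natl.
rewrite mxE exchange_big mulr_sumr; apply: eq_bigr => d _.
rewrite mxE mulr_sumr mulr_suml; apply: eq_bigr => c _.
by rewrite [_^T _ _]mxE [(\matrix_(_, _) _) _ _]mxE /S; field.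
Qed.

Lemma hess_neq0 x : x != 0 -> exists a b, hess x a b != 0.
Proof.
move=> x0; apply/not_existsP => h; move/eqP: x0; apply.
rewrite (sp_quadE x) big1 // => a _; rewrite big1 // => b _.
suff -> : hess x a b = 0 by rewrite mulr0 scale0r.
by apply/eqP/negPn/negP => hab; apply: (h a); exists b.
Qed.

(** An operator of order 1 would have zero symbol, and then a zero Hessian. *)
Lemma lambda_not_diff_op1 x : x != 0 -> ~ diff_op 1 (lambda x).
Proof.
move=> x0 [_ D1]; have [a [b]] := hess_neq0 x0; apply/negP/negPn/eqP.
have e p q : ((Omega R n)^T *m (\matrix_(i, j) hess x i j) *m Omega R n) p q = 0.
  have := diff_order1_symbol (lambdaM x) (lambda_symbolM x) D1 (AEven (sq_even p)) (AEven (sq_even q)).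
  move/(congr1 val); rewrite val_lambda_symbol symbol_sq -mpolyXD.
  by move/(congr1 (mcoeff (U_(p) + U_(q)))); rewrite mcoeffZ mcoeffX eqxx mulr1 raddf0 ?mcoeff0.
have {e} : (Omega R n)^T *m (\matrix_(i, j) hess x i j) *m Omega R n = 0.
  by apply/matrixP => p q; rewrite e mxE.
move/(skew_congr_eq0 OmegaK Omega_tr)/matrixP/(_ a b).
by rewrite !mxE.
Qed.

Lemma lambda_quad (i j : 'I_n) f :
  [/\ val (lambda (quad R (zi i) (zi j)) f) = 4%:R^-1 *: (val f)^`M(wi j)^`M(wi i),
      val (lambda (quad R (wi i) (wi j)) f) = 4%:R^-1 *: (val f)^`M(zi j)^`M(zi i)
    & val (lambda (quad R (zi i) (wi j)) f) = - (4%:R^-1 *: (val f)^`M(zi j)^`M(wi i))].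
Proof.
rewrite /lambda !ham_quad2 !(ham_zi, ham_wi) !mderivN opprK scalerN.
by split; [congr (_ *: _)|congr (_ *: _)|congr (- (_ *: _))]; rewrite mderiv_comm.
Qed.

End Quadratic.

(** * Algebras presented by generators and relations *)

(** The notation [g @_ k] clashes between free algebras and multivariate
    polynomials, whence a module for the part that handles words. *)
Module Representation.
Import monalg.
Local Notation "g @_ k" := (mcoeff k g) : ring_scope.

Section Representation.
Variables (K : comNzRingType) (L : lmodType K) (br : L -> L -> L).
Variables (M : lmodType K) (act : L -> M -> M).
Local Notation words := {malg K[{fmonom L}]}.
Implicit Types (m : {fmonom L}) (t u : words) (f g : M).

Hypotheses
  (actPl : forall c x y f, act (c *: x + y) f = c *: act x f + act y f)
  (actPr : forall c x f g, act x (c *: f + g) = c *: act x f + act x g).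

(** The word [x_1 ... x_k] acts by the composite of the actions of its
    letters, the last letter acting first. *)
Definition word_act m f : M := foldr act f (fmonom_val m).

Definition words_act t f : M := \sum_(m <- msupp t) t@_m *: word_act m f.

Lemma words_actEw (d : {fset {fmonom L}}) t f : (msupp t `<=` d)%fset ->
  words_act t f = \sum_(m <- d) t@_m *: word_act m f.
Proof.
move=> le; rewrite /words_act (big_fset_incl _ le) => //= x xd /mcoeff_outdom ->.
by rewrite scale0r.
Qed.

Lemma words_actP c t u f : words_act (c *: t + u) f = c *: words_act t f + words_act u f.
Proof.
pose d := (msupp t `|` msupp u `|` msupp (c *: t + u)%R)%fset.
rewrite !(@words_actEw d) ?fsubsetUr // /d; first last.
- by rewrite -fsetUA fsubsetUl.
- by rewrite fsetUAC fsubsetUr.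
rewrite scaler_sumr -big_split; apply: eq_bigr => m _ /=.
by rewrite mcoeffD mcoeffZ scalerDl scalerA.
Qed.

Lemma words_act0 f : words_act 0 f = 0.
Proof. by rewrite /words_act msupp0 big_seq_fset0. Qed.

Lemma words_actD t u f : words_act (t + u) f = words_act t f + words_act u f.
Proof. by rewrite -[t in LHS]scale1r words_actP scale1r. Qed.

Lemma words_actZ c t f : words_act (c *: t) f = c *: words_act t f.
Proof. by rewrite -[_ *: t]addr0 words_actP words_act0 addr0. Qed.

Lemma words_actB t u f : words_act (t - u) f = words_act t f - words_act u f.
Proof. by rewrite words_actD; congr (_ + _); rewrite -(scaleN1r u) words_actZ scaleN1r. Qed.

Lemma words_act_sum I (r : seq I) (F : I -> words) f :
  words_act (\sum_(i <- r) F i) f = \sum_(i <- r) words_act (F i) f.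
Proof.
by apply: (big_morph (words_act ^~ f)) => [t u|]; rewrite ?words_actD ?words_act0.
Qed.

Lemma words_actU c m f : words_act << c *g m >> f = c *: word_act m f.
Proof. by rewrite (words_actEw _ msuppU_le) big_seq_fset1 mcoeffUU. Qed.

Lemma word_actP m c f g : word_act m (c *: f + g) = c *: word_act m f + word_act m g.
Proof. by rewrite /word_act; elim: (fmonom_val m) => //= x s ->. Qed.

Lemma words_actPr t c f g : words_act t (c *: f + g) = c *: words_act t f + words_act t g.
Proof.
rewrite /words_act scaler_sumr -big_split; apply: eq_bigr => m _ /=.
by rewrite word_actP scalerDr !scalerA mulrC.
Qed.

Lemma words_act0r t : words_act t 0 = 0.
Proof. by have := words_actPr t (-1) 0 0; rewrite scaler0 addr0 scaleN1r addNr. Qed.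

Lemma words_act_sumr I (r : seq I) (F : I -> M) t :
  words_act t (\sum_(i <- r) F i) = \sum_(i <- r) words_act t (F i).
Proof.
apply: (big_morph (words_act t)) => [g h|]; last exact: words_act0r.
by rewrite -[g in LHS]scale1r words_actPr scale1r.
Qed.

Lemma words_actZr t c f : words_act t (c *: f) = c *: words_act t f.
Proof. by rewrite -[_ *: f]addr0 words_actPr words_act0r addr0. Qed.

Lemma words_actM t u f : words_act (t * u) f = words_act t (words_act u f).
Proof.
rewrite [words_act u f]/words_act words_act_sumr malgME exchange_big words_act_sum.
apply: eq_bigr => m _; rewrite words_act_sum words_actZr scaler_sumr.
apply: eq_bigr => m' _; rewrite words_actU scalerA mulrC; congr (_ *: _).
by rewrite /word_act fmM foldr_cat.
Qed.

Lemma words_act1 f : words_act 1 f = f.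
Proof. by rewrite words_actU scale1r /word_act fm1. Qed.

Lemma words_act_letter x f : words_act (letter x) f = act x f.
Proof. by rewrite words_actU scale1r /word_act fmU. Qed.

Hypothesis act_br : forall x y f, act (br x y) f = act x (act y f) - act y (act x f).

Lemma words_act_rel t f : env_rel br t -> words_act t f = 0.
Proof.
case=> [[c [x [y ->]]]|[x [y ->]]]; rewrite words_actB.
  apply/eqP; rewrite subr_eq0 words_actP words_act_letter actPl; apply/eqP.
  by congr (_ *: _ + _); rewrite words_act_letter.
have act2 a b : words_act (letter a * letter b) f = act a (act b f).
  by rewrite (words_actM (letter a)) (words_act_letter b) words_act_letter.
transitivity (act x (act y f) - act y (act x f) - act (br x y) f); last first.
  by rewrite act_br subrr.
congr (_ - _); last exact: words_act_letter.
by rewrite words_actB; congr (_ - _); apply: act2.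
Qed.

(** The action of words kills the defining relations, so it descends to the
    quotient algebra. *)
Lemma words_act_ideal t f : t \in env_ideal br -> words_act t f = 0.
Proof.
rewrite inE => /asboolP; elim=> [|a r b u hr _ IH]; first exact: words_act0.
by rewrite words_actD IH addr0 !words_actM (words_act_rel _ hr) words_act0r.
Qed.

Definition env_act (u : env br) f : M := words_act (repr u) f.

Lemma env_act_class t f : env_act (class br t) f = words_act t f.
Proof.
apply/eqP; rewrite -subr_eq0 -words_actB; apply/eqP/words_act_ideal.
exact: class_repr.
Qed.

Lemma env_actP c (u v : env br) f : env_act (c *: u + v) f = c *: env_act u f + env_act v f.
Proof.
rewrite -[u]classK -[v]classK.
rewrite [c *: _](classZ br c (repr u)) -classD !env_act_class.
by rewrite words_actP.
Qed.

Lemma env_act1 f : env_act 1 f = f.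
Proof. by rewrite [1 in LHS]/(env_one br) env_act_class words_act1. Qed.

Lemma env_actM (u v : env br) f : env_act (u * v) f = env_act u (env_act v f).
Proof.
rewrite -[u]classK -[v]classK [_ * _](classM br (repr u) (repr v)).
by rewrite !env_act_class words_actM.
Qed.

Lemma env_act_iota x f : env_act (iota br x) f = act x f.
Proof. by rewrite env_act_class words_act_letter. Qed.

End Representation.

Definition word (K : comNzRingType) (L : lmodType K) (r : seq L) : {malg K[{fmonom L}]} :=
  << FMonom r >>.

Lemma word_length_word (K : comNzRingType) (L : lmodType K) (r : seq L) :
  word_length (size r) (word r).
Proof. by move=> m; rewrite mcoeffU; case: (eqVneq (FMonom r) m) => [<-|_]; rewrite ?eqxx. Qed.

Lemma word_length0 (K : comNzRingType) (L : lmodType K) k :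
  exists2 t : {malg K[{fmonom L}]}, word_length k t & t = 0.
Proof. by exists 0 => // m; rewrite mcoeff0 eqxx. Qed.

Lemma word_length_lin (K : comNzRingType) (L : lmodType K) k c (t u : {malg K[{fmonom L}]}) :
  word_length k t -> word_length k u -> word_length k (c *: t + u).
Proof.
move=> tk uk m; rewrite mcoeffD mcoeffZ; have [->|/uk//] := eqVneq u@_m 0.
by have [->|/tk//] := eqVneq t@_m 0; rewrite mulr0 addr0 eqxx.
Qed.

Section AlgebraHomomorphism.
Variables (K : comNzRingType) (L B : lmodType K) (br : L -> L -> L).
Variables (mul : B -> B -> B) (one : B) (h : L -> B).
Implicit Types (f g : B).

Hypotheses
  (mulPl : forall c f f' g, mul (c *: f + f') g = c *: mul f g + mul f' g)
  (mulPr : forall c f g g', mul f (c *: g + g') = c *: mul f g + mul f g')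
  (mulA : associative mul) (mul1 : left_id one mul) (mulr1 : right_id one mul)
  (hP : linear h) (h_br : forall x y, h (br x y) = mul (h x) (h y) - mul (h y) (h x)).

Let act x g := mul (h x) g.

Let actPl c x y g : act (c *: x + y) g = c *: act x g + act y g.
Proof. by rewrite /act hP mulPl. Qed.

Let actPr c x f g : act x (c *: f + g) = c *: act x f + act x g.
Proof. exact: mulPr. Qed.

Let mulBl f f' g : mul (f - f') g = mul f g - mul f' g.
Proof. by rewrite addrC -scaleN1r mulPl scaleN1r addrC. Qed.

Let act_br x y g : act (br x y) g = act x (act y g) - act y (act x g).
Proof. by rewrite /act h_br mulBl !mulA. Qed.

(** A homomorphism out of the enveloping algebra is recovered from the left
    multiplications by the images of the generators, applied to the unit. *)
Definition env_hom (u : env br) : B := env_act act u one.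

Lemma env_act_hom (u : env br) g : env_act act u g = mul (env_hom u) g.
Proof.
have mul0 : mul 0 g = 0 by have := mulBl 0 0 g; rewrite !subrr.
rewrite /env_hom /env_act /words_act (big_morph (mul ^~ g) (id1 := 0) (op1 := +%R)) //; last first.
  by move=> f f'; rewrite -[f in LHS]scale1r mulPl scale1r.
apply: eq_bigr => m _; rewrite -[_ *: word_act act m one]addr0 mulPl mul0 addr0.
congr (_ *: _); rewrite /word_act; elim: (fmonom_val m) => [|x s IH] /=; first by rewrite mul1.
by rewrite IH /act mulA.
Qed.

Lemma env_homP : alg_hom_extending mul one h env_hom.
Proof.
split.
- by move=> c u v; rewrite /env_hom env_actP.
- by rewrite /env_hom env_act1.
- by move=> u v; rewrite /env_hom env_actM // -/(env_hom v) env_act_hom.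
- by move=> x; rewrite /env_hom env_act_iota // /act mulr1.
Qed.

Lemma env_hom_word (r : seq L) :
  env_hom (class br (word r)) = foldr (fun x g => mul (h x) g) one r.
Proof. by rewrite /env_hom env_act_class // words_actU scale1r. Qed.

End AlgebraHomomorphism.

Lemma class_lin (K : comNzRingType) (L : lmodType K) (br : L -> L -> L) c
  (t u : {malg K[{fmonom L}]}) : class br (c *: t + u) = c *: class br t + class br u.
Proof.
have e : class br (c *: t) = c *: class br t by exact: (esym (classZ br c t)).
by rewrite classD e.
Qed.

Lemma class0 (K : comNzRingType) (L : lmodType K) (br : L -> L -> L) : class br 0 = 0.
Proof. by apply: (addrI (class br 0)); rewrite -classD !addr0. Qed.

Lemma word_length_cons (K : comNzRingType) (L : lmodType K) k c (r : seq L)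
    (t : {malg K[{fmonom L}]}) : size r = k -> word_length k t ->
  exists2 u, word_length k u & forall br, class br u = c *: class br (word r) + class br t.
Proof.
move=> rk tk; exists (c *: word r + t) => [|br]; last exact: class_lin.
by apply: word_length_lin => //; rewrite -rk; apply: word_length_word.
Qed.

Lemma malg_linear_sum (K : comNzRingType) (L B : lmodType K)
    (psi : {malg K[{fmonom L}]} -> B) (t : {malg K[{fmonom L}]}) :
  (forall c t u, psi (c *: t + u) = c *: psi t + psi u) ->
  psi t = \sum_(m <- msupp t) t@_m *: psi << m >>.
Proof.
move=> psiP; have psi0 : psi 0 = 0.
  by have := psiP (-1) 0 0; rewrite scaler0 addr0 scaleN1r addNr.
have psiD t1 t2 : psi (t1 + t2) = psi t1 + psi t2 by rewrite -[t1 in LHS]scale1r psiP scale1r.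
rewrite {1}[t]monalgE (big_morph psi psiD psi0); apply: eq_bigr => m _.
have -> : << t@_m *g m >> = t@_m *: << m >> :> {malg K[{fmonom L}]}.
  by apply/malgP => m'; rewrite mcoeffZ !mcoeffU mulr_natr.
by rewrite -[_ *: _ in LHS]addr0 psiP psi0 addr0.
Qed.

(** The target carries a grading [G] and the corresponding filtration [F], with
    [F k] the elements of degree less than [k].  [phi] is a homomorphism from the
    enveloping algebra and [kappa] is one from the symmetric algebra; [phi_word]
    says that [kappa] gives the leading term of [phi]. *)
Section AssociatedGraded.
Variables (K : comNzRingType) (L B : lmodType K) (br : L -> L -> L).
Variables (phi : env br -> B) (kappa : sym L -> B) (G F : nat -> B -> Prop).
Local Notation words := {malg K[{fmonom L}]}.
Implicit Types (f g : B) (t : words) (m : {fmonom L}).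

Hypotheses (phiP : linear phi) (kappaP : linear kappa)
  (G0 : forall k, G k 0)
  (GP : forall k c f g, G k f -> G k g -> G k (c *: f + g))
  (F0 : forall k, F k 0)
  (FP : forall k c f g, F k f -> F k g -> F k (c *: f + g))
  (GF0 : forall k f, G k f -> F k f -> f = 0)
  (GF : forall j k f, (j < k)%N -> G j f -> F k f)
  (FF : forall j k f, (j <= k)%N -> F j f -> F k f)
  (G_direct : forall N (g : nat -> B), (forall k, G k (g k)) ->
     \sum_(k < N) g k = 0 -> forall k, (k < N)%N -> g k = 0)
  (kappa_word : forall r : seq L, G (size r) (kappa (sym_class (word r))))
  (phi_word : forall r : seq L,
     F (size r) (phi (class br (word r)) - kappa (sym_class (word r))))
  (F_zero : forall f, F 0 f -> f = 0)
  (F_top : forall k f, F k.+1 f -> exists2 g, G k g & F k (f - g))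
  (G_surj : forall k g, G k g -> exists2 t, word_length k t & kappa (sym_class t) = g).

Let kappa_monom m : G (fdeg m) (kappa (sym_class << m >>)).
Proof. by case: m => r; apply: kappa_word. Qed.

Let phi_monom m : F (fdeg m) (phi (class br << m >>) - kappa (sym_class << m >>)).
Proof. by case: m => r; apply: phi_word. Qed.

Let phi_class c t u : phi (class br (c *: t + u)) = c *: phi (class br t) + phi (class br u).
Proof. by rewrite class_lin phiP. Qed.

Let kappa_class c t u :
  kappa (sym_class (c *: t + u)) = c *: kappa (sym_class t) + kappa (sym_class u).
Proof. by rewrite /sym_class class_lin kappaP. Qed.

Let G_sum (I : Type) (r : seq I) (P : pred I) k (g : I -> B) (c : I -> K) :
  (forall i, P i -> G k (g i)) -> G k (\sum_(i <- r | P i) c i *: g i).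
Proof.
move=> Gg; apply: (big_rec (G k)) => [|i x Pi Gx]; first exact: G0.
by apply: GP => //; apply: Gg.
Qed.

Let F_sum (I : Type) (r : seq I) (P : pred I) k (g : I -> B) (c : I -> K) :
  (forall i, P i -> F k (g i)) -> F k (\sum_(i <- r | P i) c i *: g i).
Proof.
move=> Fg; apply: (big_rec (F k)) => [|i x Pi Fx]; first exact: F0.
by apply: FP => //; apply: Fg.
Qed.

Let FD k f g : F k f -> F k g -> F k (f + g).
Proof. by move=> Ff Fg; rewrite -[f]scale1r; apply: FP. Qed.

Let FN k f : F k f -> F k (- f).
Proof. by move=> Ff; rewrite -scaleN1r -[_ *: _]addr0; apply: FP. Qed.

Let kappa_length k t : word_length k t -> G k (kappa (sym_class t)).
Proof.
move=> tk; rewrite (malg_linear_sum t kappa_class) big_seq; apply: G_sum => m.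
by rewrite -mcoeff_neq0 => /tk <-; apply: kappa_monom.
Qed.

Let phi_length k t : word_length k t -> F k (phi (class br t) - kappa (sym_class t)).
Proof.
move=> tk; rewrite (malg_linear_sum t kappa_class) (malg_linear_sum t phi_class) -sumrB big_seq.
under eq_bigr => m _ do rewrite -scalerBr.
by apply: F_sum => m; rewrite -mcoeff_neq0 => /tk <-; apply: phi_monom.
Qed.

Let phi_below k (u : env br) : env_below k u -> F k (phi u).
Proof.
case=> t -> tk; rewrite (malg_linear_sum t phi_class) big_seq; apply: F_sum => m.
rewrite -mcoeff_neq0 => /tk mk; rewrite -[phi _](subrK (kappa (sym_class << m >>))).
by apply: FD; [apply: (FF (ltnW mk))|apply: (GF mk)].
Qed.

Let belowP k c (u v : env br) : env_below k u -> env_below k v -> env_below k (c *: u + v).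
Proof.
move=> [t -> tk] [t' -> tk']; exists (c *: t + t').
  by rewrite class_lin.
move=> m; rewrite mcoeffD mcoeffZ; have [->|/tk'//] := eqVneq t'@_m 0.
by have [->|/tk//] := eqVneq t@_m 0; rewrite mulr0 addr0 eqxx.
Qed.

Let phi_onto k f : F k f -> exists2 v, env_below k v & phi v = f.
Proof.
elim: k f => [|k IH] f Ff.
  exists 0; first by exists 0 => [|m]; rewrite ?class0 // mcoeff0 eqxx.
  rewrite (F_zero Ff); have := phiP (-1) 0 0.
  by rewrite scaler0 addr0 scaleN1r addNr.
have [g /G_surj[t tk <-] fg] := F_top Ff.
have /IH[v vk phiv] : F k (f - phi (class br t)).
  rewrite -[f](subrK (kappa (sym_class t))) -addrA; apply: FD fg _.
  by rewrite -opprB; apply/FN/phi_length.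
exists (1 *: class br t + v); last by rewrite phiP scale1r phiv addrC subrK.
apply: belowP; first by exists t => // m /tk ->.
by case: vk => t' -> tk'; exists t' => // m /tk' /ltnW.
Qed.

(** If [phi u = 0] and [t] is the leading part of [u], of length [k], then
    [kappa t] has degree [k] and, being the leading term of [phi u], also lies in
    [F k]; so it vanishes.  Conversely, when [kappa t = 0], [phi t] lies in [F k],
    so by surjectivity of [kappa] in each degree it is the image of an element
    [v] shorter than [k]; then [t - v] is in the kernel of [phi] and has leading
    part [t]. *)
Theorem gr_ker (s : sym L) : gr (fun u => phi u = 0) s <-> kappa s = 0.
Proof.
have kappa0 : kappa 0 = 0 by have := kappaP (-1) 0 0; rewrite scaler0 addr0 scaleN1r addNr.
have kappaD u v : kappa (u + v) = kappa u + kappa v by rewrite -[u in LHS]scale1r kappaP scale1r.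
have phiB u v : phi (u - v) = phi u - phi v.
  by rewrite [u - v]addrC -(scaleN1r v) phiP scaleN1r addrC.
split=> [[t tP [N ->]]|s0].
  rewrite (big_morph kappa kappaD kappa0) big1 // => k _.
  have [tk [u u0 /phi_below]] := tP k; rewrite phiB u0 sub0r => /FN; rewrite opprK => Ft.
  apply: GF0 (kappa_length tk) _.
  by rewrite -[kappa _](subKr (phi (class br (t k)))); apply: FD => //; apply/FN/phi_length.
pose w := repr s; pose t k : words := \sum_(m <- msupp w | fdeg m == k) << w@_m *g m >>.
have tk k : word_length k (t k).
  move=> m; rewrite /t raddf_sum /= => h; apply/eqP; apply: contraNT h => mk.
  rewrite big1 // => m' /eqP m'k; rewrite mcoeffU; case: eqP => // e.
  by move: mk; rewrite -e m'k eqxx.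
pose N := (\max_(m <- msupp w) (fdeg m).+1)%N.
have wN m : m \in msupp w -> (fdeg m < N)%N.
  by move=> mw; apply: (leq_bigmax_seq (F := fun m => (fdeg m).+1)) mw _.
have wE : w = \sum_(k < N) t k.
  rewrite {1}[w]monalgE /t (exchange_big_dep xpredT) //= big_seq [RHS]big_seq.
  apply: eq_bigr => m /wN mN; by rewrite (big_pred1 (Ordinal mN)).
have sE : s = \sum_(k < N) sym_class (t k).
  rewrite -[LHS]classK -/w {1}wE.
  by apply: (big_morph (@sym_class K L)) => [t1 t2|]; [exact: classD|exact: class0].
have ts0 k : kappa (sym_class (t k)) = 0.
  have [kN|Nk] := ltnP k N.
    apply: (@G_direct N (fun k => kappa (sym_class (t k)))) => // [j|].
      exact: kappa_length.
    by rewrite -(big_morph kappa kappaD kappa0) -sE.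
  rewrite /t big_seq_cond big1 => [|m /andP[/wN mN /eqP mk]]; first by rewrite /sym_class class0.
  by move: mN; rewrite mk ltnNge Nk.
exists t; last by exists N.
move=> k; split; first exact: tk.
have := phi_length (tk k); rewrite ts0 subr0 => /phi_onto[v vk phiv].
exists (-1 *: v + class br (t k)); first by rewrite phiP scaleN1r phiv addNr.
have -> : -1 *: v + class br (t k) - class br (t k) = -1 *: v + 0 by rewrite addrK addr0.
by apply: belowP => //; exists 0 => [|m]; rewrite ?class0 // mcoeff0 eqxx.
Qed.

End AssociatedGraded.

Section SymmetricEvaluation.
Variables (K : comNzRingType) (L : lmodType K).

Lemma env_hom_sym_eval (B : lmodType K) (mul : B -> B -> B) (one : B) (h : L -> B)
    (e : B -> K) (xi : {scalar L}) (s : sym L) :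
  (forall c f g, e (c *: f + g) = c * e f + e g) -> (forall f g, e (mul f g) = e f * e g) ->
  e one = 1 -> (forall x, e (h x) = xi x) ->
  e (env_hom mul one h s) = sym_eval xi s.
Proof.
move=> eP eM e1 eh; have e0 : e 0 = 0.
  by have := eP (-1) 0 0; rewrite scaler0 addr0 mulN1r addNr.
have eD f g : e (f + g) = e f + e g by rewrite -[f in LHS]scale1r eP mul1r.
rewrite /env_hom /env_act /words_act (big_morph e eD e0); apply: eq_bigr => m _.
rewrite -[_ *: _ in LHS]addr0 eP e0 addr0; congr (_ * _); rewrite /word_act.
elim: (fmonom_val m) => [|x r IH] /=; first by rewrite big_nil.
by rewrite big_cons eM eh IH.
Qed.

Lemma sym_eval_hom (xi : {scalar L}) :
  [/\ forall c u v, sym_eval xi (c *: u + v) = c * sym_eval xi u + sym_eval xi v,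
      {morph sym_eval xi : u v / u * v}
    & forall x, sym_eval xi (iota (fun _ _ => 0) x : sym L) = xi x].
Proof.
have E s : sym_eval xi s = env_hom (@GRing.mul K : K^o -> K^o -> K^o) 1 xi s.
  by symmetry; apply: (@env_hom_sym_eval K^o (@GRing.mul K) 1 xi idfun).
have [] := @env_homP K L K^o (fun _ _ => 0) (@GRing.mul K) 1 xi.
- by move=> c f f' g; rewrite mulrDl; congr (_ + _); exact: esym (mulrA c f g).
- by move=> c f g g'; rewrite mulrDr; congr (_ + _); exact: mulrCA.
- exact: mulrA.
- exact: mul1r.
- exact: mulr1.
- exact: linearP.
- by move=> x y; rewrite linear0 mulrC subrr.
move=> lin one mor iot; split.
- by move=> c u v; rewrite !E lin.
- by move=> u v; rewrite !E mor.
- by move=> x; rewrite E iot.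
Qed.

Definition quadric (x y z w : L) : sym L :=
  -1 *: (iota (fun _ _ => 0) z * iota (fun _ _ => 0) w)
  + iota (fun _ _ => 0) x * iota (fun _ _ => 0) y.

Lemma sym_eval_quadric (xi : {scalar L}) x y z w :
  sym_eval xi (quadric x y z w) = xi x * xi y - xi z * xi w.
Proof.
have [lin mor iot] := sym_eval_hom xi.
rewrite /quadric lin mulN1r addrC; congr (_ - _).
  by rewrite mor; congr (_ * _); apply: iot.
by rewrite mor; congr (_ * _); apply: iot.
Qed.

End SymmetricEvaluation.

Section ActionUniqueness.
Variables (K : comNzRingType) (L : lmodType K) (br : L -> L -> L).

Lemma class_word_cons (x : L) (r : seq L) :
  class br (word (x :: r)) = iota br x * class br (word r).
Proof.
rewrite [_ * _](classM br (letter x) (word r)); congr class.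
rewrite (malgMEw (msuppU_le (k := fmu x)) (msuppU_le (k := FMonom r))).
rewrite !big_seq_fset1 !mcoeffUU mul1r /word; congr << _ *g _ >>.
by apply/eqP; rewrite fmP fmM fmU.
Qed.

Lemma class_word_nil : class br (word [::]) = 1.
Proof.
rewrite [RHS]/(env_one br); congr class; rewrite /word.
have -> : FMonom [::] = mone :> {fmonom L} by apply/eqP; rewrite fmP fm1.
by [].
Qed.

Lemma env_linear_eq (M : lmodType K) (phi psi : env br -> M) (u : env br) :
  (forall c v w, phi (c *: v + w) = c *: phi v + phi w) ->
  (forall c v w, psi (c *: v + w) = c *: psi v + psi w) ->
  (forall r : seq L, phi (class br (word r)) = psi (class br (word r))) -> phi u = psi u.
Proof.
move=> phiP psiP e; rewrite -[u]classK; move: (repr u) => t.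
have expand (theta : env br -> M) :
    (forall c v w, theta (c *: v + w) = c *: theta v + theta w) ->
    theta (class br t) = \sum_(m <- msupp t) t@_m *: theta (class br << m >>).
  by move=> thetaP; apply: (malg_linear_sum (psi := fun t => theta (class br t))) => c v w;
    rewrite class_lin thetaP.
by rewrite !expand //; apply: eq_bigr => -[r] _; congr (_ *: _); apply: e.
Qed.

(** An action of the algebra is determined on words, hence by the action of
    the generators. *)
Lemma env_act_unique (M : lmodType K) (act : L -> M -> M) (rho : env br -> M -> M)
    (u : env br) f :
  (forall c x y f, act (c *: x + y) f = c *: act x f + act y f) ->
  (forall c x f g, act x (c *: f + g) = c *: act x f + act x g) ->
  (forall x y f, act (br x y) f = act x (act y f) - act y (act x f)) ->
  (forall a v w f, rho (a *: v + w) f = a *: rho v f + rho w f) ->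
  (forall f, rho 1 f = f) ->
  (forall v w f, rho (v * w) f = rho v (rho w f)) ->
  (forall x f, rho (iota br x) f = act x f) ->
  rho u f = env_act act u f.
Proof.
move=> actPl actPr act_br rhoP rho1 rhoM rho_iota.
apply: (env_linear_eq (phi := rho ^~ f) (psi := (env_act act) ^~ f)) => [c v w|c v w|r].
- exact: rhoP.
- exact: env_actP.
elim: r => [|x r IH]; first by rewrite class_word_nil rho1 env_act1.
by rewrite class_word_cons rhoM env_actM // rho_iota env_act_iota // IH.
Qed.

End ActionUniqueness.

Lemma env_act_intertwine (K : comNzRingType) (L M N : lmodType K) (br : L -> L -> L)
    (act : L -> M -> M) (act' : L -> N -> N) (tau : M -> N) (u : env br) f :
  (forall c f g, tau (c *: f + g) = c *: tau f + tau g) ->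
  (forall x f, tau (act x f) = act' x (tau f)) ->
  tau (env_act act u f) = env_act act' u (tau f).
Proof.
move=> tauP tau_act; have tau0 : tau 0 = 0.
  by have := tauP (-1) 0 0; rewrite scaler0 addr0 scaleN1r addNr.
have tauD g h : tau (g + h) = tau g + tau h by rewrite -[g in LHS]scale1r tauP scale1r.
rewrite /env_act /words_act (big_morph tau tauD tau0); apply: eq_bigr => m _.
rewrite -[_ *: _ in LHS]addr0 tauP tau0 addr0; congr (_ *: _); rewrite /word_act.
by elim: (fmonom_val m) => //= x r <-.
Qed.

End Representation.

Import Representation.

(** * Polynomial functions and transvections *)
Section PolynomialFunctions.
Variables (K : numFieldType) (m : nat).
Implicit Types (f p : {mpoly K[m]}) (v : 'I_m -> K).

Lemma poly_fun_eq0 (q : {poly K}) : (forall t, q.[t] = 0) -> q = 0.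
Proof.
move=> q0; apply/eqP/negPn/negP => qn0.
(* In characteristic 0 the integers supply more roots than the degree allows. *)
pose rs := [seq (k%:R : K) | k <- seq.iota 0 (size q)].
have rs0 : all (root q) rs by apply/allP => t _; rewrite /root q0.
have rsU : uniq rs by rewrite map_inj_uniq ?iota_uniq // => j k /eqP; rewrite eqr_nat => /eqP.
by have := max_poly_roots qn0 rs0 rsU; rewrite size_map size_iota ltnn.
Qed.

(** The restriction of [p] to the line through [v] in the direction of the
    [i]-th variable. *)
Definition mline v i p : {poly K} := mmap polyC (fun j => (v j)%:P + (i == j)%:R * 'X) p.

Lemma horner_mline v i p t : (mline v i p).[t] = p.@[fun j => v j + (i == j)%:R * t].
Proof.
elim/mpoly_mulX_ind: p => [|c f g IHf IHg||j f IH].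
- by rewrite /mline !raddf0 horner0.
- by rewrite /mline raddfD /= mmapZ mevalD mevalZ hornerD hornerM hornerC IHf IHg.
- by rewrite /mline !rmorph1 hornerC.
rewrite /mline rmorphM /= mmapX mmap1U mevalM mevalXU hornerM IH.
by rewrite hornerD hornerC hornerM hornerX -polyC_natr hornerC.
Qed.

Lemma deriv_mline v i p : (mline v i p)^`().[0] = p^`M(i).@[v].
Proof.
elim/mpoly_mulX_ind: p => [|c f g IHf IHg||j f IH].
- by rewrite /mline !raddf0 horner0.
- rewrite /mline raddfD /= mmapZ mderivD mderivZ mevalD mevalZ derivD.
  by rewrite deriv_mulC hornerD hornerM hornerC IHf IHg.
- by rewrite /mline !rmorph1 derivC horner0 -mpolyC1 mderivC meval0.
rewrite mderivM mderivXU mevalD !mevalM mevalXU -IH.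
rewrite {1}/mline rmorphM /= mmapX mmap1U derivM hornerD !hornerM -/(mline v i f).
rewrite horner_mline derivD derivC add0r -polyC_natr deriv_mulC derivX !hornerE.
rewrite eq_sym rmorph_nat; congr (_ * _ + _).
by apply: meval_eq => k; rewrite mulr0 addr0.
Qed.

(** The restrictions to lines vanish, since a polynomial in one variable has
    finitely many roots; hence the partial derivatives vanish as functions, and
    by induction on the degree [p] is constant. *)
Lemma mpoly_fun_eq0 p : (forall v, p.@[v] = 0) -> p = 0.
Proof.
move: {2}(msize p) (leqnn (msize p)) => k; elim: k p => [|k IH] p pk p0.
  by apply/eqP; rewrite -msize_poly_eq0 -leqn0.
have dp0 i : p^`M(i) = 0.
  apply: IH; first exact: msize_mderiv_le.
  move=> v; rewrite -deriv_mline; have -> : mline v i p = 0.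
    by apply: poly_fun_eq0 => t; rewrite horner_mline p0.
  by rewrite deriv0 horner0.
have pC : p = (p@_0%MM)%:MP.
  apply/mpolyP => mu; rewrite mcoeffC; case: eqP => [->|/eqP mu0]; first by rewrite mulr1.
  have [i mui] : exists i, mu i != 0%N.
    apply/existsP; apply: contraNT mu0 => /existsPn h; apply/eqP/mnmP => i.
    by rewrite mnm0E; apply/eqP/negPn/h.
  rewrite mulr0; have := congr1 (mcoeff (mu - U_(i))) (dp0 i).
  rewrite mcoeff_mderiv submK ?lep1mP // mcoeff0 => /eqP.
  by rewrite mulrn_eq0 => /eqP.
have e := p0 (fun _ => 0); rewrite pC mevalC in e.
by rewrite pC e mpolyC0.
Qed.

End PolynomialFunctions.

Section Transvections.
Variables (K : numFieldType) (m : nat) (J : 'M[K]_m).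
Hypothesis (JT : J^T = - J).
Implicit Types (u v w : 'cV[K]_m) (S T : 'M[K]_m).

Definition form v w : K := (v^T *m J *m w) 0 0.

Definition preserves S : Prop := S^T *m J *m S = J.

Lemma formE v w : v^T *m J *m w = (form v w)%:M.
Proof. exact: mx11_scalar. Qed.

Lemma formC v w : form w v = - form v w.
Proof.
have : (v^T *m J *m w)^T = - (w^T *m J *m v).
  by rewrite !trmx_mul trmxK JT !(mulNmx, mulmxN) mulmxA.
by move/matrixP/(_ 0 0); rewrite mxE [RHS]mxE /form => ->; rewrite opprK.
Qed.

Lemma formvv v : form v v = 0.
Proof.
have /eqP := formC v v; rewrite -subr_eq0 opprK -mulr2n mulrn_eq0 /= => /eqP.
exact.
Qed.

Lemma form_Dr v w w' : form v (w + w') = form v w + form v w'.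
Proof. by rewrite /form mulmxDr mxE. Qed.

Lemma preserves_mul S T : preserves S -> preserves T -> preserves (S *m T).
Proof.
rewrite /preserves => hS hT; rewrite trmx_mul -!mulmxA (mulmxA J) (mulmxA S^T).
by rewrite (mulmxA S^T) hS mulmxA.
Qed.

Definition transvection c u : 'M[K]_m := 1%:M + c *: (u *m (u^T *m J)).

Lemma transvectionE c u v : transvection c u *m v = v + (c * form u v) *: u.
Proof.
rewrite /transvection mulmxDl mul1mx -scalemxAl -!mulmxA.
by rewrite (mulmxA _ J) formE mul_mx_scalar scalerA.
Qed.

Lemma transvection_preserves c u : preserves (transvection c u).
Proof.
have e : (u *m (u^T *m J))^T = - (J *m u *m u^T).
  by rewrite !trmx_mul trmxK JT !mulNmx.
have eT : (transvection c u)^T = 1%:M - c *: (J *m u *m u^T).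
  apply/matrixP => i j; move/matrixP/(_ i j): e.
  by rewrite !mxE eq_sym => ->; rewrite mulrN.
rewrite /preserves eT /transvection mulmxBl mul1mx mulmxDr mulmx1 mulmxBl.
rewrite -!scalemxAl -!scalemxAr.
have -> : J *m u *m u^T *m J *m (u *m (u^T *m J)) = 0.
  rewrite -!mulmxA (mulmxA _ J) (mulmxA (u^T *m J)) formE formvv.
  by rewrite raddf0 mul0mx !mulmx0.
by rewrite !scaler0 subr0 !mulmxA subrK.
Qed.

Hypothesis (J_nondeg : forall v, v != 0 -> exists w, form v w != 0).

Let transitive_step v w : form v w != 0 -> exists2 S, preserves S & S *m v = w.
Proof.
move=> vw; exists (transvection (form (w - v) v)^-1 (w - v)).
  exact: transvection_preserves.
rewrite transvectionE mulVf ?scale1r; first by rewrite addrC subrK.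
by rewrite formC oppr_eq0 form_Dr -scaleN1r [X in _ + X]/form -scalemxAr mxE [X in _ + _ * X](formvv v) mulr0 addr0.
Qed.

(** If [form v w] is non-zero, the transvection along [w - v] with the right
    scalar carries [v] to [w].  Otherwise one goes through a vector [y] that is
    orthogonal to neither: two vectors that are not orthogonal to [v] and to [w]
    respectively, or their sum, provide it. *)
Lemma preserves_transitive v w : v != 0 -> w != 0 -> exists2 S, preserves S & S *m v = w.
Proof.
move=> v0 w0; suff [y vy yw] : exists2 y, form v y != 0 & form y w != 0.
  have [S hS <-] := transitive_step yw; have [T hT <-] := transitive_step vy.
  by exists (S *m T); [exact: preserves_mul|rewrite mulmxA].
have [y1 vy1] := J_nondeg v0; have [y2 wy2] := J_nondeg w0.
have [wy1|wy1] := eqVneq (form w y1) 0; last first.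
  by exists y1 => //; rewrite formC oppr_eq0.
have [vy2|vy2] := eqVneq (form v y2) 0; last first.
  by exists y2 => //; rewrite formC oppr_eq0.
exists (y1 + y2); first by rewrite form_Dr vy2 addr0.
by rewrite formC oppr_eq0 form_Dr wy1 add0r.
Qed.

End Transvections.

Lemma trace_rank1 (K : comPzRingType) m (v p : 'cV[K]_m) (N : 'M_m) :
  \tr (v *m p^T *m N) = (p^T *m N *m v) 0 0.
Proof. by rewrite -mulmxA mxtrace_mulC /mxtrace big_ord1. Qed.

(** * The minimal nilpotent orbit *)
Section Orbit.
Variables (R : realType) (n : nat).
Local Notation C := R[i].
Local Notation J := (Omega R n).
Local Notation vect := 'cV[C]_(n + n).
Implicit Types (x y : sp R n) (a b : 'I_(n + n)) (v w : vect) (S : 'M[C]_(n + n)).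

Definition ev v x : C := (val x).@[fun a => v a 0].

Lemma ev_is_linear v : linear_for *%R (ev v).
Proof.
move=> c x y; have e : val (c *: x + y) = c *: val x + val y by [].
by rewrite /ev e mevalD mevalZ.
Qed.
HB.instance Definition _ v := GRing.isLinear.Build C (sp R n) C *%R (ev v) (ev_is_linear v).

Lemma ev_quad v a b : ev v (quad R a b) = v a 0 * v b 0.
Proof. by rewrite /ev mevalM !mevalXU. Qed.

Lemma sp_scalar_ext (xi eta : {scalar sp R n}) :
  (forall a b, xi (quad R a b) = eta (quad R a b)) -> xi =1 eta.
Proof.
move=> e x; rewrite (sp_quadE x) !linear_sum; apply: eq_bigr => a _.
by rewrite !linear_sum; apply: eq_bigr => b _; rewrite !linearZ /= e.
Qed.

Lemma ev_Ad v S x : ev v (Ad S x) = ev (invmx S *m v) x.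
Proof.
rewrite /ev /= /linear_subst comp_mpoly_meval; apply: meval_eq => a.
rewrite tnth_mktuple raddf_sum mxE; apply: eq_bigr => b _ /=.
by rewrite mevalZ mevalXU.
Qed.

Lemma ev_inj x y : (forall v, ev v x = ev v y) -> x = y.
Proof.
move=> e; apply: val_inj; apply/eqP; rewrite -subr_eq0; apply/eqP.
apply: mpoly_fun_eq0 => v; rewrite mevalB; apply/eqP; rewrite subr_eq0; apply/eqP.
by have := e (\col_a v a); rewrite /ev; under meval_eq => a do rewrite mxE;
  under [in RHS]meval_eq => a do rewrite mxE.
Qed.

Lemma Omega_nondeg v : v != 0 -> exists w, form J v w != 0.
Proof.
move=> v0; apply/not_existsP => h; move/eqP: v0; apply.
have vJ : v^T *m J = 0.
  apply/rowP => a; rewrite [RHS]mxE; have := h (delta_mx a 0).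
  rewrite /form -(colE a) mxE => /negP/negPn/eqP; exact.
have := congr1 (fun M => M *m J) vJ.
rewrite mul0mx -mulmxA OmegaK mul_mx_scalar scaleN1r => /eqP.
by rewrite oppr_eq0 => /eqP/(congr1 trmx); rewrite trmxK trmx0.
Qed.

Lemma symplectic_unit S : symplectic S -> S \in unitmx.
Proof.
move=> hS; have : - J *m S^T *m J *m S = 1%:M.
  have -> : - J *m S^T *m J *m S = - (J *m (S^T *m J *m S)) by rewrite !mulNmx !mulmxA.
  by rewrite [X in J *m X]hS OmegaK raddfN opprK.
by move/mulmx1_unit => [].
Qed.

Definition min_orbit (eta : {scalar sp R n}) : Prop := exists2 v, v != 0 & eta =1 ev v.

Lemma min_orbit_coadjoint : (0 < n)%N -> coadjoint_orbit min_orbit.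
Proof.
move=> n0; have [e e0] : exists e : vect, e != 0.
  pose i : 'I_(n + n) := zi (Ordinal n0); exists (delta_mx i 0).
  apply/eqP => /matrixP/(_ i 0); rewrite !mxE !eqxx => /eqP.
  by rewrite oner_eq0.
exists (ev e : {scalar sp R n}) => eta; split.
  move=> [v v0 etav].
  have [S hS Se] := preserves_transitive (Omega_tr R n) Omega_nondeg e0 v0.
  exists S => // x; rewrite etav ev_Ad -Se mulmxA mulVmx ?mul1mx //.
  exact: symplectic_unit.
move=> [S hS etaS]; have Su := symplectic_unit hS.
exists (S *m e).
  by apply: contraNneq e0 => Se0; rewrite -(mul1mx e) -(mulVmx Su) -mulmxA Se0 mulmx0.
move=> y; have -> : y = Ad S (Ad (invmx S) y).
  by apply: ev_inj => v; rewrite !ev_Ad invmxK mulmxA mulmxV ?mul1mx.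
by rewrite etaS [RHS]ev_Ad mulmxA mulVmx // mul1mx.
Qed.

Lemma sp_matrixE x : sp_matrix x = J^T *m \matrix_(a, b) hess x a b.
Proof.
apply/matrixP => a b; rewrite mxE poissonE bidiffS mxE raddf_sum /=.
apply: eq_bigr => c _; rewrite ham_X mulrC mcoeffCM [J^T _ _]mxE [(\matrix_(_, _) _) _ _]mxE.
by congr (_ * _); rewrite /hess mcoeff_mderiv mnm0E add0m.
Qed.

Definition lin (p : vect) : {mpoly C[n + n]} := \sum_a p a 0 *: 'X_a.

Lemma mderiv_lin p a : (lin p)^`M(a) = (p a 0)%:MP.
Proof.
rewrite /lin raddf_sum (bigD1 a) //= big1 => [|b /negPf ba].
  by rewrite mderivZ mderivXU eqxx addr0 -mul_mpolyC mulr1.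
by rewrite mderivZ mderivXU ba scaler0.
Qed.

Lemma lin_sq_homog c p : c *: (lin p * lin p) \is 2.-homog.
Proof.
rewrite rpredZ //; have lin1 : lin p \is 1.-homog.
  by rewrite rpred_sum // => a _; rewrite rpredZ // dhomogX /= mdeg1.
exact: (dhomogM lin1 lin1).
Qed.

Definition lin_sq c p : sp R n := DHomog (lin_sq_homog c p).

Lemma hess_lin_sq c p a b : hess (lin_sq c p) a b = c * (2%:R * (p a 0 * p b 0)).
Proof.
rewrite /hess /= !mderivZ !mcoeffZ; congr (_ * _).
rewrite mderivM mderiv_lin [lin p * _]mulrC -mulr2n mderivMn mderiv_mulC mderiv_lin.
by rewrite -rmorphM mcoeffMn mcoeffC eqxx mulr1 mulr_natl.
Qed.

Lemma ev_hess v y : ev v y = 2%:R^-1 * (v^T *m (\matrix_(a, b) hess y a b) *m v) 0 0.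
Proof.
have -> : ev v y = \sum_a \sum_b 2%:R^-1 * hess y a b * (v a 0 * v b 0).
  rewrite {1}(sp_quadE y) linear_sum; apply: eq_bigr => a _.
  by rewrite linear_sum; apply: eq_bigr => b _; rewrite linearZ /= ev_quad.
rewrite mxE exchange_big mulr_sumr; apply: eq_bigr => b _.
rewrite mxE mulr_suml mulr_sumr; apply: eq_bigr => a _.
by rewrite [v^T _ _]mxE [(\matrix_(_, _) _) _ _]mxE; ring.
Qed.

(** With [p = - J v], the quadratic polynomial [- (1/4) (lin p) ^ 2] has matrix
    [(1/2) v *m p^T].  The square of this matrix contains the factor
    [p^T *m v = form v v = 0], and its trace pairing with [y] is half the Hessian
    of [y] at [v], that is [y(v)]. *)
Lemma ev_nilpotent v : nilpotent_functional (ev v : {scalar sp R n}).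
Proof.
pose p : vect := - (J *m v); pose c : C := - 4%:R^-1.
have Jp : J *m p = v by rewrite mulmxN mulmxA OmegaK mul_scalar_mx scaleN1r opprK.
have Hp : \matrix_(a, b) hess (lin_sq c p) a b = (2%:R * c) *: (p *m p^T).
  apply/matrixP => a b; rewrite mxE [RHS]mxE hess_lin_sq [(p *m _) _ _]mxE big_ord1.
  by rewrite [p^T _ _]mxE; ring.
have Mp : sp_matrix (lin_sq c p) = 2%:R^-1 *: (v *m p^T).
  rewrite sp_matrixE Hp Omega_tr -scalemxAr mulNmx mulmxA Jp scalerN -scaleNr.
  by congr (_ *: _); rewrite /c; field.
have pv : p^T *m v = 0.
  have -> : p^T *m v = (form J v v)%:M.
    by rewrite -formE /p linearN /= trmx_mul Omega_tr !(mulNmx, mulmxN) opprK.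
  by rewrite formvv ?raddf0 //; apply: Omega_tr.
exists (lin_sq c p); first exists 2%N.
  rewrite Mp expr2 -[_ * _]/(_ *m _) -scalemxAl -scalemxAr.
  by rewrite -mulmxA (mulmxA p^T) pv mul0mx mulmx0 !scaler0.
move=> y; rewrite Mp sp_matrixE -scalemxAl linearZ /= [LHS]ev_hess; congr (_ * _).
rewrite trace_rank1; have -> : v^T = p^T *m J^T by rewrite -trmx_mul Jp.
by rewrite !mulmxA.
Qed.

Lemma min_orbit_nonzero_nilpotent : (0 < n)%N -> nonzero_nilpotent_orbit min_orbit.
Proof.
move=> n0; split; first exact: min_orbit_coadjoint.
move=> xi [v v0 xiv]; split.
  by have [x xk xtr] := ev_nilpotent v; exists x => // y; rewrite xiv xtr.
have [a va] : exists a, v a 0 != 0.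
  apply/not_existsP => h; move/eqP: v0; apply; apply/colP => a.
  by rewrite mxE; apply/eqP/negPn/negP/h.
by exists (quad R a a); rewrite xiv ev_quad mulf_neq0.
Qed.

(** On [min_orbit] both sides are the product of the same four coordinates of
    a vector. *)
Lemma closure_quadric (xi : {scalar sp R n}) a b c d :
  zariski_closure min_orbit xi ->
  xi (quad R a b) * xi (quad R c d) = xi (quad R a c) * xi (quad R b d).
Proof.
move=> /(_ (quadric (quad R a b) (quad R c d) (quad R a c) (quad R b d))).
rewrite sym_eval_quadric => h; apply/eqP; rewrite -subr_eq0; apply/eqP/h.
by move=> eta [v _ etav]; rewrite sym_eval_quadric !etav !ev_quad; ring.
Qed.

(** By [closure_quadric] the values of [xi] on the products of two variables
    form a symmetric matrix of rank at most 1, which over the complex numbers is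
    [v *m v^T]; [v] is a row of that matrix divided by the square root of its
    diagonal entry. *)
Lemma closure_min_orbit (xi : {scalar sp R n}) :
  zariski_closure min_orbit xi -> (exists x, xi x != 0) -> min_orbit xi.
Proof.
move=> xiO [x xix]; pose s a b := xi (quad R a b).
have sC a b : s a b = s b a.
  by congr (xi _); apply: val_inj; apply: mulrC.
have sq a b c d : s a b * s c d = s a c * s b d by exact: closure_quadric.
have [a sa] : exists a, s a a != 0.
  apply/not_existsP => h; have s0 a b : s a b = 0.
    have /negP/negPn/eqP saa := h a; have := sq a b a b; rewrite saa mul0r => /eqP.
    by rewrite mulf_eq0 orbb => /eqP.
  move/eqP: xix; apply; rewrite (@sp_scalar_ext xi (\0 : {scalar _})) //.
pose v : vect := \col_b (s a b / sqrtC (s a a)).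
have xiv : xi =1 ev v.
  apply: (@sp_scalar_ext xi (ev v : {scalar _})) => b c; rewrite /= ev_quad !mxE.
  rewrite mulrACA -invfM -expr2 sqrtCK sq -/(s b c).
  by rewrite [s a a * _]mulrC mulfK.
exists v => //; apply: contraNneq xix => v0.
have e0 : ev 0 =1 \0.
  by apply: (@sp_scalar_ext (ev 0 : {scalar _}) (\0 : {scalar _})) => b c;
    rewrite /= ev_quad mxE mul0r.
by rewrite xiv v0 e0.
Qed.

(** Minimality puts [O] inside the closure of [min_orbit], hence inside
    [min_orbit]; since the latter is a single orbit, the two are equal. *)
Theorem minimal_orbitE (O : {scalar sp R n} -> Prop) : (0 < n)%N ->
  minimal_nilpotent_orbit O -> forall eta, O eta <-> min_orbit eta.
Proof.
move=> n0 [[[xi Oxi] Onil] Omin].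
have O_min eta : O eta -> min_orbit eta.
  move=> Oeta; apply: closure_min_orbit; last by have [] := Onil _ Oeta.
  exact: Omin (min_orbit_nonzero_nilpotent n0) _ Oeta.
move=> eta; split=> [|[v v0 etav]]; first exact: O_min.
have [v1 v10 xiv1] : min_orbit xi.
  apply: O_min; apply/Oxi; exists 1%:M; first by rewrite /symplectic trmx1 mul1mx mulmx1.
  move=> x; congr (xi _); apply: ev_inj => w; rewrite ev_Ad.
  by rewrite invmx1 mul1mx.
have [S hS Sv] := preserves_transitive (Omega_tr R n) Omega_nondeg v10 v0.
apply/Oxi; exists S => // x; rewrite etav xiv1 ev_Ad -Sv mulmxA mulVmx ?mul1mx //.
exact: symplectic_unit.
Qed.

Local Notation A := (Aeven R n).

Definition kappa : sym (sp R n) -> A := env_hom *%R 1 (@momentum R n).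

Let mulPl c (f f' g : A) : (c *: f + f') * g = c *: (f * g) + f' * g.
Proof. by rewrite mulrDl -scalerAl. Qed.

Let mulPr c (f g g' : A) : f * (c *: g + g') = c *: (f * g) + f * g'.
Proof. by rewrite mulrDr scalerAr. Qed.

Let momentum_comm (x y : sp R n) :
  momentum 0 = momentum x * momentum y - momentum y * momentum x.
Proof. by rewrite mulrC subrr; apply: (raddf0 (@momentum R n)). Qed.

Lemma kappa_hom : alg_hom_extending *%R 1 (@momentum R n) kappa.
Proof.
apply: env_homP; [exact: mulPl|exact: mulPr|exact: mulrA|exact: mul1r|exact: mulr1| |].
  exact: momentumP.
exact: momentum_comm.
Qed.

Lemma kappa_word (r : seq (sp R n)) :
  kappa (sym_class (word r)) = foldr (fun x g => momentum x * g) 1 r.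
Proof.
apply: env_hom_word; [exact: mulPl|exact: mulPr|exact: mulrA| |].
  exact: momentumP.
exact: momentum_comm.
Qed.

Lemma kappa0 : kappa 0 = 0.
Proof.
have [kP _ _ _] := kappa_hom.
by have := kP (-1) 0 0; rewrite scaler0 addr0 scaleN1r addNr.
Qed.

Lemma eval_kappa v (s : sym (sp R n)) (eta : {scalar sp R n}) : eta =1 ev v ->
  (val (kappa s)).@[fun a => v a 0] = sym_eval eta s.
Proof.
move=> e; apply: (@env_hom_sym_eval _ _ A *%R 1 _ (fun f : A => (val f).@[fun a => v a 0])).
- move=> c f g; have E : val (c *: f + g) = c *: val f + val g by [].
  by rewrite E mevalD mevalZ.
- by move=> f g; rewrite valM mevalM.
- exact: meval1.
- by move=> x; rewrite e.
Qed.

(** By [eval_kappa] vanishing on the orbit means that [kappa s] vanishes at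
    all non-zero vectors.  The product with a variable then vanishes
    everywhere. *)
Lemma kappa_eq0 O (s : sym (sp R n)) : (0 < n)%N -> minimal_nilpotent_orbit O ->
  kappa s = 0 <-> vanishing_ideal O s.
Proof.
move=> n0 Omin; have OE := minimal_orbitE n0 Omin; split=> [s0 eta /OE[v v0 etav]|s0].
  by rewrite -(eval_kappa s etav) s0 meval0.
pose a : 'I_(n + n) := zi (Ordinal n0).
suff /eqP : 'X_a * val (kappa s) = 0.
  rewrite mulf_eq0 => /orP[/eqP e|/eqP e]; last exact: val_inj.
  have := congr1 (mcoeff U_(a)) e; rewrite mcoeffX eqxx mcoeff0 => /eqP.
  by rewrite oner_eq0.
apply: mpoly_fun_eq0 => v; rewrite mevalM mevalXU.
have [->|va] := eqVneq (v a) 0; first by rewrite mul0r.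
pose w : vect := \col_b v b.
have -> : (val (kappa s)).@[v] = (val (kappa s)).@[fun b => w b 0].
  by apply: meval_eq => b; rewrite mxE.
rewrite (@eval_kappa w s (ev w)) // s0 ?mulr0 //; apply/OE; exists w => //.
by apply: contraNneq va => /matrixP/(_ a 0); rewrite !mxE => ->.
Qed.

End Orbit.

(** * The kernel of the Moyal homomorphism *)
Section MpolyDegree.
Variables (K : fieldType) (m : nat).
Implicit Types (f g : {mpoly K[m]}).

Lemma msizeD_max d f g : (msize f <= d)%N -> (msize g <= d)%N -> (msize (f + g) <= d)%N.
Proof. by move=> fd gd; rewrite (leq_trans (msizeD_le _ _)) // geq_max fd. Qed.

Lemma msize_sum_max (I : Type) (r : seq I) (F : I -> {mpoly K[m]}) d :
  (forall i, msize (F i) <= d)%N -> (msize (\sum_(i <- r) F i)%R <= d)%N.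
Proof.
move=> Fd; apply: (big_rec (fun p => (msize p <= d)%N)) => [|i p _ pd].
  by rewrite msize0.
exact: msizeD_max.
Qed.

Lemma msizeM_deg d e f g :
  (msize f <= d.+1)%N -> (msize g <= e.+1)%N -> (msize (f * g)%R <= (d + e).+1)%N.
Proof.
have [->|f0] := eqVneq f 0; first by rewrite mul0r msize0.
have [->|g0] := eqVneq g 0; first by rewrite mulr0 msize0.
rewrite msizeM //; move: (msize f) (msize g) => a b; lia.
Qed.

Lemma mcoeff_pihomog d f mu : (pihomog mdeg d f)@_mu = if mdeg mu == d then f@_mu else 0.
Proof.
elim/mpolyind: f => [|c nu f _ _ IH]; first by rewrite raddf0 mcoeff0 if_same.
rewrite raddfD /= linearZ /= pihomogX !mcoeffD !mcoeffZ IH mcoeffX.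
case: (eqVneq nu mu) => [->|nm]; case: ifP => _; rewrite ?mcoeffX ?mcoeff0 ?eqxx ?mulr0 ?add0r //.
  by rewrite (negPf nm) mulr0 add0r; case: ifP.
Qed.

Lemma homog_msize_eq0 d f : f \is d.-homog -> (msize f <= d)%N -> f = 0.
Proof.
move=> /dhomogP fd; apply: contraTeq => f0.
by rewrite -(mlead_deg f0) (fd _ (mlead_supp f0)) -ltnNge.
Qed.

Lemma homog_direct N (g : nat -> {mpoly K[m]}) (d : nat -> nat) : injective d ->
  (forall k, g k \is (d k).-homog) -> \sum_(k < N) g k = 0 ->
  forall k, (k < N)%N -> g k = 0.
Proof.
move=> dI gd g0 k kN; have := congr1 (pihomog mdeg (d k)) g0.
rewrite raddf0 raddf_sum (bigD1 (Ordinal kN)) //= big1 => [|j jk].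
  by rewrite addr0 (pihomog_dE (gd k)).
by apply: (pihomog_ne0 _ (gd j)); rewrite (inj_eq dI).
Qed.

End MpolyDegree.

Section JosephIdeal.
Variables (R : realType) (n : nat).
Local Notation C := R[i].
Local Notation A := (Aeven R n).
Local Notation sp := (sp R n).
Implicit Types (f g : A) (x y : sp).

Definition weyl_hom : env (@sp_lie R n) -> A := env_hom (@weyl R n) 1 (@momentum R n).

Lemma momentum_lie x y : momentum (sp_lie x y) =
  weyl (momentum x) (momentum y) - weyl (momentum y) (momentum x).
Proof. by rewrite weyl_commutator; apply: val_inj. Qed.

Lemma weyl_hom_alg : alg_hom_extending (@weyl R n) 1 (@momentum R n) weyl_hom.
Proof.
apply: env_homP.
- exact: weylPl.
- exact: weylPr.
- exact: weylA.
- exact: weyl1l.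
- exact: weyl1r.
- exact: momentumP.
- exact: momentum_lie.
Qed.

(** The even polynomials of degree less than [2 * k]: [msize] exceeds the
    degree by one. *)
Definition low (k : nat) f : Prop := (msize (val f) <= 2 * k)%N.

Lemma msize_bidiff d e p (f g : {mpoly C[n + n]}) :
  (msize f <= (p + d).+1)%N -> (msize g <= (p + e).+1)%N ->
  (msize (bidiff p f g) <= (d + e).+1)%N.
Proof.
elim: p f g => [|p IH] f g fd ge; first exact: msizeM_deg.
rewrite bidiffS; apply: msize_sum_max => a; apply: IH.
  exact: msize_mderiv_le.
by rewrite /ham; case: split => i; rewrite ?msizeN msize_mderiv_le.
Qed.

Lemma msize_moyal_term d e p (f g : {mpoly C[n + n]}) :
  (msize f <= (p + d).+1)%N -> (msize g <= (p + e).+1)%N ->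
  (msize (moyal_term p f g) <= (d + e).+1)%N.
Proof.
move=> fd ge; rewrite moyal_term.unlock; apply: leq_trans (msizeZ_le _ _) _.
exact: msize_bidiff.
Qed.

Lemma even_deg_msize k f : even_deg k f -> (msize (val f) <= (2 * k).+1)%N.
Proof. exact: homog_msize_le. Qed.

(** The terms with [p = 1] and [p = 2] lower the degree by [2 * p]. *)
Lemma weyl_momentum_low k x f : (msize (val f) <= (2 * k).+1)%N ->
  low k.+1 (weyl (momentum x) f - momentum x * f).
Proof.
move=> fk; rewrite weyl_momentum addDDK /low valD !val_even_term.
have x2 := msize_momentum x.
apply: msizeD_max.
  by apply: leq_trans (@msize_moyal_term 1 (2 * k - 1) 1 _ _ _ _) _; lia.
by apply: leq_trans (@msize_moyal_term 0 (2 * k - 2) 2 _ _ _ _) _; lia.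
Qed.

Lemma foldr_even_deg (r : seq sp) :
  even_deg (size r) (foldr (fun x g => momentum x * g) 1 r).
Proof.
elim: r => [|x r IH]; first exact: dhomog1.
by rewrite /even_deg /= mulnS; apply: (dhomogM (valP x) IH).
Qed.

Lemma foldr_weyl_low (r : seq sp) :
  low (size r) (foldr (fun x g => weyl (momentum x) g) 1 r
                - foldr (fun x g => momentum x * g) 1 r).
Proof.
elim: r => [|x r IH]; first by rewrite subrr /low raddf0 msize0.
move: (foldr_even_deg r) IH; rewrite /low [size (x :: r)]/= ![foldr _ _ (x :: r)]/=.
move: (foldr (fun x g => weyl _ g) 1 r) (foldr (fun x g => _ * g) 1 r) => P Q Qr PQ.
have Pr : (msize (val P) <= (2 * size r).+1)%N.
  rewrite -[P](subrK Q) valD; apply: msizeD_max; first by apply: leqW; exact: PQ.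
  exact: even_deg_msize.
have -> : weyl (momentum x) P - momentum x * Q =
    (weyl (momentum x) P - momentum x * P) + momentum x * (P - Q).
  by rewrite mulrBr addrA subrK.
rewrite /low valD; apply: msizeD_max; first exact: weyl_momentum_low.
rewrite valM; have [->|PQ0] := eqVneq (P - Q) 0; first by rewrite raddf0 mulr0 msize0.
have : (0 < msize (val (P - Q)%R))%N.
  by rewrite lt0n msize_poly_eq0; apply: contraNneq PQ0 => e; apply/eqP/val_inj.
move=> PQ_gt0.
apply: leq_trans (@msizeM_deg C _ 2 (msize (val (P - Q)%R)).-1 _ _ (msize_momentum x) _) _.
  by rewrite prednK.
by move: PQ PQ_gt0; move: (msize _) (size r) => a b; lia.
Qed.

Lemma low_top k f : low k.+1 f -> exists2 g, even_deg k g & low k (f - g).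
Proof.
move=> fk; pose g := pihomog mdeg (2 * k) (val f).
have gk : g \is (2 * k).-homog by exact: pihomogP.
have ge : g \in parity_mpoly false.
  apply/parity_mpolyP => m; rewrite mcoeff_pihomog; case: ifP => [/eqP -> _|]; last by rewrite eqxx.
  by rewrite oddM.
exists (AEven ge); first exact: gk.
rewrite /low valB msizeE; apply/bigmax_leqP_seq => m; rewrite mcoeff_msupp mcoeffB.
rewrite mcoeff_pihomog => fm _; have [e|mk] := eqVneq (mdeg m) (2 * k)%N.
  by move: fm; rewrite e eqxx subrr eqxx.
rewrite (negPf mk) subr0 in fm.
have := parity_mpolyP _ _ (valP f) m fm; have := msize_mdeg_lt (p := val f) (m := m).
rewrite mcoeff_msupp => /(_ fm) => h; have := leq_trans h fk.
by move: mk; move: (mdeg m) => d; lia.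
Qed.

Lemma mnm_quads k (m : 'X_{1..n + n}) : mdeg m = (2 * k)%N ->
  exists2 r : seq sp, size r = k & val (foldr (fun x g => momentum x * g) 1 r) = 'X_[m].
Proof.
elim: k m => [|k IH] m mk.
  exists [::] => //; move/eqP: mk; rewrite muln0 mdeg_eq0 => /eqP ->.
  by rewrite mpolyX0.
have pick d (mu : 'X_{1..n + n}) : mdeg mu = d.+1 ->
      exists2 a, mdeg (mu - U_(a)) = d & mu = (U_(a) + (mu - U_(a)))%MM.
  move=> mud; have [a mu_a] : exists a, mu a != 0%N.
    apply/existsP; apply/contra_eqT: mud => /existsPn mu0; rewrite mdegE big1 // => a _.
    by have /negPn/eqP := mu0 a.
  have e : mu = (U_(a) + (mu - U_(a)))%MM by rewrite addmC submK // lep1mP.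
  by exists a => //; move: mud; rewrite {1}e mdegD mdeg1 => -[].
rewrite mulnS in mk; have [a mk1 ->] := pick _ _ mk; have [b mk2 ->] := pick _ _ mk1.
have [r rk re] := IH _ mk2; exists (quad R a b :: r); first by rewrite /= rk.
rewrite [LHS](_ : _ = 'X_a * 'X_b * val (foldr (fun x g => momentum x * g) 1 r)); last exact: valM.
by rewrite re -!mpolyXD addmA.
Qed.

Lemma weyl_hom_word (r : seq sp) :
  weyl_hom (class (@sp_lie R n) (word r)) = foldr (fun x g => weyl (momentum x) g) 1 r.
Proof.
apply: env_hom_word; [exact: weylPl|exact: weylPr|exact: weylA| |].
  exact: momentumP.
exact: momentum_lie.
Qed.

Lemma kappa_onto k f : even_deg k f ->
  exists2 t, word_length k t & kappa (sym_class t) = f.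
Proof.
move=> /dhomogP fk; suff [t tk tf] : exists2 t, word_length k t & val (kappa (sym_class t)) = val f.
  by exists t => //; apply: val_inj.
have [kP _ _ _] := kappa_hom R n.
rewrite [val f]mpolyE big_seq.
apply: (big_rec (fun p => exists2 t, word_length k t & val (kappa (sym_class t)) = p)).
  have [t tk t0] := @word_length0 C sp k; exists t => //.
  by rewrite t0 /sym_class class0 (kappa0 R n) raddf0.
move=> m p /fk mk [t tk <-]; have [r rk re] := mnm_quads mk.
have [u uk e] := word_length_cons ((val f)@_m) rk tk; exists u => //.
rewrite /sym_class e kP [val _]valD; congr (_ + _).
by rewrite [kappa (class _ _)]kappa_word -re.
Qed.

Theorem weyl_kernel_gr (O : {scalar sp} -> Prop) s : (0 < n)%N ->
  minimal_nilpotent_orbit O ->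
  gr (fun u => weyl_hom u = 0) s <-> vanishing_ideal O s.
Proof.
move=> n0 Omin; apply: iff_trans (kappa_eq0 s n0 Omin).
have [phiP _ _ _] := weyl_hom_alg; have [kP _ _ _] := kappa_hom R n.
apply: (@gr_ker _ _ _ _ weyl_hom (@kappa R n) (@even_deg R n) low).
- exact: phiP.
- exact: kP.
- by move=> k; apply: rpred0.
- by move=> k c f g fk gk; rewrite /even_deg -[val _]/(c *: val f + val g) rpredD ?rpredZ.
- by move=> k; rewrite /low raddf0 msize0.
- move=> k c f g fk gk; rewrite /low -[val _]/(c *: val f + val g).
  by apply: msizeD_max => //; apply: leq_trans (msizeZ_le _ _) fk.
- by move=> k f fk /(homog_msize_eq0 fk) e; apply: val_inj.
- by move=> j k f jk /even_deg_msize fj; apply: leq_trans fj _; lia.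
- by move=> j k f jk fj; apply: leq_trans fj _; rewrite leq_mul2l jk orbT.
- move=> N g gd g0 k kN; apply: val_inj.
  apply: (@homog_direct C (n + n) N (fun k => val (g k)) (fun k => 2 * k)%N) => //.
    by move=> i j /eqP; rewrite eqn_pmul2l // => /eqP.
  have := congr1 val g0; rewrite raddf_sum raddf0; exact.
- by move=> r; rewrite kappa_word; apply: foldr_even_deg.
- by move=> r; rewrite kappa_word weyl_hom_word; apply: foldr_weyl_low.
- move=> f; rewrite /low muln0 leqn0 msize_poly_eq0 => /eqP e; exact: val_inj.
- exact: low_top.
- exact: kappa_onto.
Qed.

Lemma weyl_kernel_ideal : two_sided_ideal (fun u => weyl_hom u = 0).
Proof.
have [phiP _ phiM _] := weyl_hom_alg.
have w0l f : weyl 0 f = 0 by have := weylPl (-1) 0 0 f; rewrite scaler0 addr0 scaleN1r addNr.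
have w0r f : weyl f 0 = 0 by have := weylPr (-1) f 0 0; rewrite scaler0 addr0 scaleN1r addNr.
split.
- by have := phiP (-1) 0 0; rewrite scaler0 addr0 scaleN1r addNr.
- by move=> u v u0 v0; rewrite -[u]scale1r phiP u0 v0 scaler0 addr0.
- by move=> a u b u0; rewrite !phiM u0 w0r w0l.
Qed.

End JosephIdeal.

(** * Densities of weight one quarter from even polynomials *)
Section LinearExtension.
Variables (K : comNzRingType) (m : nat) (V : lmodType K) (b : 'X_{1..m} -> V).
Implicit Types (p q : {mpoly K[m]}) (mu : 'X_{1..m}).

Definition linext p : V := \sum_(mu <- msupp p) p@_mu *: b mu.

Lemma linextEw (r : seq 'X_{1..m}) p : uniq r -> {subset msupp p <= r} ->
  linext p = \sum_(mu <- r) p@_mu *: b mu.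
Proof.
move=> rU pr; rewrite (bigID (mem (msupp p))) /= [X in _ + X]big1 => [|mu]; last first.
  by move/memN_msupp_eq0 ->; rewrite scale0r.
rewrite addr0 -big_filter; apply: perm_big; apply: uniq_perm.
- exact: msupp_uniq.
- exact: filter_uniq.
by move=> mu; rewrite mem_filter; case: (boolP (_ \in msupp p)) => // /pr ->.
Qed.

Lemma linextP c p q : linext (c *: p + q) = c *: linext p + linext q.
Proof.
pose r := undup (msupp p ++ msupp q ++ msupp (c *: p + q)).
have rU : uniq r by exact: undup_uniq.
rewrite !(linextEw rU); first last.
- by move=> mu; rewrite mem_undup !mem_cat => ->; rewrite ?orbT.
- by move=> mu; rewrite mem_undup !mem_cat => ->; rewrite ?orbT.
- by move=> mu; rewrite mem_undup !mem_cat => ->; rewrite ?orbT.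
rewrite scaler_sumr -big_split; apply: eq_bigr => mu _ /=.
by rewrite mcoeffD mcoeffZ scalerDl scalerA.
Qed.

Lemma linextX mu : linext 'X_[mu] = b mu.
Proof. by rewrite /linext msuppX big_seq1 mcoeffX eqxx scale1r. Qed.

Lemma linext0 : linext 0 = 0.
Proof. by have := linextP (-1) 0 0; rewrite scaler0 addr0 scaleN1r addNr. Qed.

End LinearExtension.

Section PolynomialModel.
Variables (K : numFieldType) (s : K).
Hypothesis (s2 : s * s = 1).
Implicit Types (f : {poly K}).

(** The double factorial [(2 j - 1)!!]. *)
Fixpoint odd_fact (j : nat) : nat := if j is i.+1 then ((2 * i).+1 * odd_fact i)%N else 1%N.

Lemma odd_fact_gt0 j : (0 < odd_fact j)%N.
Proof. by elim: j => //= j IH; rewrite muln_gt0 IH. Qed.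

(** The even part of [f], as a polynomial in [y = x ^ 2].  The rescaling of
    ['X^(2 * j)] by [s ^ j (2 j - 1)!!] makes multiplication by [x ^ 2], [d/dx ^ 2]
    and the symmetrised [x d/dx] first-order operators in [y]: on the
    monomial of index [j] the first has to create a factor [2 j + 1], which the
    second absorbs. *)
Definition even_part f : {poly K} := \poly_(j < size f) (s ^+ j * (odd_fact j)%:R * f`_(2 * j)).

Lemma coef_even_part f j : (even_part f)`_j = s ^+ j * (odd_fact j)%:R * f`_(2 * j).
Proof.
rewrite coef_poly; case: ltnP => // fj; rewrite nth_default ?mulr0 //.
by apply: leq_trans fj _; rewrite leq_pmull.
Qed.

Lemma even_partP c f g : even_part (c *: f + g) = c *: even_part f + even_part g.
Proof.
apply/polyP => j; rewrite coefD coefZ !coef_even_part coefD coefZ.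
by ring.
Qed.

(** [lie_derivative] over an arbitrary field of characteristic 0. *)
Definition lie lam (v f : {poly K}) : {poly K} := v * f^`() + lam *: (v^`() * f).

Let n4 : (4%:R : K) != 0.
Proof. by rewrite pnatr_eq0. Qed.

Let coef_der f j : f^`()`_j = j.+1%:R * f`_j.+1.
Proof. by rewrite coef_deriv mulr_natl. Qed.

Let coef_deriv_X f j : (if j == 0%N then 0 else f^`()`_j.-1) = j%:R * f`_j.
Proof. by case: j => [|j] /=; rewrite ?mul0r // coef_deriv mulr_natl. Qed.

Lemma even_part_mulXX f :
  even_part ('X * ('X * f)) = lie 4%:R^-1 ((s * 2%:R) *: ('X * 'X)) (even_part f).
Proof.
have -> : lie 4%:R^-1 ((s * 2%:R) *: ('X * 'X)) (even_part f) =
    'X * (s *: (2%:R *: ('X * (even_part f)^`()) + even_part f)).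
  rewrite /lie derivZ derivM derivX mul1r mulr1 -!mul_polyC.
  have -> : (s * 2%:R)%:P = s%:P * 2%:R :> {poly K} by rewrite rmorphM rmorph_nat.
  have e : (4%:R^-1)%:P * 4%:R = 1 :> {poly K} by rewrite -(rmorph_nat polyC) -rmorphM mulVf.
  rewrite rmorph_nat; move: (even_part f) (even_part f)^`() => F F'.
  transitivity ('X * (s%:P * (2%:R * ('X * F') + ((4%:R^-1)%:P * 4%:R) * F))); first by ring.
  by rewrite e mul1r.
apply/polyP => -[|j].
  by rewrite coef_even_part muln0 !coefXM mulr0.
rewrite coef_even_part coefXM mulnS !coefXM /= coefZ coefD coefZ coefXM coef_deriv_X.
rewrite coef_even_part natrM exprS.
have -> : (2 * j).+1%:R = 2%:R * j%:R + 1 :> K by rewrite -addn1 natrD natrM.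
by ring.
Qed.

Lemma even_part_deriv2 f :
  even_part f^`()^`() = lie 4%:R^-1 (s * 2%:R)%:P (even_part f).
Proof.
rewrite /lie derivC mul0r scaler0 addr0; apply/polyP => j.
rewrite mul_polyC coefZ coef_der !coef_even_part !coef_der mulnS /= natrM exprS.
have -> : (2 * j).+2%:R = 2%:R * j.+1%:R :> K by rewrite -natrM mulnS.
move: (odd_fact j)%:R (s ^+ j) (f`__) => d t c.
transitivity (t * d * (2%:R * j.+1%:R * ((2 * j).+1%:R * c)) * (s * s)); last by ring.
by rewrite s2; ring.
Qed.

Lemma even_part_mulX_deriv f :
  even_part (s *: ('X * f)^`() - (2%:R^-1 * s) *: f)
  = lie 4%:R^-1 ((s * 2%:R) *: 'X) (even_part f).
Proof.
apply/polyP => j; rewrite /lie derivZ derivX coefD -!scalerAl mul1r !coefZ coefXM coef_even_part.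
rewrite coef_deriv_X coefB !coefZ coef_der coefXM /=.
rewrite coef_even_part.
have -> : (2 * j).+1%:R = 2%:R * j%:R + 1 :> K by rewrite -addn1 natrD natrM.
have h2 : 2%:R^-1 = 4%:R^-1 * 2%:R :> K by field.
by field.
Qed.

Lemma even_part_onto f : exists g, even_part g = f.
Proof.
have s0 : s != 0 by apply: contraTneq (oner_neq0 K) => s0; rewrite -s2 s0 mul0r eqxx.
exists (\sum_(i < size f) (f`_i / (s ^+ i * (odd_fact i)%:R)) *: 'X^(2 * i)).
apply/polyP => j; rewrite coef_even_part coef_sum.
under eq_bigr => i _ do rewrite coefZ coefXn eqn_pmul2l //.
have [jf|fj] := ltnP j (size f); last first.
  rewrite nth_default // big1 ?mulr0 // => i _.
  by rewrite gtn_eqF ?mulr0 // (leq_trans (ltn_ord i)).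
rewrite (bigD1 (Ordinal jf)) //= big1 => [|i]; last first.
  by rewrite -val_eqE /= eq_sym => /negPf ->; rewrite mulr0.
rewrite eqxx mulr1 addr0 mulrC mulfVK // mulf_neq0 ?expf_neq0 //.
by rewrite pnatr_eq0 -lt0n odd_fact_gt0.
Qed.

End PolynomialModel.

Lemma first_order_lin (K : comNzRingType) (V : algType K) (X x y x' y' : V) (h c : K) :
  X * (c *: x + y) + h *: (c *: x' + y') = c *: (X * x + h *: x') + (X * y + h *: y').
Proof. by rewrite mulrDr !scalerDr -scalerAr !scalerA [h * c]mulrC addrACA. Qed.

Section SymbolModel.
Variables (K : numFieldType) (m : nat) (a a' : 'I_m) (h : K).
Hypothesis (aa' : a != a').
Implicit Types (f : {mpoly K[m]}) (mu : 'X_{1..m}).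

(** Let ['X_a'] act on [C[x]] by [x] and ['X_a] by [2 h d/dx].  This is the
    symmetrised (Weyl) quantisation of ['X_[mu]] applied to the constant 1. *)
Definition model_term mu : {poly K} :=
  (h ^+ mu a * ((mu a') ^_ (mu a))%:R) *: 'X^(mu a' - mu a).

Definition model : {mpoly K[m]} -> {poly K} := linext model_term.

Lemma modelP c f g : model (c *: f + g) = c *: model f + model g.
Proof. exact: linextP. Qed.

Let model0 : model 0 = 0 := linext0 _.

Let modelZ c f : model (c *: f) = c *: model f.
Proof. by rewrite -[_ *: f]addr0 modelP model0 addr0. Qed.

Let modelD f g : model (f + g) = model f + model g.
Proof. by rewrite -[f in LHS]scale1r modelP scale1r. Qed.

(** The operator on the left is the Moyal product by ['X_a], so it acts after
    quantisation by [2 h d/dx]. *)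
Lemma model_annihilator f :
  model ('X_a * f + h *: f^`M(a')) = (2%:R * h) *: (model f)^`().
Proof.
elim/mpolyind: f => [|c mu f _ _ IH].
  by rewrite mulr0 raddf0 scaler0 addr0 model0 raddf0 scaler0.
transitivity (c *: model ('X_a * 'X_[mu] + h *: 'X_[mu]^`M(a'))
    + model ('X_a * f + h *: f^`M(a'))).
  by rewrite -modelP mderivD mderivZ; congr model; apply: first_order_lin.
rewrite IH modelP derivD derivZ scalerDr; congr (_ + _).
rewrite [RHS]scalerA [_ * c]mulrC -[RHS]scalerA; congr (_ *: _);
  rewrite -mpolyXD mderivX modelD !modelZ /model !linextX.
rewrite /model_term !(mnmDE, mnmBE, mnm1E) !eqxx [a' == a]eq_sym (negPf aa') !(addn0, subn0, add0n, add1n).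
rewrite derivZ derivXn subn1; move: (mu a) (mu a') => i j.
case: j => [|j]; first by rewrite ffact0n mulr0 !scale0r scaler0 sub0n mulr0n !scaler0 addr0.
rewrite /= subSS subSKn -[_ *+ (j.+1 - i)]scaler_nat !scalerA -scalerDl.
congr (_ *: _); have e : (j.+1 ^_ i)%:R * (j.+1 - i)%:R = j.+1%:R * (j ^_ i)%:R :> K.
  by rewrite -!natrM -ffactnSr ffactSS.
rewrite ffactSS natrM exprS.
transitivity (2%:R * h * h ^+ i * ((j.+1 ^_ i)%:R * (j.+1 - i)%:R)); last by ring.
by rewrite e; ring.
Qed.

(** The operator on the left is the Moyal product by ['X_a'], which acts by [x]
    after quantisation. *)
Lemma model_creator f :
  model ('X_a' * f - h *: f^`M(a)) = 'X * model f.
Proof.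
rewrite -scaleNr; elim/mpolyind: f => [|c mu f _ _ IH].
  by rewrite mulr0 raddf0 scaler0 addr0 model0 mulr0.
transitivity (c *: model ('X_a' * 'X_[mu] + (- h) *: 'X_[mu]^`M(a))
    + model ('X_a' * f + (- h) *: f^`M(a))).
  by rewrite -modelP mderivD mderivZ; congr model; apply: first_order_lin.
rewrite IH modelP mulrDr -scalerAr; congr (_ *: _ + _).
rewrite -mpolyXD mderivX modelD !modelZ /model !linextX.
rewrite /model_term !(mnmDE, mnmBE, mnm1E) !eqxx [a' == a]eq_sym (negPf aa') !(addn0, subn0, add0n, add1n).
rewrite subn1; move: (mu a) (mu a') => i j.
case: i => [|i]; first by rewrite !ffactn0 !subn0 scale0r scaler0 addr0 -scalerAr -exprS.
rewrite /= subSS !scalerA -scalerDl -scalerAr -exprS.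
have [ij|ji] := ltnP i j; last first.
  rewrite [j ^_ i.+1]ffact_small // mulr0 scale0r ffactSS.
  move: ji; rewrite leq_eqVlt => /orP[/eqP ->|ji].
    by rewrite natrM exprS; set d := (i ^_ i)%:R; rewrite -[RHS](scale0r 'X^(i - i));
      congr (_ *: _); ring.
  by rewrite ffact_small // muln0 !mulr0 addr0 scale0r.
rewrite subnSK // ffactSS; congr (_ *: _).
rewrite ffactnSr !natrM natrB 1?ltnW // exprS -!natr1; ring.
Qed.

End SymbolModel.

(** * The two charts of the projective line *)
Section LadderOperators.
Variables (R : realType) (n : nat).
Local Notation C := R[i].

(** The left Moyal product by the variable ['X_a] at [t = 1], on all
    polynomials, even or not. *)
Definition ladder (a : 'I_(n + n)) (f : {mpoly C[n + n]}) : {mpoly C[n + n]} :=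
  'X_a * f + 2%:R^-1 *: ham a f.

Lemma ladder_expand (K : comNzRingType) (V : comAlgType K) (h w : K) (x y f fx fy fxy : V) :
  x * (y * f + h *: fy) + h *: (w *: f + y * fx + h *: fxy) - (h * w) *: f =
  x * y * f + h *: (x * fy + y * fx) + (h * h) *: fxy.
Proof.
rewrite mulrDr mulrA -scalerAr -addrA -addrA -[RHS]addrA; congr (_ + _).
rewrite !scalerDr !scalerA.
move: (h *: _) ((h * w) *: _) (h *: _) (_ *: fxy) => A B D E.
by rewrite addDDK addrA.
Qed.

(** The Moyal product by ['X_a * 'X_b] is the symmetrised product of the two
    ladder operators, whose commutator is the scalar [Omega a b]. *)
Lemma val_weyl_quad a b (f : Aeven R n) :
  val (weyl (momentum (quad R a b)) f) =
  ladder a (ladder b (val f)) - (2%:R^-1 * Omega R n a b) *: val f.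
Proof.
rewrite weyl_momentum !valD valM ham_quad2 val_even_term.
rewrite -[val (momentum _)]/('X_a * 'X_b).
have -> : moyal_term 1 ('X_a * 'X_b) (val f) =
    2%:R^-1 *: ('X_a * ham b (val f) + 'X_b * ham a (val f)).
  rewrite -['X_b in LHS]mulr1 !moyal_termX !moyal_term1l !mul1r.
  by rewrite mul0r mulr0 add0r addr0 -scalerAr scalerDr.
have e : ham a (ladder b (val f)) = Omega R n a b *: val f + 'X_b * ham a (val f)
    + 2%:R^-1 *: ham a (ham b (val f)).
  by rewrite /ladder linearD /= hamM hamZ ham_X mul_mpolyC.
have -> : 4%:R^-1 = 2%:R^-1 * 2%:R^-1 :> C by rewrite -invfM -natrM.
rewrite ham_comm.
rewrite {1}/ladder.
rewrite e.
symmetry.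
exact: ladder_expand.
Qed.
End LadderOperators.

Lemma lie_derivativePl (R : realType) (lam c : R[i]) v w f :
  lie_derivative lam (c *: v + w) f = c *: lie_derivative lam v f + lie_derivative lam w f.
Proof.
rewrite /lie_derivative derivD derivZ !mulrDl -!scalerAl !scalerDr !scalerA [lam * c]mulrC.
by rewrite addrACA.
Qed.

Lemma lie_derivativePr (R : realType) (lam c : R[i]) v f g :
  lie_derivative lam v (c *: f + g) = c *: lie_derivative lam v f + lie_derivative lam v g.
Proof.
rewrite /lie_derivative derivD derivZ !mulrDr -!scalerAr !scalerDr !scalerA [lam * c]mulrC.
by rewrite addrACA.
Qed.

(** The chart where ['X_a] is invertible, with the quotient of ['X_a'] by ['X_a]
    as coordinate.  Exchanging the two variables changes the sign [s] of their
    Poisson bracket, so both charts are covered. *)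
Section Chart.
Variables (R : realType) (a a' : 'I_(1 + 1)) (s : R[i]).
Local Notation C := R[i].
Local Notation A := (Aeven R 1).
Local Notation sp1 := (sp R 1).
Hypotheses (aa' : a != a') (cover : forall b, b = a \/ b = a') (s2 : s * s = 1)
  (ham_a : forall f : {mpoly C[1 + 1]}, ham a f = s *: f^`M(a'))
  (ham_a' : forall f : {mpoly C[1 + 1]}, ham a' f = - (s *: f^`M(a)))
  (omega_aa' : Omega R 1 a a' = s) (omega_aa : Omega R 1 a a = 0)
  (omega_a'a' : Omega R 1 a' a' = 0).
Implicit Types (f g : A) (q : sp1).

Let h : C := s * 2%:R^-1.

Definition section_of f : {poly C} := even_part s (model a a' h (val f)).

Lemma section_ofP c f g : section_of (c *: f + g) = c *: section_of f + section_of g.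
Proof. by rewrite /section_of -[val _]/(c *: val f + val g) modelP even_partP. Qed.

(** The vector field of [vfield_x] for [s = 1], and of [vfield_y] for
    [s = -1]. *)
Definition chart_field q : {poly C} :=
  (s * 2%:R) *: mmap (@polyC C) (fun b => if b == a then 1 else 'X) (val q).

Lemma chart_field_quad b c : chart_field (quad R b c) =
  (s * 2%:R) *: ((if b == a then 1 else 'X) * (if c == a then 1 else 'X)).
Proof. by rewrite /chart_field [val _]/('X_b * 'X_c) rmorphM /= !mmapX !mmap1U. Qed.

Lemma chart_fieldP c q q' : chart_field (c *: q + q') = c *: chart_field q + chart_field q'.
Proof.
rewrite /chart_field -[val _]/(c *: val q + val q') mmapD mmapZ mul_polyC scalerDr.
by rewrite !scalerA [c * _]mulrC.
Qed.

Let model_ladder_a (p : {mpoly C[1 + 1]}) :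
  model a a' h (ladder a p) = s *: (model a a' h p)^`().
Proof.
by rewrite /ladder ham_a scalerA [2%:R^-1 * s]mulrC model_annihilator //; congr (_ *: _);
  rewrite /h; field.
Qed.

Let model_ladder_a' (p : {mpoly C[1 + 1]}) :
  model a a' h (ladder a' p) = 'X * model a a' h p.
Proof.
by rewrite /ladder ham_a' scalerN scalerA [2%:R^-1 * s]mulrC model_creator.
Qed.

Lemma section_of_quad b c f : section_of (weyl (momentum (quad R b c)) f) =
  even_part s (model a a' h (ladder b (ladder c (val f)))
               - (2%:R^-1 * Omega R 1 b c) *: model a a' h (val f)).
Proof.
by rewrite /section_of val_weyl_quad addrC -scaleNr modelP scaleNr addrC.
Qed.

(** By [val_weyl_quad] and the two model lemmas, the products by the quadratic
    monomials become the three operators of [even_part_deriv2],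
    [even_part_mulXX] and [even_part_mulX_deriv]; the quadratic polynomials are
    their linear combinations. *)
Lemma section_of_momentum q f :
  section_of (weyl (momentum q) f) = lie_derivative 4%:R^-1 (chart_field q) (section_of f).
Proof.
have a'a : (a' == a) = false by rewrite eq_sym (negPf aa').
have mixed : section_of (weyl (momentum (quad R a a')) f) =
    lie_derivative 4%:R^-1 (chart_field (quad R a a')) (section_of f).
  rewrite section_of_quad chart_field_quad eqxx a'a mul1r model_ladder_a model_ladder_a' omega_aa'.
  exact: even_part_mulX_deriv.
have quad_section b c : section_of (weyl (momentum (quad R b c)) f) =
    lie_derivative 4%:R^-1 (chart_field (quad R b c)) (section_of f).
  case: (cover b) (cover c) => -> [] ->; last 1 first; last 1 first.
  - have -> : quad R a' a = quad R a a' by apply: val_inj; rewrite /= mulrC.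
    exact: mixed.
  - rewrite section_of_quad chart_field_quad a'a omega_a'a' mulr0 scale0r subr0 !model_ladder_a'.
    exact: even_part_mulXX.
  - rewrite section_of_quad chart_field_quad eqxx omega_aa mulr0 scale0r subr0 !model_ladder_a.
    rewrite derivZ scalerA s2 scale1r mul1r alg_polyC.
    exact: even_part_deriv2.
  - exact: mixed.
rewrite [q]sp_quadE.
pose good q := section_of (weyl (momentum q) f) =
  lie_derivative 4%:R^-1 (chart_field q) (section_of f).
have goodP c x y : good x -> good y -> good (c *: x + y).
  by rewrite /good momentumP weylPl section_ofP chart_fieldP lie_derivativePl => -> ->.
have good0 : good 0.
  by rewrite -(addNr (quad R a a)) -scaleN1r; exact: goodP (quad_section _ _) (quad_section _ _).
apply: (big_rec good) => [|b x _ gx]; first exact: good0.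
rewrite -[X in X + x]scale1r; apply: (goodP _ _ _ _ gx).
apply: (big_rec good) => [|c y _ gy]; first exact: good0.
exact: goodP (quad_section _ _) gy.
Qed.

Lemma model_Xa' k : model a a' h 'X_[U_(a') *+ k] = 'X^k.
Proof.
rewrite /model linextX /model_term !mulmnE !mnm1E eqxx [a' == a]eq_sym (negPf aa').
by rewrite mul0n mul1n expr0 ffactn0 mul1r scale1r subn0.
Qed.

Lemma section_of_onto v : exists f, section_of f = v.
Proof.
have [g <-] := even_part_onto s2 v.
have fe : \sum_(i < size g) g`_(2 * i) *: 'X_[U_(a') *+ (2 * i)] \in @parity_mpoly R 1 false.
  apply: rpred_sum => i _; apply: rpredZ; apply/parity_mpolyP => m.
  rewrite mcoeffX; have [<- _|_] := eqVneq _ m; last by rewrite eqxx.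
  by rewrite mdegMn mdeg1 mul1n oddM.
exists (AEven fe); apply/polyP => j; rewrite /section_of !coef_even_part; congr (_ * _).
have modelE I (r : seq I) (c : I -> C) (F : I -> {mpoly C[1 + 1]}) :
    model a a' h (\sum_(i <- r) c i *: F i) = \sum_(i <- r) c i *: model a a' h (F i).
  elim: r => [|i r IH]; first by rewrite !big_nil; apply: linext0.
  by rewrite !big_cons modelP IH.
have -> : model a a' h (val (AEven fe)) = \sum_(i < size g) g`_(2 * i) *: 'X^(2 * i).
  by rewrite /= modelE; apply: eq_bigr => i _; rewrite model_Xa'.
rewrite coef_sum; under eq_bigr => i _ do rewrite coefZ coefXn eqn_pmul2l //.
(* The sum contains every even coefficient of [g], as [j < size g] whenever the
   coefficient of index [2 * j] is non-zero. *)
have [jg|gj] := ltnP j (size g); last first.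
  rewrite nth_default; last by apply: leq_trans gj _; rewrite leq_pmull.
  by apply: big1 => i _; rewrite gtn_eqF ?mulr0 // (leq_trans (ltn_ord i)).
rewrite (bigD1 (Ordinal jg)) //= eqxx mulr1 big1 ?addr0 // => i.
by rewrite -val_eqE /= eq_sym => /negPf ->; rewrite mulr0.
Qed.

Definition chart_action q : {poly C} -> {poly C} := lie_derivative 4%:R^-1 (chart_field q).

Let section_ofB f g : section_of (f - g) = section_of f - section_of g.
Proof. by rewrite addrC -scaleN1r section_ofP scaleN1r addrC. Qed.

Let section_of0 : section_of 0 = 0.
Proof. by rewrite -(subrr 0) section_ofB subrr. Qed.

Let weylBl f g k : weyl (f - g) k = weyl f k - weyl g k.
Proof. by rewrite addrC -scaleN1r weylPl scaleN1r addrC. Qed.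

Lemma section_of_commutator q g f :
  section_of (weyl (even_poisson (momentum q) g) f) =
  chart_action q (section_of (weyl g f)) - section_of (weyl g (weyl (momentum q) f)).
Proof.
by rewrite -weyl_commutator weylBl section_ofB -!weylA section_of_momentum.
Qed.

Lemma chart_actionPl c x y v :
  chart_action (c *: x + y) v = c *: chart_action x v + chart_action y v.
Proof. by rewrite /chart_action chart_fieldP lie_derivativePl. Qed.

(** The Lie derivatives represent the Lie algebra because they are carried
    by [section_of], which is onto, from the left Moyal products. *)
Lemma chart_action_lie x y v : chart_action (@sp_lie R 1 x y) v =
  chart_action x (chart_action y v) - chart_action y (chart_action x v).
Proof.
have [f <-] := section_of_onto v.
by rewrite /chart_action -!section_of_momentum momentum_lie weylBl section_ofB -!weylA.
Qed.

Lemma env_act_section u f : env_act chart_action u (section_of f) =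
  section_of (weyl (@weyl_hom R 1 u) f).
Proof.
rewrite -env_act_hom; [|exact: weylPl|exact: weylA|exact: weyl1l].
symmetry; apply: env_act_intertwine; first exact: section_ofP.
exact: section_of_momentum.
Qed.

Let mnm_eq (m m' : 'X_{1..1 + 1}) : m a = m' a -> m a' = m' a' -> m = m'.
Proof. by move=> ea ea'; apply/mnmP => b; case: (cover b) => ->. Qed.

(** Without the variable ['X_a], [section_of] only rescales the coefficients
    by non-zero factors. *)
Lemma section_of_faithful_base g : (val g)^`M(a) = 0 -> section_of g = 0 -> g = 0.
Proof.
move=> ga g0; apply: val_inj; apply/mpolyP => m; rewrite mcoeff0; apply/eqP.
have supp mu : mu \in msupp (val g) -> mu a = 0%N.
  rewrite mcoeff_msupp; apply: contraNeq => mua.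
  have := congr1 (mcoeff (mu - U_(a))%MM) ga.
  rewrite mcoeff_mderiv mcoeff0 submK ?lep1mP // => /eqP; rewrite mulrn_eq0.
  by rewrite mnmBE mnm1E eqxx /=.
have [mg|] := boolP (m \in msupp (val g)); last by move/memN_msupp_eq0 ->.
have /(parity_mpolyP _ _ (valP g)) : (val g)@_m != 0 by rewrite -mcoeff_msupp.
rewrite mdegE (bigD1 a) //= (bigD1 a') 1?eq_sym //= (supp _ mg) add0n big1 ?addn0; last first.
  by move=> b /andP[]; case: (cover b) => ->; rewrite eqxx.
move=> m_even; have := congr1 (fun p : {poly C} => p`_(m a')./2) g0.
have e2 : (2 * (m a')./2 = m a')%N by rewrite mul2n -[RHS]odd_double_half m_even.
have s0 : s != 0 by apply: contraTneq (oner_neq0 C) => s0; rewrite -s2 s0 mul0r eqxx.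
rewrite coef_even_part e2 coef0 => /eqP; rewrite !mulf_eq0 expf_eq0 (negPf s0) andbF /=.
rewrite pnatr_eq0 eqn0Ngt odd_fact_gt0 /= => /eqP.
rewrite /model /linext coef_sum (bigD1_seq m) ?msupp_uniq //= big1_seq => [|mu /andP[mum mus]].
  by rewrite /model_term (supp _ mg) expr0 ffactn0 mul1r scale1r subn0 coefZ coefXn eqxx mulr1 addr0 => ->.
rewrite /model_term (supp _ mus) expr0 ffactn0 mul1r scale1r subn0 coefZ coefXn.
case: eqP => [e|_]; last by rewrite mulr0.
by case/eqP: mum; apply: mnm_eq; rewrite ?(supp _ mg) ?(supp _ mus).
Qed.

(** The polynomials [g] whose left products have zero image form a subspace
    stable under the bracket with ['X_a' * 'X_a'], which lowers the degree in
    ['X_a].  By induction on this degree the bracket is zero, so [g] does not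
    involve ['X_a], and its product by 1 has zero image. *)
Lemma section_of_faithful g : (forall f, section_of (weyl g f) = 0) -> g = 0.
Proof.
have [d] : exists d, forall m, m \in msupp (val g) -> (m a < d)%N.
  exists (\max_(m <- msupp (val g)) (m a).+1)%N => m mg.
  exact: (leq_bigmax_seq (F := fun m : 'X_{1..1 + 1} => (m a).+1)) mg _.
elim: d g => [|d IH] g gd g0.
  apply: val_inj; apply/mpolyP => m; rewrite mcoeff0; apply: memN_msupp_eq0.
  by apply/negP => /gd.
pose g' := even_poisson (momentum (quad R a' a')) g.
have g'E : val g' = (- (2%:R * s)) *: ('X_a' * (val g)^`M(a)).
  rewrite -[val g']/(bidiff 1 ('X_a' * 'X_a') (val g)) bidiffX.
  have -> : bidiff 1 'X_a' (val g) = ham a' (val g).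
    by rewrite -['X_a']mulr1 bidiffX !bidiff1l mul0r mulr0 add0r scale1r mul1r.
  rewrite scale1r /= ham_a' mulrN -scalerAr -mulr2n -scaler_nat scalerN scalerA scaleNr.
  by [].
have g'0 : g' = 0.
  apply: IH => [m|f]; last first.
    have act0 q : chart_action q 0 = 0 by rewrite /chart_action /lie_derivative deriv0 !mulr0 scaler0 addr0.
    by rewrite section_of_commutator !g0 act0 subrr.
  rewrite g'E => /msuppZ_le/msuppM_le/allpairsP[/= [m1 m2] [/=]].
  rewrite msuppX inE => /eqP -> m2g ->; rewrite mnmDE mnm1E eq_sym (negPf aa') add0n.
  have /gd : (m2 + U_(a))%MM \in msupp (val g); last first.
    by rewrite mnmDE mnm1E eqxx /=; lia.
  move: m2g; rewrite !mcoeff_msupp mcoeff_mderiv.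
  by apply: contraNneq => ->; rewrite mul0rn.
apply: section_of_faithful_base; last by rewrite -[g]weyl1r g0.
have s0 : s != 0 by apply: contraTneq (oner_neq0 C) => s0; rewrite -s2 s0 mul0r eqxx.
have := congr1 val g'0; rewrite g'E => /eqP; rewrite scaler_eq0 oppr_eq0 !mulf_eq0 pnatr_eq0 (negPf s0) /=.
case/orP => [/eqP/(congr1 (mcoeff U_(a')%MM))|/eqP //].
by rewrite mcoeffX eqxx mcoeff0 => /eqP; rewrite oner_eq0.
Qed.

Lemma chart_actionPr c x v w :
  chart_action x (c *: v + w) = c *: chart_action x v + chart_action x w.
Proof. exact: lie_derivativePr. Qed.

Lemma chart_action_extending : action_extending chart_action (env_act chart_action).
Proof.
split.
- by move=> c u v f; apply: env_actP; [exact: chart_actionPl|exact: chart_actionPr|exact: chart_action_lie].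
- by move=> f; apply: env_act1; [exact: chart_actionPl|exact: chart_actionPr|exact: chart_action_lie].
- by move=> u v f; apply: env_actM; [exact: chart_actionPl|exact: chart_actionPr|exact: chart_action_lie].
- by move=> x f; apply: env_act_iota; [exact: chart_actionPl|exact: chart_actionPr|exact: chart_action_lie].
Qed.

Lemma chart_kernel rho u : action_extending chart_action rho ->
  (forall v, rho u v = 0) <-> weyl_hom u = 0.
Proof.
case=> rhoP rho1 rhoM rho_iota.
have rhoE v : rho u v = env_act chart_action u v.
  apply: env_act_unique => //; [exact: chart_actionPl|exact: chart_actionPr|exact: chart_action_lie].
split=> [u0|u0 v].
  by apply: section_of_faithful => f; rewrite -env_act_section -rhoE u0.
have [f <-] := section_of_onto v; rewrite rhoE env_act_section u0.
have -> : weyl 0 f = 0 by have := weylBl 0 0 f; rewrite !subrr.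
exact: section_of0.
Qed.

End Chart.

Lemma action_extending_ext (R : realType) (act act' : sp R 1 -> {poly R[i]} -> {poly R[i]}) rho :
  (forall q v, act q v = act' q v) -> action_extending act rho -> action_extending act' rho.
Proof. by move=> e [hP h1 hM h]; split; [exact: hP|exact: h1|exact: hM|move=> x f;
  rewrite h e]. Qed.

Theorem weyl_kernel_J_lambda (R : realType) (u : env (@sp_lie R 1)) :
  J_lambda 4%:R^-1 u <-> weyl_hom u = 0.
Proof.
pose z : 'I_(1 + 1) := zi ord0; pose w : 'I_(1 + 1) := wi ord0.
have zw : z != w by [].
have cover b : b = z \/ b = w.
  by rewrite -(splitK b); case: split => i; [left|right]; rewrite (ord1 i).
have cover' b : b = w \/ b = z by case: (cover b); [right|left].
have ham_z1 (f : {mpoly R[i][1 + 1]}) : ham z f = 1 *: f^`M(w) by rewrite ham_zi scale1r.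
have ham_w1 (f : {mpoly R[i][1 + 1]}) : ham w f = - (1 *: f^`M(z)) by rewrite ham_wi scale1r.
have ham_wN (f : {mpoly R[i][1 + 1]}) : ham w f = (-1) *: f^`M(z) by rewrite ham_wi scaleN1r.
have ham_zN (f : {mpoly R[i][1 + 1]}) : ham z f = - (-1 *: f^`M(w)) by rewrite ham_zi scaleN1r opprK.
have omega_zz : Omega R 1 z z = 0 by rewrite block_mxEul mxE.
have omega_ww : Omega R 1 w w = 0 by rewrite block_mxEdr mxE.
have omega_zw : Omega R 1 z w = 1 by rewrite block_mxEur mxE eqxx.
have omega_wz : Omega R 1 w z = -1 by rewrite block_mxEdl !mxE eqxx.
have chart_x q v : @chart_action R z 1 q v = lie_derivative 4%:R^-1 (vfield_x q) v.
  by rewrite /chart_action /chart_field mul1r.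
have chart_y q v : @chart_action R w (-1) q v = lie_derivative 4%:R^-1 (vfield_y q) v.
  rewrite /chart_action /chart_field /vfield_y mulN1r scaleNr.
  congr (lie_derivative _ (- (_ *: mmap _ _ _)) _); apply: funext => b.
  by case: (cover b) => ->.
have mulNN1 : -1 * -1 = 1 :> R[i] by rewrite mulrNN mulr1.
have kernel_x rho := @chart_kernel R z w 1 zw cover (mulr1 1) ham_z1 ham_w1 omega_zw omega_zz omega_ww rho u.
have kernel_y rho := @chart_kernel R w z (-1) zw cover' mulNN1 ham_wN ham_zN omega_wz omega_ww omega_zz rho u.
split=> [[rho_x [rho_y [hx _ u0]]]|u0].
  apply/(kernel_x rho_x) => [|v]; last by have [] := u0 v.
  exact: action_extending_ext hx.
have hx : action_extending (@chart_action R z 1) (env_act (@chart_action R z 1)).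
  exact: (@chart_action_extending R z w 1 zw cover (mulr1 1) ham_z1 ham_w1 omega_zw omega_zz omega_ww).
have hy : action_extending (@chart_action R w (-1)) (env_act (@chart_action R w (-1))).
  exact: (@chart_action_extending R w z (-1) zw cover' mulNN1 ham_wN ham_zN omega_wz omega_ww omega_zz).
exists (env_act (@chart_action R z 1)), (env_act (@chart_action R w (-1))); split.
- exact: action_extending_ext hx.
- exact: action_extending_ext hy.
- by move=> v; split; [exact: (proj2 (kernel_x _ hx))|exact: (proj2 (kernel_y _ hy))].
Qed.

(** * The ideals corresponding to the Moyal product *)
Section MainResult.
Variables (R : realType) (n : nat).

Lemma kappa_surjective (f : Aeven R n) : exists s, kappa s = f.
Proof.
suff [s sf] : exists s, val (@kappa R n s) = val f by exists s; apply: val_inj.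
have [kP _ _ _] := kappa_hom R n.
rewrite [val f]mpolyE big_seq.
apply: (big_rec (fun p => exists s, val (@kappa R n s) = p)).
  by exists 0; rewrite (kappa0 R n) raddf0.
move=> m p; rewrite mcoeff_msupp => /(parity_mpolyP _ _ (valP f)) m_even [s <-].
have [|r rk re] := @mnm_quads R n (mdeg m)./2 m.
  by rewrite mul2n -[LHS]odd_double_half m_even.
exists ((val f)@_m *: sym_class (word r) + s).
by rewrite kP [val _]valD; congr (_ + _); rewrite -re -kappa_word.
Qed.

Lemma star_corresponds_weyl (J : env (@sp_lie R n) -> Prop) :
  (forall u, J u <-> weyl_hom u = 0) ->
  star_corresponds_to (@momentum R n) (@moyal R n) J.
Proof.
move=> Jw; exists (@weyl_hom R n); last exact: Jw.
have [phiP phi1 phiM phi_iota] := weyl_hom_alg R n; split=> // u v.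
by rewrite phiM weyl.unlock.
Qed.

End MainResult.

Theorem proposition5p1 (R : realType) (n : nat) (n_gt0 : (0 < n)%N)
    (O : {scalar sp R n} -> Prop) (O_min : minimal_nilpotent_orbit O) :
  [/\ orbit_functions_are_even O,
      graded_star_product (@even_poisson R n) (@even_deg R n) (@moyal R n)
      /\ equivariant_star (@even_poisson R n) (@momentum R n) (@moyal R n),
      (2 <= n)%N ->
        (exists2 J, ideal_with_gr O J
                  & star_corresponds_to (@momentum R n) (@moyal R n) J)
        /\ (forall J, joseph_ideal O J ->
              star_corresponds_to (@momentum R n) (@moyal R n) J),
      n = 1%N ->
        star_corresponds_to (@momentum R 1) (@moyal R 1)
          (@J_lambda R (4%:R^-1))
    & exists Lambda : sp R n -> Aeven R n -> Aeven R n,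
      [/\ forall x f, moyal (momentum x)%:P f%:P =
            (momentum x * f)%:P
            + (2%:R^-1 *: even_poisson (momentum x) f)%:P * 'X
            + (Lambda x f)%:P * 'X^2,
          forall x, diff_op 2 (Lambda x),
          forall x, x != 0 -> ~ diff_op 1 (Lambda x)
        & forall (i j : 'I_n) (f : Aeven R n),
          [/\ val (Lambda (quad R (zi i) (zi j)) f)
                = 4%:R^-1 *: (val f)^`M(wi j)^`M(wi i),
              val (Lambda (quad R (wi i) (wi j)) f)
                = 4%:R^-1 *: (val f)^`M(zi j)^`M(zi i)
            & val (Lambda (quad R (zi i) (wi j)) f)
                = - (4%:R^-1 *: (val f)^`M(zi j)^`M(wi i))]]].
Proof.
have ker_gr s := weyl_kernel_gr s n_gt0 O_min.
have ker_ideal : ideal_with_gr O (fun u => weyl_hom u = 0).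
  by split; [exact: weyl_kernel_ideal|exact: ker_gr].
split.
- exists (@kappa R n); split; [exact: kappa_hom|exact: kappa_surjective|move=> s].
  exact: kappa_eq0.
- by split; [exact: moyal_graded|exact: moyal_equivariant].
- move=> _; split.
    exists (fun u => weyl_hom u = 0); first exact: ker_ideal.
    exact: star_corresponds_weyl.
  move=> J [_ J_unique]; apply: star_corresponds_weyl => u.
  by apply: iff_sym; apply: J_unique ker_ideal u.
- by move=> _; apply: star_corresponds_weyl; apply: weyl_kernel_J_lambda.
exists (@lambda R n); split.
- exact: moyal_momentum.
- exact: lambda_diff_op2.
- exact: lambda_not_diff_op1.
- exact: lambda_quad.
Qed.
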